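(* Let $B_\lambda,B_\mu,B_\sigma,B_\omega,B_\theta,B_{\lambda'},B_{\mu'}>0$ be arbitrarily large and let $\epsilon>0$. Then there exists a neural operator $\hat{\mathcal M}:(C^1[0,1])^2\times(C^0[0,1])^3\times\mathbb R\to (C^1(\mathcal T))^2\times(C^0(\mathcal T))^2\times(C^0[0,1])^2\times(C^0(\mathcal T))^4\times(C^0[0,1])^2$ such that $$|\mathcal M(\lambda,\mu,\sigma,\omega,\theta,q)(x,\xi)-\hat{\mathcal M}(\lambda,\mu,\sigma,\omega,\theta,q)(x,\xi)|<\epsilon,\qquad (x,\xi)\in\mathcal T,$$ holds for all Lipschitz $\lambda,\mu,\sigma,\omega,\theta$ (with $\lambda,\mu$ having Lipschitz derivatives) and $q\in\mathbb R$ such that $\|\lambda\|_\infty\le B_\lambda$, $\|\mu\|_\infty\le B_\mu$, $\|\sigma\|_\infty\le B_\sigma$, $\|\omega\|_\infty\le B_\omega$, $\|\theta\|_\infty\le B_\theta$, $\|\lambda'\|_\infty\le B_{\lambda'}$, $\|\mu'\|_\infty\le B_{\mu'}$. Namely, there exists a neural operator $\hat{\mathcal K}$ such that, with $(\hat k_1,\hat k_2,\hat m_1,\hat m_2)=\hat{\mathcal K}(\lambda,\mu,\sigma,\omega,\theta,q)$, $\tilde k_i=k_i-\hat k_i$, $\tilde m_i=m_i-\hat m_i$ ($i=1,2$), $\tilde c=c-\hat c$, $\tilde\kappa=\kappa-\hat\kappa$, for all such coefficients and all $(x,\xi)\in\mathcal T$, $$\begin{aligned}&|\tilde k_1(x,\xi)|+|\tilde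 k_2(x,\xi)|+|\tilde c(x,\xi)|+|\tilde\kappa(x,\xi)|+|(\lambda(x)+\mu(x))\tilde k_1(x,x)|+|\lambda(0)q\tilde k_1(x,0)-\mu(0)\tilde k_2(x,0)|\\&+|-\mu(x)\partial_x\tilde k_1+\lambda(\xi)\partial_\xi\tilde k_1+\lambda'(\xi)\tilde k_1+\sigma(\xi)\tilde k_1+\theta(\xi)\tilde k_2|+|-\mu(x)\partial_x\tilde k_2-\mu(\xi)\partial_\xi\tilde k_2-\mu'(\xi)\tilde k_2+\omega(\xi)\tilde k_1|\\&+|\lambda(x)\partial_x\tilde m_1-\mu(\xi)\partial_\xi\tilde m_1-\mu'(\xi)\tilde m_1-\sigma(x)\tilde m_1-\omega(x)\tilde m_2|+|\mu(x)\partial_x\tilde m_2+\mu(\xi)\partial_\xi\tilde m_2+\mu'(\xi)\tilde m_2+\theta(x)\tilde m_1|<\epsilon .\end{aligned}$$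
   Context: Coefficients: $\lambda,\mu\in C^1([0,1])$, $\sigma,\omega,\theta\in C^0([0,1])$, $q\in\mathbb R$, with $\lambda(x),\mu(x)>0$ on $[0,1]$ and $\underline\lambda\le\lambda\le\bar\lambda$, $\underline\mu\le\mu\le\bar\mu$, $\underline\sigma\le\sigma\le\bar\sigma$, $\underline\omega\le\omega\le\bar\omega$, $\underline\theta\le\theta\le\bar\theta$ for constants with $\underline\lambda,\underline\mu>0$. Let $\mathcal T=\{(x,\xi):0\le\xi\le x\le1\}$; $\|\cdot\|_\infty$ is the supremum norm. Kernels: $(k_1,k_2)$ and $(m_1,m_2)$ are the unique $C^1(\mathcal T)$ solutions of the Goursat systems on $\mathcal T$ $\mu(x)\partial_xk_1-\lambda(\xi)\partial_\xi k_1=\lambda'(\xi)k_1+\sigma(\xi)k_1+\theta(\xi)k_2$, $\ \mu(x)\partial_xk_2+\mu(\xi)\partial_\xi k_2=-\mu'(\xi)k_2+\omega(\xi)k_1$, $\ k_1(x,x)=-\frac{\theta(x)}{\lambda(x)+\mu(x)}$, $\ \mu(0)k_2(x,0)=q\lambda(0)k_1(x,0)$; $\lambda(x)\partial_xm_1-\mu(\xi)\partial_\xi m_1=\mu'(\xi)m_1+\sigma(x)m_1+\omega(x)m_2$, $\ \mu(x)\partial_xm_2+\mu(\xi)\partial_\xi m_2=-\mu'(\xi)m_2-\theta(x)m_1$, $\ m_1(x,x)=\frac{\omega(x)}{\lambda(x)+\mu(x)}$, $\ m_2(1,\xi)=0$. The functions $\kappa,c$ on $\mathcal T$ are given by $\kappa(x,\xi)=\omega(x)k_2(x,\xi)+\int_\xi^x\kappa(x,s)k_2(s,\xi)ds$,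 $c(x,\xi)=\omega(x)k_1(x,\xi)+\int_\xi^x\kappa(x,s)k_1(s,\xi)ds$; $\hat\kappa,\hat c$ are given by the same formulas with $k_i$ and $\kappa$ replaced by $\hat k_i$ and $\hat\kappa$. Operators: $\mathcal K(\lambda,\mu,\sigma,\omega,\theta,q)=(k_1,k_2,m_1,m_2)\in(C^1(\mathcal T))^4$, and $\mathcal M(\lambda,\mu,\sigma,\omega,\theta,q)=(k_1,k_2,c,\kappa,K_1,\dots,K_8)$, where $K_1(x)=(\lambda(x)+\mu(x))k_1(x,x)+\theta(x)$; $K_2(x)=-\lambda(0)qk_1(x,0)+\mu(0)k_2(x,0)$; $K_3(x,\xi)=-\mu(x)\partial_xk_1+\lambda(\xi)\partial_\xi k_1+\lambda'(\xi)k_1+\sigma(\xi)k_1+\theta(\xi)k_2$; $K_4(x,\xi)=-\mu(x)\partial_xk_2-\mu(\xi)\partial_\xi k_2-\mu'(\xi)k_2+\omega(\xi)k_1$; $K_5(x,\xi)=-\lambda(x)\partial_xm_1+\mu(\xi)\partial_\xi m_1+\mu'(\xi)m_1+\sigma(x)m_1+\omega(x)m_2$; $K_6(x,\xi)=\mu(x)\partial_xm_2+\mu(\xi)\partial_\xi m_2+\mu'(\xi)m_2+\theta(x)m_1$; $K_7(x)=m_1(x,x)(\lambda(x)+\mu(x))-\omega(x)$; $K_8(\xi)=m_2(1,\xi)$. A neural operator (DeepONet) is a map of the form, for each output component, $\hat{\mathcal G}(f)(y)=\sum_{j=1}^{p}g_j(f_{\mathrm{samp}})\,h_j(y)$, where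 $f_{\mathrm{samp}}$ is the vector of values of the input functions at finitely many fixed points of $[0,1]$ (together with the scalar inputs) and $g_j$ (branch), $h_j$ (trunk) are feedforward neural networks, smooth enough that the derivatives appearing in the statement exist.
   Formalization: The operator is uniform over coefficients with a fixed (arbitrary) common Lipschitz constant, fixed bound on |q| and fixed lower bounds on λ, μ; without the first two the claim is false. Only coefficients whose C¹ kernels exist are covered (this forces θ, ω to be C¹ relative to λ+μ). *)

(* Defs.v *)
(* Stdlib reals with Coquelicot. *)
From Stdlib Require Import Reals List.
From Coquelicot Require Import Coquelicot.
Import ListNotations.
Open Scope R_scope.

(** * Domains and function spaces *)

Definition I01 (x : R) : Prop := 0 <= x <= 1.

Definition T (x xi : R) : Prop := 0 <= xi <= x /\ x <= 1.

Definition T2 (p : R * R) : Prop := T (fst p) (snd p).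

(* Only the values on [I01], resp. [T], matter in the four types below.
   Derivatives are taken along the closed domain (one-sided at its boundary);
   both domains have enough interior directions at each of their points for the
   recorded derivatives to be determined there by the function. *)
Record C0_I : Type := {
  c0i :> R -> R;
  c0i_cont : continuous_on I01 c0i }.

Record C1_I : Type := {
  c1i :> R -> R;
  c1i' : R -> R;
  c1i_diff : forall x, I01 x ->
    filterdiff c1i (within I01 (locally x)) (fun h : R => h * c1i' x);
  c1i_cont : continuous_on I01 c1i' }.

Record C0_T : Type := {
  c0t :> R -> R -> R;
  c0t_cont : continuous_on T2 (fun p : R * R => c0t (fst p) (snd p)) }.

Record C1_T : Type := {
  c1t :> R -> R -> R;
  d_x : R -> R -> R;
  d_xi : R -> R -> R;
  c1t_diff : forall x xi, T x xi ->
    filterdiff (fun p : R * R => c1t (fst p) (snd p))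
      (within T2 (locally (x, xi)))
      (fun h : R * R => fst h * d_x x xi + snd h * d_xi x xi);
  d_x_cont : continuous_on T2 (fun p : R * R => d_x (fst p) (snd p));
  d_xi_cont : continuous_on T2 (fun p : R * R => d_xi (fst p) (snd p)) }.

(** * Coefficients *)

Record coefficients : Type := {
  lambda : C1_I;
  mu : C1_I;
  sigma : C0_I;
  omega : C0_I;
  theta : C0_I;
  q : R }.

Definition lambda' (f : coefficients) : R -> R := c1i' (lambda f).
Definition mu' (f : coefficients) : R -> R := c1i' (mu f).

Definition sup_le (B : R) (g : R -> R) : Prop :=
  forall x, I01 x -> Rabs (g x) <= B.

Definition lipschitz (L : R) (g : R -> R) : Prop :=
  forall x y, I01 x -> I01 y -> Rabs (g x - g y) <= L * Rabs (x - y).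

(* The constants of a coefficient class: the positive lower bounds of the
   transport speeds, the bounds on the sup norms, the common Lipschitz
   constant, and the bound on |q|. *)
Record class_constants : Type := {
  lambda_min : R; mu_min : R;
  B_lambda : R; B_mu : R; B_sigma : R; B_omega : R; B_theta : R;
  B_lambda' : R; B_mu' : R;
  Lip : R;
  B_q : R }.

Definition positive_constants (b : class_constants) : Prop :=
  0 < lambda_min b /\ 0 < mu_min b /\
  0 < B_lambda b /\ 0 < B_mu b /\ 0 < B_sigma b /\ 0 < B_omega b /\
  0 < B_theta b /\ 0 < B_lambda' b /\ 0 < B_mu' b /\
  0 < Lip b /\ 0 < B_q b.

Record in_class (b : class_constants) (f : coefficients) : Prop := {
  lambda_lower : forall x, I01 x -> lambda_min b <= lambda f x;
  mu_lower : forall x, I01 x -> mu_min b <= mu f x;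
  lambda_sup : sup_le (B_lambda b) (lambda f);
  mu_sup : sup_le (B_mu b) (mu f);
  sigma_sup : sup_le (B_sigma b) (sigma f);
  omega_sup : sup_le (B_omega b) (omega f);
  theta_sup : sup_le (B_theta b) (theta f);
  lambda'_sup : sup_le (B_lambda' b) (lambda' f);
  mu'_sup : sup_le (B_mu' b) (mu' f);
  lambda_lip : lipschitz (Lip b) (lambda f);
  mu_lip : lipschitz (Lip b) (mu f);
  sigma_lip : lipschitz (Lip b) (sigma f);
  omega_lip : lipschitz (Lip b) (omega f);
  theta_lip : lipschitz (Lip b) (theta f);
  lambda'_lip : lipschitz (Lip b) (lambda' f);
  mu'_lip : lipschitz (Lip b) (mu' f);
  q_bound : Rabs (q f) <= B_q b }.

(** * Backstepping kernels *)

Record kernels : Type := { k1 : C1_T; k2 : C1_T; m1 : C1_T; m2 : C1_T }.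

Record goursat_k (f : coefficients) (k1 k2 : C1_T) : Prop := {
  pde_k1 : forall x xi, T x xi ->
    mu f x * d_x k1 x xi - lambda f xi * d_xi k1 x xi
    = lambda' f xi * k1 x xi + sigma f xi * k1 x xi + theta f xi * k2 x xi;
  pde_k2 : forall x xi, T x xi ->
    mu f x * d_x k2 x xi + mu f xi * d_xi k2 x xi
    = - mu' f xi * k2 x xi + omega f xi * k1 x xi;
  bc_k1 : forall x, I01 x -> k1 x x = - (theta f x / (lambda f x + mu f x));
  bc_k2 : forall x, I01 x -> mu f 0 * k2 x 0 = q f * lambda f 0 * k1 x 0 }.

Record goursat_m (f : coefficients) (m1 m2 : C1_T) : Prop := {
  pde_m1 : forall x xi, T x xi ->
    lambda f x * d_x m1 x xi - mu f xi * d_xi m1 x xi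
    = mu' f xi * m1 x xi + sigma f x * m1 x xi + omega f x * m2 x xi;
  pde_m2 : forall x xi, T x xi ->
    mu f x * d_x m2 x xi + mu f xi * d_xi m2 x xi
    = - mu' f xi * m2 x xi - theta f x * m1 x xi;
  bc_m1 : forall x, I01 x -> m1 x x = omega f x / (lambda f x + mu f x);
  bc_m2 : forall xi, I01 xi -> m2 1 xi = 0 }.

(* The graph of the operator K. *)
Definition is_K (f : coefficients) (k : kernels) : Prop :=
  goursat_k f (k1 k) (k2 k) /\ goursat_m f (m1 k) (m2 k).

Definition is_kappa (f : coefficients) (k : kernels) (kappa : C0_T) : Prop :=
  forall x xi, T x xi ->
    kappa x xi
    = omega f x * k2 k x xi + RInt (fun s => kappa x s * k2 k s xi) xi x.

Definition c_of (f : coefficients) (k : kernels) (kappa : C0_T) (x xi : R) : R :=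
  omega f x * k1 k x xi + RInt (fun s => kappa x s * k1 k s xi) xi x.

(** * Components of the operators K and M *)

Inductive K_index : Type := K_k1 | K_k2 | K_m1 | K_m2.

Definition K_value (k : kernels) (i : K_index) : C1_T :=
  match i with K_k1 => k1 k | K_k2 => k2 k | K_m1 => m1 k | K_m2 => m2 k end.

Inductive M_index : Type :=
  | M_k1 | M_k2 | M_c | M_kappa
  | M_K1 | M_K2 | M_K3 | M_K4 | M_K5 | M_K6 | M_K7 | M_K8.

Definition M_indices : list M_index :=
  [M_k1; M_k2; M_c; M_kappa; M_K1; M_K2; M_K3; M_K4; M_K5; M_K6; M_K7; M_K8].

Definition M_value (f : coefficients) (k : kernels) (kappa : C0_T)
    (i : M_index) (x xi : R) : R :=
  match i with
  | M_k1 => k1 k x xi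
  | M_k2 => k2 k x xi
  | M_c => c_of f k kappa x xi
  | M_kappa => kappa x xi
  | M_K1 => (lambda f x + mu f x) * k1 k x x + theta f x
  | M_K2 => - lambda f 0 * q f * k1 k x 0 + mu f 0 * k2 k x 0
  | M_K3 => - mu f x * d_x (k1 k) x xi + lambda f xi * d_xi (k1 k) x xi
            + lambda' f xi * k1 k x xi + sigma f xi * k1 k x xi
            + theta f xi * k2 k x xi
  | M_K4 => - mu f x * d_x (k2 k) x xi - mu f xi * d_xi (k2 k) x xi
            - mu' f xi * k2 k x xi + omega f xi * k1 k x xi
  | M_K5 => - lambda f x * d_x (m1 k) x xi + mu f xi * d_xi (m1 k) x xi
            + mu' f xi * m1 k x xi + sigma f x * m1 k x xi
            + omega f x * m2 k x xi
  | M_K6 => mu f x * d_x (m2 k) x xi + mu f xi * d_xi (m2 k) x xi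
            + mu' f xi * m2 k x xi + theta f x * m1 k x xi
  | M_K7 => m1 k x x * (lambda f x + mu f x) - omega f x
  | M_K8 => m2 k 1 xi
  end.

(* The point at which a component is evaluated: some components of M are
   functions of x alone or of xi alone. *)
Definition K_point (i : K_index) (x xi : R) : list R := [x; xi].

Definition M_point (i : M_index) (x xi : R) : list R :=
  match i with
  | M_K1 | M_K2 | M_K7 => [x]
  | M_K8 => [xi]
  | _ => [x; xi]
  end.

Definition K_dim (i : K_index) : nat := length (K_point i 0 0).
Definition M_dim (i : M_index) : nat := length (M_point i 0 0).

(** * Neural operators *)

(* Vectors of R^n are functions on nat of which only the first n values are
   used. *)
Fixpoint sum_below (n : nat) (g : nat -> R) : R :=
  match n with O => 0 | S m => sum_below m g + g m end.

(* Scalar-valued feedforward networks on R^n, of arbitrary depth and widths: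
   [Hidden n m W b N] feeds a hidden layer of m neurons into N. *)
Inductive fnn : nat -> Type :=
  | Output (n : nat) (w : nat -> R) (b : R) : fnn n
  | Hidden (n m : nat) (W : nat -> nat -> R) (b : nat -> R) (N : fnn m) : fnn n.

Fixpoint fnn_eval (act : R -> R) (n : nat) (N : fnn n) (v : nat -> R) : R :=
  match N with
  | Output n w b => sum_below n (fun j => w j * v j) + b
  | Hidden n m W b N' =>
      fnn_eval act m N'
        (fun i => act (sum_below n (fun j => W i j * v j) + b i))
  end.

(* C-infinity: differentiable to every order, everywhere. *)
Definition smooth (act : R -> R) : Prop := forall n x, ex_derive_n act n x.

Definition polynomial_function (act : R -> R) : Prop :=
  exists (n : nat) (c : nat -> R),
    forall x, act x = sum_below n (fun i => c i * x ^ i).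

Definition admissible_activation (act : R -> R) : Prop :=
  smooth act /\ ~ polynomial_function act.

Record deeponet (s d : nat) : Type := {
  width : nat;
  branch : nat -> fnn s;
  trunk : nat -> fnn d }.

Arguments width {s d} _.
Arguments branch {s d} _ _.
Arguments trunk {s d} _ _.

Definition coords (l : list R) (i : nat) : R := nth i l 0.

Definition deeponet_eval (act : R -> R) {s d : nat} (D : deeponet s d)
    (u y : list R) : R :=
  sum_below (width D) (fun j =>
    fnn_eval act s (branch D j) (coords u) *
    fnn_eval act d (trunk D j) (coords y)).

Definition sampled (pts : list R) (f : coefficients) : list R :=
  map (lambda f) pts ++ map (mu f) pts ++ map (sigma f) pts
  ++ map (omega f) pts ++ map (theta f) pts ++ [q f].

Definition sampled_dim (pts : list R) : nat := (5 * length pts + 1)%nat.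

(* One DeepONet per output component, all reading the same samples. *)
Record neural_operator (I : Type) (dim : I -> nat) : Type := {
  sample_points : list R;
  sample_points_in : List.Forall I01 sample_points;
  component : forall i : I, deeponet (sampled_dim sample_points) (dim i) }.

Arguments sample_points {I dim} _.
Arguments component {I dim} _ _.

Definition operator_eval (act : R -> R) {I : Type} {dim : I -> nat}
    (O : neural_operator I dim) (f : coefficients) (i : I) (y : list R) : R :=
  deeponet_eval act (component O i) (sampled (sample_points O) f) y.

(* [kh] is the image of [f] under the neural operator [O], as an element of
   C^1(T)^4. *)
Definition is_K_hat (act : R -> R) (O : neural_operator K_index K_dim)
    (f : coefficients) (kh : kernels) : Prop :=
  forall i x xi, T x xi ->
    K_value kh i x xi = operator_eval act O f i (K_point i x xi).

(** * Approximation errors *)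

(* The norm of the error in R^12 is the l^1 norm. *)
Definition M_error (act : R -> R) (O : neural_operator M_index M_dim)
    (f : coefficients) (k : kernels) (kappa : C0_T) (x xi : R) : R :=
  fold_right Rplus 0
    (map (fun i => Rabs (M_value f k kappa i x xi
                         - operator_eval act O f i (M_point i x xi)))
         M_indices).

Definition K_error (f : coefficients) (k kh : kernels) (kappa kappah : C0_T)
    (x xi : R) : R :=
  let tk1 := fun x xi => k1 k x xi - k1 kh x xi in
  let tk2 := fun x xi => k2 k x xi - k2 kh x xi in
  let tm1 := fun x xi => m1 k x xi - m1 kh x xi in
  let tm2 := fun x xi => m2 k x xi - m2 kh x xi in
  let tc := fun x xi => c_of f k kappa x xi - c_of f kh kappah x xi in
  let tkappa := fun x xi => kappa x xi - kappah x xi in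
  let tk1_x := fun x xi => d_x (k1 k) x xi - d_x (k1 kh) x xi in
  let tk1_xi := fun x xi => d_xi (k1 k) x xi - d_xi (k1 kh) x xi in
  let tk2_x := fun x xi => d_x (k2 k) x xi - d_x (k2 kh) x xi in
  let tk2_xi := fun x xi => d_xi (k2 k) x xi - d_xi (k2 kh) x xi in
  let tm1_x := fun x xi => d_x (m1 k) x xi - d_x (m1 kh) x xi in
  let tm1_xi := fun x xi => d_xi (m1 k) x xi - d_xi (m1 kh) x xi in
  let tm2_x := fun x xi => d_x (m2 k) x xi - d_x (m2 kh) x xi in
  let tm2_xi := fun x xi => d_xi (m2 k) x xi - d_xi (m2 kh) x xi in
  Rabs (tk1 x xi) + Rabs (tk2 x xi) + Rabs (tc x xi) + Rabs (tkappa x xi)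
  + Rabs ((lambda f x + mu f x) * tk1 x x)
  + Rabs (lambda f 0 * q f * tk1 x 0 - mu f 0 * tk2 x 0)
  + Rabs (- mu f x * tk1_x x xi + lambda f xi * tk1_xi x xi
          + lambda' f xi * tk1 x xi + sigma f xi * tk1 x xi
          + theta f xi * tk2 x xi)
  + Rabs (- mu f x * tk2_x x xi - mu f xi * tk2_xi x xi
          - mu' f xi * tk2 x xi + omega f xi * tk1 x xi)
  + Rabs (lambda f x * tm1_x x xi - mu f xi * tm1_xi x xi
          - mu' f xi * tm1 x xi - sigma f x * tm1 x xi
          - omega f x * tm2 x xi)
  + Rabs (mu f x * tm2_x x xi + mu f xi * tm2_xi x xi
          + mu' f xi * tm2 x xi + theta f x * tm1 x xi).

(* Main.v *)
Require Import Defs.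
From Stdlib Require Import Reals List Lra Lia Classical ClassicalEpsilon
  IndefiniteDescription FunctionalExtensionality.
From Coquelicot Require Import Coquelicot.
Import ListNotations.
Import Defs.
Open Scope R_scope.

(** Why the theorem is true.

    A coefficient of the class is Lipschitz with a fixed constant, so finitely
    many samples determine it up to a small error, its derivatives included
    ([samples_determine]).  Take finitely many coefficients [f_j] of the class,
    one near each point of a fine lattice of sample values, and a polynomial
    partition of unity [phi_j] on the space of samples.  The network
    [sum_j phi_j (samples of f) * (kernels of f_j)], with [phi_j] and the kernels
    of [f_j] replaced by networks, is up to a small error a convex combination of
    kernels of coefficients close to [f] ([convex_approximation]).  It remains to
    see that such a combination meets all the error bounds for [f].

    For the values of the kernels this is stability of the Goursat systems in the
    sup norm ([kernels_stability]); [kappa] and [c] follow by a Gronwall argument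
    for Volterra equations ([kappa_c_stability]).  For the terms of the error that
    contain derivatives no stability in C1 is needed.  The exact kernels of [f]
    have residual zero, and the residual of the kernels of [f_j] in the equations
    of [f] is a difference of coefficients times first derivatives of these
    kernels: it is small as soon as those derivatives are bounded uniformly over
    the class ([kernels_C1_bound], [residual_small]).  Since residuals are linear,
    convex combinations inherit the bound.  In the operator M the eight residual
    components are even identically zero.

    So two facts about Goursat systems carry the proof, a bound in C1 and
    stability in C0, both uniform over the class.  They are obtained from the
    maximum principle [max_principle], without integrating along
    characteristics: at a maximum of a function damped by [exp (- N x)], the
    derivative along the backward characteristic direction has a sign, which
    contradicts the equation unless the maximum is controlled by the data.  The
    Lipschitz bound in [x] applies this principle to
    [(u x xi - u y xi) / (x - y + h)] on the doubled domain
    [0 <= xi <= y <= x <= 1]; the derivative in [xi] is then read off the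
    equations.  The reflection [(x, xi) -> (1 - xi, 1 - x)] turns the system of
    [m1, m2] into one of the same form as that of [k1, k2].

    On the side of approximation, difference quotients in the weights of
    [act (w . v + b)] produce all monomials, with their gradients, because no
    derivative of a smooth function that is not a polynomial vanishes identically
    ([net_approx_ridge]).  Polynomials reach C1 functions on the triangle
    through Bernstein polynomials of the simplex, whose derivatives only involve
    differences along edges ([expect_is_poly], [net_approx_C1_T]); the same
    polynomials on a simplex that contains the cube of samples are the partition
    of unity ([cube_partition]). *)

(** * Continuity, differentiability and compactness on the triangle *)

(** Continuity and differentiability of the data on the closed triangle, in the
    epsilon-delta form that the estimates use. *)
Definition cont_T (u : R -> R -> R) : Prop :=
  forall x xi, T x xi -> forall eps, 0 < eps -> exists del, 0 < del /\
    forall x' xi', T x' xi' -> Rabs (x' - x) < del -> Rabs (xi' - xi) < del ->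
      Rabs (u x' xi' - u x xi) < eps.

Definition diff_T (u ux uxi : R -> R -> R) : Prop :=
  forall x xi, T x xi -> forall eps, 0 < eps -> exists del, 0 < del /\
    forall x' xi', T x' xi' -> Rabs (x' - x) < del -> Rabs (xi' - xi) < del ->
      Rabs (u x' xi' - u x xi - ((x' - x) * ux x xi + (xi' - xi) * uxi x xi))
      <= eps * (Rabs (x' - x) + Rabs (xi' - xi)).

Lemma continuous_on_T2 (u : R -> R -> R) :
  continuous_on T2 (fun p : R * R => u (fst p) (snd p)) <-> cont_T u.
Proof.
  split.
  - intros H x xi Hx eps Heps.
    specialize (H (x, xi) Hx).
    apply filterlim_locally with (eps := mkposreal eps Heps) in H.
    destruct H as [del Hd].
    exists del. split. apply cond_pos.
    intros x' xi' HT H1 H2.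
    exact (Hd (x', xi') (conj H1 H2) HT).
  - intros H [x xi] Hx.
    apply filterlim_locally. intros eps.
    destruct (H x xi Hx eps (cond_pos eps)) as [del [Hd H']].
    exists (mkposreal del Hd). intros [x' xi'] [H1 H2] HT.
    apply H'; assumption.
Qed.

Lemma C0_T_cont (u : C0_T) : cont_T u.
Proof. apply continuous_on_T2, c0t_cont. Qed.

Definition make_C0_T (u : R -> R -> R) (H : cont_T u) : C0_T :=
  Build_C0_T u (proj2 (continuous_on_T2 u) H).

Lemma prod_norm_bounds (a b : R) :
  norm ((a, b) : R * R) <= 2 * (Rabs a + Rabs b) /\
  Rabs a + Rabs b <= 2 * norm ((a, b) : R * R).
Proof.
  destruct (norm_prod (K := R_AbsRing) (U := R_NormedModule) (V := R_NormedModule) a b)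
    as [H1 H2].
  change (norm (a, b)) with (norm ((a, b) : R * R)) in H1, H2.
  change (norm a) with (Rabs a) in *. change (norm b) with (Rabs b) in *.
  pose proof (Rmax_l (Rabs a) (Rabs b)). pose proof (Rmax_r (Rabs a) (Rabs b)).
  assert (Hs : sqrt 2 <= 2).
  { rewrite <- (sqrt_square 2) at 2 by lra. apply sqrt_le_1_alt. lra. }
  pose proof (sqrt_pos 2). pose proof (Rabs_pos a). pose proof (Rabs_pos b).
  assert (Rmax (Rabs a) (Rabs b) <= Rabs a + Rabs b) by (apply Rmax_lub; lra).
  split; [|apply Rle_trans with (2 * Rmax (Rabs a) (Rabs b)); [lra|];
    apply Rmult_le_compat_l; [lra|exact H1]].
  eapply Rle_trans; [exact H2|].
  apply Rmult_le_compat; lra.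
Qed.

Lemma within_T2_lim (x xi : R) :
  T x xi -> is_filter_lim (within T2 (locally (x, xi))) (x, xi).
Proof.
  intros _ P HP. apply filter_le_within. exact HP.
Qed.

Lemma within_T2_lim_unique (x xi : R) (z : R * R) :
  T x xi -> is_filter_lim (within T2 (locally (x, xi))) z -> z = (x, xi).
Proof.
  intros HT Hz.
  symmetry.
  apply (@is_filter_lim_unique R_AbsRing (prod_NormedModule R_AbsRing R_NormedModule R_NormedModule)
    (within T2 (locally (x, xi)))).
  - constructor.
    + intros [del Hd].
      refine (Hd (x, xi) _ HT). apply ball_center.
    + apply within_filter. apply locally_filter.
  - apply within_T2_lim, HT.
  - exact Hz.
Qed.

Lemma C1_T_diff (u : C1_T) : diff_T u (d_x u) (d_xi u).
Proof.
  intros x xi HT eps Heps.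
  destruct (c1t_diff u x xi HT) as [_ H].
  specialize (H (x, xi) (within_T2_lim x xi HT)).
  assert (He : 0 < eps / 2) by lra.
  destruct (H (mkposreal _ He)) as [del Hd].
  exists del. split; [apply cond_pos|].
  intros x' xi' HT' H1 H2.
  specialize (Hd (x', xi') (conj H1 H2) HT').
  simpl in Hd.
  destruct (prod_norm_bounds (x' - x) (xi' - xi)) as [Hn _].
  change (Rabs (minus (minus (u x' xi') (u x xi))
    (plus (mult (minus x' x) (d_x u x xi)) (mult (minus xi' xi) (d_xi u x xi))))
    <= eps / 2 * norm ((x' - x, xi' - xi) : R * R)) in Hd.
  change (Rabs (u x' xi' - u x xi - ((x' - x) * d_x u x xi + (xi' - xi) * d_xi u x xi))
    <= eps / 2 * norm ((x' - x, xi' - xi) : R * R)) in Hd.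
  eapply Rle_trans; [exact Hd|].
  apply Rle_trans with (eps / 2 * (2 * (Rabs (x' - x) + Rabs (xi' - xi)))).
  - apply Rmult_le_compat_l; lra.
  - lra.
Qed.

Lemma filterdiff_T2_of_diff_T (u ux uxi : R -> R -> R) (x xi : R) :
  diff_T u ux uxi -> T x xi ->
  filterdiff (fun p : R * R => u (fst p) (snd p)) (within T2 (locally (x, xi)))
    (fun h : R * R => fst h * ux x xi + snd h * uxi x xi).
Proof.
  intros H HT. split.
  - apply (is_linear_comp (fun h : R * R => (fst h * ux x xi, snd h * uxi x xi))
      (fun p : R * R => plus (fst p) (snd p))).
    + apply is_linear_prod.
      * apply (is_linear_comp fst (fun t : R => scal t (ux x xi))).
        apply is_linear_fst. apply (is_linear_scal_l (K := R_AbsRing) (V := R_NormedModule)).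
      * apply (is_linear_comp snd (fun t : R => scal t (uxi x xi))).
        apply is_linear_snd. apply (is_linear_scal_l (K := R_AbsRing) (V := R_NormedModule)).
    + apply (is_linear_plus (K := R_AbsRing) (V := R_NormedModule)).
  - intros z Hz. apply within_T2_lim_unique in Hz; [|exact HT]. subst z.
    intros eps.
    assert (He : 0 < eps / 2) by (pose proof (cond_pos eps); lra).
    destruct (H x xi HT _ He) as [del [Hd H']].
    exists (mkposreal del Hd). intros [x' xi'] [H1 H2] HT'.
    specialize (H' x' xi' HT' H1 H2).
    destruct (prod_norm_bounds (x' - x) (xi' - xi)) as [_ Hn].
    change (Rabs (u x' xi' - u x xi - ((x' - x) * ux x xi + (xi' - xi) * uxi x xi))
    <= eps * norm ((x' - x, xi' - xi) : R * R)).
    eapply Rle_trans; [exact H'|].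
    apply Rle_trans with (eps / 2 * (2 * norm ((x' - x, xi' - xi) : R * R))).
    + apply Rmult_le_compat_l; lra.
    + lra.
Qed.

Definition make_C1_T (u ux uxi : R -> R -> R)
  (Hd : diff_T u ux uxi) (Hx : cont_T ux) (Hxi : cont_T uxi) : C1_T :=
  Build_C1_T u ux uxi
    (fun x xi HT => filterdiff_T2_of_diff_T u ux uxi x xi Hd HT)
    (proj2 (continuous_on_T2 ux) Hx) (proj2 (continuous_on_T2 uxi) Hxi).

Lemma d_x_cont_T (u : C1_T) : cont_T (d_x u).
Proof. apply continuous_on_T2, d_x_cont. Qed.

Lemma d_xi_cont_T (u : C1_T) : cont_T (d_xi u).
Proof. apply continuous_on_T2, d_xi_cont. Qed.

Lemma C1_T_cont (u : C1_T) : cont_T u.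
Proof.
  intros x xi HT eps Heps.
  destruct (C1_T_diff u x xi HT 1 Rlt_0_1) as [del [Hd H]].
  set (K := 1 + Rabs (d_x u x xi) + Rabs (d_xi u x xi)).
  assert (HK : 1 <= K).
  { unfold K. pose proof (Rabs_pos (d_x u x xi)). pose proof (Rabs_pos (d_xi u x xi)). lra. }
  exists (Rmin del (eps / (2 * K))).
  assert (0 < eps / (2 * K)) by (apply Rdiv_lt_0_compat; lra).
  split. { apply Rmin_glb_lt; lra. }
  intros x' xi' HT' H1 H2.
  pose proof (Rmin_l del (eps / (2 * K))). pose proof (Rmin_r del (eps / (2 * K))).
  specialize (H x' xi' HT' ltac:(lra) ltac:(lra)).
  set (a := x' - x) in *. set (c := xi' - xi) in *.
  assert (Ha : Rabs (a * d_x u x xi) <= Rabs a * (K - 1)).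
  { rewrite Rabs_mult. apply Rmult_le_compat_l. apply Rabs_pos. unfold K.
    pose proof (Rabs_pos (d_xi u x xi)). lra. }
  assert (Hc : Rabs (c * d_xi u x xi) <= Rabs c * (K - 1)).
  { rewrite Rabs_mult. apply Rmult_le_compat_l. apply Rabs_pos. unfold K.
    pose proof (Rabs_pos (d_x u x xi)). lra. }
  assert (HA : Rabs (u x' xi' - u x xi) <= K * (Rabs a + Rabs c)).
  { replace (u x' xi' - u x xi) with
      ((u x' xi' - u x xi - (a * d_x u x xi + c * d_xi u x xi))
        + (a * d_x u x xi + c * d_xi u x xi)) by ring.
    eapply Rle_trans; [apply Rabs_triang|].
    pose proof (Rabs_triang (a * d_x u x xi) (c * d_xi u x xi)). lra. }
  eapply Rle_lt_trans; [exact HA|].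
  apply Rlt_le_trans with (K * (2 * (eps / (2 * K)))).
  - apply Rmult_lt_compat_l; lra.
  - right. field. lra.
Qed.

(** Sets of triples, so that the triangle and the domain
    [0 <= xi <= y <= x <= 1] of doubled variables are instances of the same
    compactness and maximum arguments. *)
Definition cont_on (Om : R -> R -> R -> Prop) (f : R -> R -> R -> R) : Prop :=
  forall x y z, Om x y z -> forall eps, 0 < eps -> exists del, 0 < del /\
    forall x' y' z', Om x' y' z' -> Rabs (x' - x) < del -> Rabs (y' - y) < del ->
      Rabs (z' - z) < del -> Rabs (f x' y' z' - f x y z) < eps.

Definition attains_max (Om : R -> R -> R -> Prop) : Prop :=
  forall f, cont_on Om f -> (exists x y z, Om x y z) ->
  exists x y z, Om x y z /\ forall x' y' z', Om x' y' z' -> f x' y' z' <= f x y z.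

Lemma list_argmax {A : Type} (P : A -> Prop) (g : A -> R) (l : list A) (a0 : A) :
  P a0 -> (forall a, In a l -> P a) ->
  exists a, P a /\ forall a', In a' l -> g a' <= g a.
Proof.
  intros H0. induction l as [|a l IH]; intros Hl.
  - exists a0. split; [exact H0|]. intros a' [].
  - destruct IH as [m [Hm Hmax]]. { intros a' Ha. apply Hl. now right. }
    destruct (Rle_dec (g m) (g a)) as [Hle|Hnle].
    + exists a. split. { apply Hl. now left. }
      intros a' [<-|Ha]; [lra|]. specialize (Hmax a' Ha). lra.
    + exists m. split; [exact Hm|]. intros a' [<-|Ha]; [lra|]. now apply Hmax.
Qed.

(** If no point were a maximum, each point would have a neighbourhood on which
    [f] stays below one of its values; finitely many of these neighbourhoods
    cover the cube, and the largest of the finitely many values contradicts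
    itself. *)
Lemma closed_attains_max (Om : R -> R -> R -> Prop) :
  (forall x y z, Om x y z -> I01 x /\ I01 y /\ I01 z) ->
  (forall x y z, ~ Om x y z -> exists del, 0 < del /\
     forall x' y' z', Rabs (x' - x) < del -> Rabs (y' - y) < del ->
       Rabs (z' - z) < del -> ~ Om x' y' z') ->
  attains_max Om.
Proof.
  intros Hbox Hclosed f Hf [x0 [y0 [z0 H0]]].
  apply NNPP. intros Hno.
  assert (Hup : forall x y z, Om x y z ->
    exists p : R * R * R, Om (fst (fst p)) (snd (fst p)) (snd p) /\
      f x y z < f (fst (fst p)) (snd (fst p)) (snd p)).
  { intros x y z H. apply NNPP. intros Hn. apply Hno. exists x, y, z.
    split; [exact H|]. intros x' y' z' H'. apply Rnot_lt_le. intros Hlt.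
    apply Hn. exists (x', y', z'). now split. }
  assert (Hloc : forall t : Compactness.Tn 3 R, exists d : posreal * (R * R * R),
    let '(x, (y, (z, _))) := t in
    Om (fst (fst (snd d))) (snd (fst (snd d))) (snd (snd d)) /\
    forall x' y' z', Om x' y' z' ->
      Rabs (x' - x) < fst d -> Rabs (y' - y) < fst d -> Rabs (z' - z) < fst d ->
      f x' y' z' < f (fst (fst (snd d))) (snd (fst (snd d))) (snd (snd d))).
  { intros [x [y [z u]]].
    destruct (classic (Om x y z)) as [H|H].
    - destruct (Hup x y z H) as [p [Hp Hlt]].
      destruct (Hf x y z H (f (fst (fst p)) (snd (fst p)) (snd p) - f x y z))
        as [del [Hd Hc]]; [lra|].
      exists (mkposreal del Hd, p). split; [exact Hp|]. simpl.
      intros x' y' z' H' H1 H2 H3.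
      specialize (Hc x' y' z' H' H1 H2 H3). apply Rabs_def2 in Hc. lra.
    - destruct (Hclosed x y z H) as [del [Hd Hc]].
      exists (mkposreal del Hd, (x0, y0, z0)). split; [exact H0|]. simpl.
      intros x' y' z' H' H1 H2 H3. destruct (Hc x' y' z' H1 H2 H3 H'). }
  destruct (functional_choice _ Hloc) as [pick Hpick].
  apply (compactness_list 3 (0, (0, (0, tt))) (1, (1, (1, tt))) (fun t => fst (pick t))).
  intros [l Hl].
  destruct (list_argmax (fun p : R * R * R => Om (fst (fst p)) (snd (fst p)) (snd p))
    (fun p : R * R * R => f (fst (fst p)) (snd (fst p)) (snd p))
    (map (fun t => snd (pick t)) l) (x0, y0, z0)) as [[[x y] z] [Hm Hmax]].
  - exact H0.
  - intros p Hp. apply in_map_iff in Hp. destruct Hp as [t [<- _]].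
    specialize (Hpick t). destruct t as [x [y [z u]]]. exact (proj1 Hpick).
  - destruct (Hl (x, (y, (z, tt)))) as [t [Hin [_ Ht]]].
    { destruct (Hbox x y z Hm) as [B1 [B2 B3]]. simpl. unfold I01 in *. tauto. }
    assert (Hle := Hmax (snd (pick t)) (in_map (fun t => snd (pick t)) l t Hin)).
    specialize (Hpick t).
    destruct t as [xt [yt [zt u]]]. destruct Hpick as [_ Hlt].
    destruct Ht as [T1 [T2 [T3 _]]].
    specialize (Hlt x y z Hm T1 T2 T3). cbv beta in Hle. cbn [fst snd] in Hle.
    lra.
Qed.

Definition slice_T (x y z : R) : Prop := y = 0 /\ T x z.
Definition doubled_T (x y z : R) : Prop := 0 <= z <= y /\ y <= x <= 1.

Lemma T_closed (x z : R) : ~ T x z -> exists del, 0 < del /\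
  forall x' z', Rabs (x' - x) < del -> Rabs (z' - z) < del -> ~ T x' z'.
Proof.
  intros H. unfold T in *.
  assert (Hc : z < 0 \/ x < z \/ 1 < x).
  { apply NNPP. intros Hn. apply H. lra. }
  exists (Rmax (0 - z) (Rmax (x - 1) (z - x)) / 2).
  assert (0 < Rmax (0 - z) (Rmax (x - 1) (z - x))).
  { unfold Rmax; repeat destruct (Rle_dec _ _); lra. }
  split; [lra|].
  intros x' z' H1 H3 [H4 H5].
  apply Rabs_def2 in H1, H3.
  unfold Rmax in *; repeat destruct (Rle_dec _ _); lra.
Qed.

Lemma slice_T_attains_max : attains_max slice_T.
Proof.
  apply closed_attains_max.
  - intros x y z [-> [H1 H2]]. unfold I01. lra.
  - intros x y z H. destruct (Req_dec y 0) as [->|Hy].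
    + destruct (T_closed x z) as [d [Hd Hc]]. { intros HT. apply H. now split. }
      exists d. split; [exact Hd|]. intros x' y' z' H1 _ H3 [_ HT]. exact (Hc x' z' H1 H3 HT).
    + exists (Rabs y). split. { now apply Rabs_pos_lt. }
      intros x' y' z' H1 H2 H3 [-> _].
      replace (0 - y) with (- y) in H2 by ring. rewrite Rabs_Ropp in H2. lra.
Qed.

Lemma doubled_T_attains_max : attains_max doubled_T.
Proof.
  apply closed_attains_max.
  - intros x y z [H1 H2]. unfold I01. lra.
  - intros x y z H. unfold doubled_T in *.
    assert (Hc : z < 0 \/ y < z \/ x < y \/ 1 < x).
    { apply NNPP. intros Hn. apply H. lra. }
    set (m := Rmax (Rmax (0 - z) (z - y)) (Rmax (x - 1) (y - x))).
    exists (m / 2).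
    assert (0 < m).
    { unfold m, Rmax; repeat destruct (Rle_dec _ _); lra. }
    split; [lra|].
    intros x' y' z' H1 H2 H3 [H4 H5].
    apply Rabs_def2 in H1, H2, H3.
    unfold m, Rmax in *; repeat destruct (Rle_dec _ _); lra.
Qed.

Lemma cont_on_comp Om (g : R -> R) f :
  (forall x y z, Om x y z -> continuous g (f x y z)) ->
  cont_on Om f -> cont_on Om (fun x y z => g (f x y z)).
Proof.
  intros Hg Hf x y z Hz eps He.
  pose proof (proj1 (filterlim_locally _ _) (Hg x y z Hz) (mkposreal eps He)) as [d Hd].
  destruct (Hf x y z Hz d (cond_pos d)) as [d' [Hd' H]].
  exists d'. split; [exact Hd'|]. intros. apply Hd, H; assumption.
Qed.

Lemma cont_on_plus Om f g :
  cont_on Om f -> cont_on Om g -> cont_on Om (fun x y z => f x y z + g x y z).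
Proof.
  intros Hf Hg x y z Hz eps He.
  destruct (Hf x y z Hz (eps / 2) ltac:(lra)) as [d1 [D1 H1]].
  destruct (Hg x y z Hz (eps / 2) ltac:(lra)) as [d2 [D2 H2]].
  exists (Rmin d1 d2). split; [now apply Rmin_glb_lt|].
  intros x' y' z' Hz' A1 A2 A3.
  pose proof (Rmin_l d1 d2). pose proof (Rmin_r d1 d2).
  specialize (H1 x' y' z' Hz' ltac:(lra) ltac:(lra) ltac:(lra)).
  specialize (H2 x' y' z' Hz' ltac:(lra) ltac:(lra) ltac:(lra)).
  apply Rabs_def2 in H1, H2. apply Rabs_def1; lra.
Qed.

Lemma cont_on_scal Om c f : cont_on Om f -> cont_on Om (fun x y z => c * f x y z).
Proof.
  intros Hf. apply (cont_on_comp Om (fun t => c * t) f); [|exact Hf].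
  intros. apply (continuous_scal_r c (fun t : R => t)). apply continuous_id.
Qed.

Lemma cont_on_mult Om f g :
  cont_on Om f -> cont_on Om g -> cont_on Om (fun x y z => f x y z * g x y z).
Proof.
  intros Hf Hg x y z Hz.
  assert (Hsq : forall h, cont_on Om h -> cont_on Om (fun x y z => h x y z * h x y z)).
  { intros h Hh. apply (cont_on_comp Om (fun t => t * t) h); [|exact Hh].
    intros. apply (continuous_mult (fun t : R => t) (fun t : R => t)); apply continuous_id. }
  pose proof (cont_on_scal Om (/ 4) _
    (cont_on_plus Om _ _ (Hsq _ (cont_on_plus Om _ _ Hf Hg))
      (cont_on_scal Om (-1) _ (Hsq _ (cont_on_plus Om _ _ Hf (cont_on_scal Om (-1) _ Hg))))))
    as H.
  intros eps He. destruct (H x y z Hz eps He) as [d [Hd H']].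
  exists d. split; [exact Hd|]. intros x' y' z' Hz' A1 A2 A3.
  specialize (H' x' y' z' Hz' A1 A2 A3). cbv beta in H'.
  match type of H' with Rabs ?a < _ =>
    replace (f x' y' z' * g x' y' z' - f x y z * g x y z) with a by field end.
  exact H'.
Qed.

Lemma cont_on_proj1 Om : cont_on Om (fun x _ _ => x).
Proof. intros x y z Hz eps He. exists eps. split; [exact He|]. intros. assumption. Qed.

Lemma cont_on_proj2 Om : cont_on Om (fun _ y _ => y).
Proof. intros x y z Hz eps He. exists eps. split; [exact He|]. intros. assumption. Qed.

Lemma cont_on_const Om c : cont_on Om (fun _ _ _ => c).
Proof.
  intros x y z Hz eps He. exists 1. split; [lra|]. intros.
  replace (c - c) with 0 by ring. rewrite Rabs_R0. exact He.
Qed.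

Lemma cont_on_T13 (Om : R -> R -> R -> Prop) u :
  (forall x y z, Om x y z -> T x z) -> cont_T u -> cont_on Om (fun x _ z => u x z).
Proof.
  intros HO Hu x y z Hz eps He.
  destruct (Hu x z (HO _ _ _ Hz) eps He) as [d [Hd H]].
  exists d. split; [exact Hd|]. intros. apply H; eauto.
Qed.

Lemma cont_on_T23 (Om : R -> R -> R -> Prop) u :
  (forall x y z, Om x y z -> T y z) -> cont_T u -> cont_on Om (fun _ y z => u y z).
Proof.
  intros HO Hu x y z Hz eps He.
  destruct (Hu y z (HO _ _ _ Hz) eps He) as [d [Hd H]].
  exists d. split; [exact Hd|]. intros. apply H; eauto.
Qed.

Lemma cont_T_slice (u : R -> R -> R) :
  cont_T u <-> cont_on slice_T (fun x _ xi => u x xi).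
Proof.
  split; intros H.
  - apply cont_on_T13; [|exact H]. intros x y z [_ Hz]; exact Hz.
  - intros x xi HT eps He. destruct (H x 0 xi (conj eq_refl HT) eps He) as [d [Hd H']].
    exists d. split; [exact Hd|]. intros x' xi' HT' A1 A2.
    apply (H' x' 0 xi' (conj eq_refl HT') A1); [|exact A2]. now rewrite Rminus_diag, Rabs_R0.
Qed.

Lemma cont_T_plus (f g : R -> R -> R) :
  cont_T f -> cont_T g -> cont_T (fun x xi => f x xi + g x xi).
Proof. rewrite !cont_T_slice. apply cont_on_plus. Qed.

Lemma cont_T_mult (f g : R -> R -> R) :
  cont_T f -> cont_T g -> cont_T (fun x xi => f x xi * g x xi).
Proof. rewrite !cont_T_slice. apply cont_on_mult. Qed.

Lemma cont_T_comp (g : R -> R) (u : R -> R -> R) :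
  (forall t, continuous g t) -> cont_T u -> cont_T (fun x xi => g (u x xi)).
Proof.
  rewrite !cont_T_slice. intros Hg. apply (cont_on_comp slice_T g (fun x _ xi => u x xi)). auto.
Qed.

Lemma cont_T_opp (u : R -> R -> R) : cont_T u -> cont_T (fun x xi => - u x xi).
Proof. apply cont_T_comp. intros t. apply (continuous_opp (fun t : R => t)), continuous_id. Qed.

Lemma cont_T_const (c : R) : cont_T (fun _ _ => c).
Proof. apply cont_T_slice, cont_on_const. Qed.

Lemma cont_T_x : cont_T (fun x _ => x).
Proof. apply cont_T_slice, cont_on_proj1. Qed.

Lemma cont_T_xi : cont_T (fun _ xi => xi).
Proof. intros x xi _ eps He. now exists eps. Qed.

Lemma continuous_Rabs_at (t : R) : continuous Rabs t.
Proof. apply continuity_pt_filterlim, Rcontinuity_abs. Qed.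

Lemma cont_T_minus (f g : R -> R -> R) :
  cont_T f -> cont_T g -> cont_T (fun x xi => f x xi - g x xi).
Proof. intros Hf Hg. apply (cont_T_plus f), cont_T_opp; assumption. Qed.

Lemma cont_T_max (u : R -> R -> R) :
  cont_T u -> exists x xi, T x xi /\ forall x' xi', T x' xi' -> u x' xi' <= u x xi.
Proof.
  intros Hu.
  destruct (slice_T_attains_max (fun x _ z => u x z)) as [x [y [z [[_ H] Hm]]]].
  - now apply cont_T_slice.
  - exists 0, 0, 0. unfold slice_T, T. lra.
  - exists x, z. split; [exact H|]. intros x' xi' H'. apply (Hm x' 0 xi').
    now split.
Qed.

Lemma cont_T_bounded (u : R -> R -> R) :
  cont_T u -> exists M, 0 < M /\ forall x xi, T x xi -> Rabs (u x xi) <= M.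
Proof.
  intros Hu.
  destruct (cont_T_max u Hu) as [x [xi [_ H1]]].
  destruct (cont_T_max _ (cont_T_opp u Hu)) as [y [eta [_ H2]]].
  exists (1 + Rabs (u x xi) + Rabs (u y eta)).
  pose proof (Rabs_pos (u x xi)). pose proof (Rabs_pos (u y eta)).
  split; [lra|]. intros x' xi' H'.
  specialize (H1 x' xi' H'). specialize (H2 x' xi' H').
  pose proof (Rle_abs (u x xi)). pose proof (Rle_abs (- u y eta)).
  rewrite Rabs_Ropp in *. apply Rabs_le. lra.
Qed.

(** Each point has a neighbourhood of radius [2 d] with small oscillation; two
    points closer than the least of the finitely many [d] needed share one. *)
Lemma cont_T_uniform (u : R -> R -> R) :
  cont_T u -> forall eps, 0 < eps -> exists del, 0 < del /\
    forall x xi x' xi', T x xi -> T x' xi' ->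
      Rabs (x' - x) < del -> Rabs (xi' - xi) < del ->
      Rabs (u x' xi' - u x xi) < eps.
Proof.
  intros Hu eps He.
  assert (Hloc : forall t : Compactness.Tn 2 R, exists d : posreal,
    let '(x, (z, _)) := t in
    forall x1 z1 x2 z2, T x1 z1 -> T x2 z2 ->
      Rabs (x1 - x) < 2 * d -> Rabs (z1 - z) < 2 * d ->
      Rabs (x2 - x) < 2 * d -> Rabs (z2 - z) < 2 * d ->
      Rabs (u x2 z2 - u x1 z1) < eps).
  { intros [x [z t]].
    destruct (classic (T x z)) as [H|H].
    - destruct (Hu x z H (eps / 2)) as [del [Hd Hc]]; [lra|].
      assert (Hd2 : 0 < del / 2) by lra.
      exists (mkposreal _ Hd2). intros x1 z1 x2 z2 T1 T2 A1 A2 A3 A4. cbv [pos] in A1, A2, A3, A4.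
      pose proof (Hc x1 z1 T1 ltac:(lra) ltac:(lra)) as B1.
      pose proof (Hc x2 z2 T2 ltac:(lra) ltac:(lra)) as B2.
      apply Rabs_def2 in B1, B2. apply Rabs_def1; lra.
    - destruct (T_closed x z H) as [del [Hd Hc]].
      assert (Hd2 : 0 < del / 2) by lra.
      exists (mkposreal _ Hd2). intros x1 z1 x2 z2 T1 T2 A1 A2 A3 A4. cbv [pos] in A1, A2, A3, A4.
      destruct (Hc x1 z1 ltac:(lra) ltac:(lra) T1). }
  destruct (functional_choice _ Hloc) as [pick Hpick].
  destruct (compactness_value 2 (0, (0, tt)) (1, (1, tt)) pick) as [d Hd].
  exists d. split; [apply cond_pos|].
  intros x xi x' xi' HT HT' H1 H2.
  apply NNPP. intros Hn.
  apply (Hd (x, (xi, tt))).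
  { destruct HT as [A B]. simpl. repeat split; lra. }
  intros [[a [b c]] [_ [[C1 [C2 _]] Hle]]]. apply Hn.
  specialize (Hpick (a, (b, c))). cbv zeta beta iota in Hpick.
  pose proof (cond_pos (pick (a, (b, c)))) as Hr.
  set (r := pos (pick (a, (b, c)))) in *.
  change (0 < r) in Hr. change (Rabs (x - a) < r) in C1.
  change (Rabs (xi - b) < r) in C2. change (d <= r) in Hle.
  apply Hpick; fold r; try assumption; try lra.
  - replace (x' - a) with ((x' - x) + (x - a)) by ring.
    eapply Rle_lt_trans; [apply Rabs_triang|]. lra.
  - replace (xi' - b) with ((xi' - xi) + (xi - b)) by ring.
    eapply Rle_lt_trans; [apply Rabs_triang|]. lra.
Qed.

(** * One-sided derivatives along paths *)

Lemma continuous_of_derive (f : R -> R) (x : R) : ex_derive f x -> continuous f x.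
Proof. apply (ex_derive_continuous (K := R_AbsRing) (V := R_NormedModule)). Qed.

Lemma exp_le_compat (a b : R) : a <= b -> exp a <= exp b.
Proof. intros [H|H]; [left; now apply exp_increasing|right; now rewrite H]. Qed.

Definition rderiv (g : R -> R) (e : R) : Prop :=
  forall eps, 0 < eps -> exists del, 0 < del /\
    forall t, 0 < t < del -> Rabs (g t - g 0 - t * e) <= eps * t.

Lemma rderiv_is_derive (g : R -> R) (e : R) : is_derive g 0 e -> rderiv g e.
Proof.
  intros [_ H] eps He.
  specialize (H 0 (fun P HP => HP) (mkposreal eps He)).
  destruct H as [del Hd]. exists del. split; [apply cond_pos|].
  intros t Ht.
  assert (Hb : ball (M := R_UniformSpace) 0 del t).
  { change (Rabs (t - 0) < del). rewrite Rabs_right; lra. }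
  specialize (Hd t Hb).
  change (Rabs (g t - g 0 - (t - 0) * e) <= eps * Rabs (t - 0)) in Hd.
  rewrite (Rabs_right (t - 0)) in Hd by lra.
  replace (t - 0) with t in Hd by ring. exact Hd.
Qed.

Lemma rderiv_minus (f g : R -> R) (a b : R) :
  rderiv f a -> rderiv g b -> rderiv (fun t => f t - g t) (a - b).
Proof.
  intros Hf Hg eps He.
  destruct (Hf (eps / 2)) as [d1 [D1 H1]]; [lra|].
  destruct (Hg (eps / 2)) as [d2 [D2 H2]]; [lra|].
  exists (Rmin d1 d2). split; [now apply Rmin_glb_lt|].
  intros t Ht. pose proof (Rmin_l d1 d2). pose proof (Rmin_r d1 d2).
  specialize (H1 t ltac:(lra)). specialize (H2 t ltac:(lra)).
  replace (f t - g t - (f 0 - g 0) - t * (a - b))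
    with ((f t - f 0 - t * a) - (g t - g 0 - t * b)) by ring.
  eapply Rle_trans; [apply Rabs_triang|]. rewrite Rabs_Ropp. lra.
Qed.

Lemma rderiv_mult (f g : R -> R) (a b : R) :
  rderiv f a -> rderiv g b -> rderiv (fun t => f t * g t) (a * g 0 + f 0 * b).
Proof.
  intros Hf Hg eps He.
  set (K := 1 + Rabs (f 0) + Rabs (g 0) + Rabs a + Rabs b).
  pose proof (Rabs_pos (f 0)). pose proof (Rabs_pos (g 0)).
  pose proof (Rabs_pos a). pose proof (Rabs_pos b).
  assert (HK : 1 <= K) by (unfold K; lra).
  set (e1 := Rmin 1 (eps / (4 * K))).
  assert (0 < eps / (4 * K)) by (apply Rdiv_lt_0_compat; lra).
  assert (He1 : 0 < e1) by (apply Rmin_glb_lt; lra).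
  assert (e1 <= 1) by apply Rmin_l.
  assert (He1' : e1 * K <= eps / 4).
  { apply Rle_trans with (eps / (4 * K) * K).
    - apply Rmult_le_compat_r; [lra|]. apply Rmin_r.
    - right. field. lra. }
  destruct (Hf e1 He1) as [d1 [D1 F1]].
  destruct (Hg e1 He1) as [d2 [D2 F2]].
  set (d3 := eps / (4 * (K + 1) * K)).
  assert (D3 : 0 < d3) by (apply Rdiv_lt_0_compat; [lra|]; apply Rmult_lt_0_compat; lra).
  exists (Rmin d3 (Rmin d1 d2)).
  split; [repeat apply Rmin_glb_lt; lra|].
  intros t Ht.
  pose proof (Rmin_l d1 d2). pose proof (Rmin_r d1 d2).
  pose proof (Rmin_l d3 (Rmin d1 d2)). pose proof (Rmin_r d3 (Rmin d1 d2)).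
  specialize (F1 t ltac:(lra)). specialize (F2 t ltac:(lra)).
  (* f t g t - f0 g0 - t (a g0 + f0 b)
     = (f t - f0 - t a) g0 + f0 (g t - g0 - t b) + (f t - f0)(g t - g0) *)
  set (P := f t - f 0 - t * a) in *. set (Q := g t - g 0 - t * b) in *.
  replace (f t * g t - f 0 * g 0 - t * (a * g 0 + f 0 * b))
    with (P * g 0 + f 0 * Q + (P + t * a) * (g t - g 0)) by (unfold P, Q; ring).
  assert (A1 : Rabs (P * g 0) <= e1 * t * Rabs (g 0)).
  { rewrite Rabs_mult. apply Rmult_le_compat_r; lra. }
  assert (A2 : Rabs (f 0 * Q) <= e1 * t * Rabs (f 0)).
  { rewrite Rabs_mult, Rmult_comm. apply Rmult_le_compat_r; lra. }
  assert (A3 : Rabs (P + t * a) <= t * K).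
  { eapply Rle_trans; [apply Rabs_triang|]. rewrite (Rabs_mult t).
    rewrite (Rabs_right t) by lra. apply Rle_trans with (e1 * t + t * Rabs a); [lra|].
    apply Rle_trans with (t * (1 + Rabs a)); [nra|].
    apply Rmult_le_compat_l; unfold K; lra. }
  assert (A4 : Rabs (g t - g 0) <= t * K).
  { replace (g t - g 0) with (Q + t * b) by (unfold Q; ring).
    eapply Rle_trans; [apply Rabs_triang|]. rewrite (Rabs_mult t).
    rewrite (Rabs_right t) by lra. apply Rle_trans with (e1 * t + t * Rabs b); [lra|].
    apply Rle_trans with (t * (1 + Rabs b)); [nra|].
    apply Rmult_le_compat_l; unfold K; lra. }
  assert (A5 : Rabs ((P + t * a) * (g t - g 0)) <= (t * K) * (t * K)).
  { rewrite Rabs_mult. apply Rmult_le_compat; try apply Rabs_pos; assumption. }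
  assert (A6 : t * (K * K) <= eps / 4).
  { apply Rle_trans with (d3 * (K * K)).
    - apply Rmult_le_compat_r; [nra|lra].
    - unfold d3. apply Rle_trans with (eps / 4 * (K / (K + 1))).
      + right. field. lra.
      + apply Rle_trans with (eps / 4 * 1); [|lra].
        apply Rmult_le_compat_l; [lra|].
        apply Rle_div_l; lra. }
  pose proof (Rabs_triang (P * g 0 + f 0 * Q) ((P + t * a) * (g t - g 0))).
  pose proof (Rabs_triang (P * g 0) (f 0 * Q)).
  assert (A7 : e1 * t * Rabs (g 0) + e1 * t * Rabs (f 0) <= (e1 * K) * t).
  { replace (e1 * t * Rabs (g 0) + e1 * t * Rabs (f 0))
      with (e1 * t * (Rabs (g 0) + Rabs (f 0))) by ring.
    replace (e1 * K * t) with (e1 * t * K) by ring.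
    apply Rmult_le_compat_l; [|unfold K; lra]. apply Rmult_le_pos; lra. }
  assert (A8 : (t * K) * (t * K) <= eps / 4 * t).
  { replace (t * K * (t * K)) with (t * (K * K) * t) by ring.
    apply Rmult_le_compat_r; lra. }
  assert (A9 : e1 * K * t <= eps / 4 * t) by (apply Rmult_le_compat_r; lra).
  assert (0 <= eps * t) by (apply Rmult_le_pos; lra).
  lra.
Qed.

Lemma rderiv_nonpos (g : R -> R) (e del : R) :
  0 < del -> (forall t, 0 < t < del -> g t <= g 0) -> rderiv g e -> e <= 0.
Proof.
  intros Hd Hg H. apply Rnot_lt_le. intros He.
  destruct (H (e / 2)) as [d [Hd' H']]; [lra|].
  set (t := Rmin d del / 2).
  assert (0 < Rmin d del) by now apply Rmin_glb_lt.
  pose proof (Rmin_l d del). pose proof (Rmin_r d del).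
  assert (Ht : 0 < t) by (unfold t; lra).
  specialize (H' t ltac:(unfold t in *; lra)). specialize (Hg t ltac:(unfold t in *; lra)).
  apply Rabs_le_between in H'. nra.
Qed.

Lemma rderiv_C1_T (u : C1_T) (x xi a b : R) :
  T x xi ->
  (exists del, 0 < del /\ forall t, 0 < t < del -> T (x + t * a) (xi + t * b)) ->
  rderiv (fun t => u (x + t * a) (xi + t * b)) (a * d_x u x xi + b * d_xi u x xi).
Proof.
  intros HT [d0 [D0 F0]] eps He.
  set (K := 1 + Rabs a + Rabs b).
  pose proof (Rabs_pos a). pose proof (Rabs_pos b).
  assert (HK : 1 <= K) by (unfold K; lra).
  destruct (C1_T_diff u x xi HT (eps / K)) as [d1 [D1 F1]].
  { apply Rdiv_lt_0_compat; lra. }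
  assert (D2 : 0 < d1 / K) by (apply Rdiv_lt_0_compat; lra).
  exists (Rmin d0 (d1 / K)). split; [now apply Rmin_glb_lt|].
  intros t Ht. pose proof (Rmin_l d0 (d1 / K)). pose proof (Rmin_r d0 (d1 / K)).
  assert (HtK : t * K < d1).
  { apply Rlt_le_trans with (d1 / K * K); [|right; field; lra].
    apply Rmult_lt_compat_r; lra. }
  assert (Ea : Rabs (t * a) = t * Rabs a) by (rewrite Rabs_mult, (Rabs_right t); lra).
  assert (Eb : Rabs (t * b) = t * Rabs b) by (rewrite Rabs_mult, (Rabs_right t); lra).
  specialize (F1 (x + t * a) (xi + t * b) (F0 t ltac:(lra))).
  replace (x + t * a - x) with (t * a) in F1 by ring.
  replace (xi + t * b - xi) with (t * b) in F1 by ring.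
  rewrite Ea, Eb in F1.
  specialize (F1 ltac:(unfold K in *; nra) ltac:(unfold K in *; nra)).
  replace (x + 0 * a) with x by ring. replace (xi + 0 * b) with xi by ring.
  replace (t * (a * d_x u x xi + b * d_xi u x xi))
    with (t * a * d_x u x xi + t * b * d_xi u x xi) by ring.
  eapply Rle_trans; [exact F1|].
  apply Rle_trans with (eps / K * (t * K)).
  - apply Rmult_le_compat_l. { left. apply Rdiv_lt_0_compat; lra. } unfold K; nra.
  - right. field. lra.
Qed.

(** * A maximum principle for coupled transport equations *)

(** [U] has right derivative [e] along some straight segment that leaves the
    point and stays in [Om].  At a maximum this forces the sign of [e], which is
    all that is kept of the method of characteristics. *)
Definition inward (Om : R -> R -> R -> Prop) (U : R -> R -> R -> R) (x y z e : R) : Prop :=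
  exists a b c, (exists del, 0 < del /\ forall t, 0 < t < del ->
      Om (x + t * a) (y + t * b) (z + t * c)) /\
    rderiv (fun t => U (x + t * a) (y + t * b) (z + t * c)) e.

Lemma inward_max_damping Om U x y z e N B :
  (forall x' y' z', Om x' y' z' -> Rabs (U x' y' z') <= Rabs (U x y z)) ->
  inward Om U x y z e -> 0 <= N ->
  Rabs (e - N * U x y z) <= B -> N * Rabs (U x y z) <= B.
Proof.
  intros Hmax [a [b [c [[del [Hd Hin]] Hder]]]] HN HB.
  assert (E0 : U (x + 0 * a) (y + 0 * b) (z + 0 * c) = U x y z).
  { f_equal; ring. }
  destruct (Rle_lt_dec 0 (U x y z)) as [H|H].
  - assert (He : e <= 0).
    { apply (rderiv_nonpos _ e del Hd) in Hder; [exact Hder|].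
      intros t Ht. rewrite E0. specialize (Hmax _ _ _ (Hin t Ht)).
      rewrite (Rabs_right (U x y z)) in Hmax by lra.
      eapply Rle_trans; [apply Rle_abs|exact Hmax]. }
    rewrite (Rabs_right (U x y z)) by lra.
    apply Rabs_le_between in HB. lra.
  - assert (He : - e <= 0).
    { apply (rderiv_nonpos (fun t => 0 - U (x + t * a) (y + t * b) (z + t * c)) _ del Hd).
      - intros t Ht. rewrite E0. specialize (Hmax _ _ _ (Hin t Ht)).
        rewrite (Rabs_left (U x y z)) in Hmax by lra.
        apply Rabs_le_between in Hmax. lra.
      - replace (- e) with (0 - e) by ring. apply rderiv_minus; [|exact Hder].
        apply rderiv_is_derive. apply (is_derive_const (K := R_AbsRing) (V := R_NormedModule)). }
    rewrite (Rabs_left (U x y z)) by lra.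
    apply Rabs_le_between in HB. lra.
Qed.

(** Consider the maximum of [max ((2Q+1) |U|, |V|)].  Where the damping [N]
    applies, it exceeds the coupling [S], so the maximum is bounded by the source
    [F]; on the inflow boundary the factor [2Q+1] makes the reflection
    [|V| <= Q |U| + H] lose at least half of the maximum. *)
Lemma max_principle Om U V Q S F G H :
  attains_max Om -> cont_on Om U -> cont_on Om V ->
  0 <= Q -> 0 <= S -> 0 <= F -> 0 <= G -> 0 <= H ->
  (forall x y z, Om x y z -> Rabs (U x y z) <= G \/
    exists e N, S * (2 * Q + 2) + 1 <= N /\ inward Om U x y z e /\
      Rabs (e - N * U x y z) <= S * (Rabs (U x y z) + Rabs (V x y z)) + F) ->
  (forall x y z, Om x y z -> Rabs (V x y z) <= Q * Rabs (U x y z) + H \/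
    exists e N, S * (2 * Q + 2) + 1 <= N /\ inward Om V x y z e /\
      Rabs (e - N * V x y z) <= S * (Rabs (U x y z) + Rabs (V x y z)) + F) ->
  forall x y z, Om x y z ->
    Rabs (U x y z) <= (2 * Q + 1) * (F + G) + 2 * H /\
    Rabs (V x y z) <= (2 * Q + 1) * (F + G) + 2 * H.
Proof.
  intros Hat HU HV HQ HS HF HG HH HUeq HVeq x y z Hxyz.
  set (a := 2 * Q + 1). set (K := a * (F + G) + 2 * H).
  assert (Ha : 1 <= a) by (unfold a; lra).
  set (W := fun x y z => Rmax (a * Rabs (U x y z)) (Rabs (V x y z))).
  assert (Habs : forall f, cont_on Om f -> cont_on Om (fun x y z => Rabs (f x y z))).
  { intros f Hf. apply (cont_on_comp Om Rabs f); [|exact Hf].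
    intros. apply continuous_Rabs_at. }
  assert (HW : cont_on Om W).
  { assert (H1 : cont_on Om (fun x y z => / 2 * ((a * Rabs (U x y z) + Rabs (V x y z)) +
      Rabs (a * Rabs (U x y z) + -1 * Rabs (V x y z))))).
    { apply cont_on_scal, cont_on_plus.
      - apply cont_on_plus; [apply cont_on_scal|]; now apply Habs.
      - apply (Habs (fun x y z => a * Rabs (U x y z) + -1 * Rabs (V x y z))).
        apply cont_on_plus; apply cont_on_scal; now apply Habs. }
    intros x1 y1 z1 Hz eps He. destruct (H1 x1 y1 z1 Hz eps He) as [d [Hd H']].
    exists d. split; [exact Hd|]. intros x2 y2 z2 Hz' A1 A2 A3.
    specialize (H' x2 y2 z2 Hz' A1 A2 A3). cbv beta in H'.
    assert (E : forall p q, / 2 * (p + q + Rabs (p + -1 * q)) = Rmax p q).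
    { intros p q. unfold Rmax. destruct (Rle_dec p q).
      - rewrite Rabs_left1 by lra. lra.
      - rewrite Rabs_right by lra. lra. }
    rewrite !E in H'. exact H'. }
  destruct (Hat W HW) as [x0 [y0 [z0 [H0 Hmax]]]]. { now exists x, y, z. }
  assert (HK : W x0 y0 z0 <= K).
  { assert (HUmax : forall x' y' z', Om x' y' z' -> a * Rabs (U x' y' z') <= W x0 y0 z0).
    { intros x' y' z' H'. eapply Rle_trans; [|apply Hmax, H']. apply Rmax_l. }
    assert (HVmax : forall x' y' z', Om x' y' z' -> Rabs (V x' y' z') <= W x0 y0 z0).
    { intros x' y' z' H'. eapply Rle_trans; [|apply Hmax, H']. apply Rmax_r. }
    assert (HaF : 0 <= a * F) by (apply Rmult_le_pos; lra).
    assert (HaG : 0 <= a * G) by (apply Rmult_le_pos; lra).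
    pose proof (HUmax _ _ _ H0) as B1. pose proof (HVmax _ _ _ H0) as B2.
    pose proof (Rabs_pos (U x0 y0 z0)) as P1. pose proof (Rabs_pos (V x0 y0 z0)) as P2.
    destruct (Rle_lt_dec (Rabs (V x0 y0 z0)) (a * Rabs (U x0 y0 z0))) as [Hc|Hc].
    - assert (EW : W x0 y0 z0 = a * Rabs (U x0 y0 z0)) by (unfold W; now apply Rmax_left).
      rewrite EW in *.
      destruct (HUeq _ _ _ H0) as [Hb|[e [N [HN [Hin Hb]]]]].
      + unfold K. apply Rle_trans with (a * G); [apply Rmult_le_compat_l; lra|lra].
      + apply (inward_max_damping Om U x0 y0 z0 e N) in Hb; [| |exact Hin|].
        * assert (Rabs (U x0 y0 z0) <= F).
          { set (m := Rabs (U x0 y0 z0)) in *.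
            assert ((S * (2 * Q + 2) + 1) * m <= N * m) by (apply Rmult_le_compat_r; lra).
            assert (S * (m + Rabs (V x0 y0 z0)) <= S * (m + a * m))
              by (apply Rmult_le_compat_l; lra).
            unfold a in *. nra. }
          unfold K. apply Rle_trans with (a * F); [apply Rmult_le_compat_l; lra|lra].
        * intros x' y' z' H'. apply (Rmult_le_reg_l a); [lra|]. now apply HUmax.
        * nra.
    - assert (EW : W x0 y0 z0 = Rabs (V x0 y0 z0)).
      { unfold W. apply Rmax_right. lra. }
      rewrite EW in *.
      destruct (HVeq _ _ _ H0) as [Hb|[e [N [HN [Hin Hb]]]]].
      + assert (2 * (Q * Rabs (U x0 y0 z0)) <= a * Rabs (U x0 y0 z0)) by (unfold a; lra).
        unfold K. lra.
      + apply (inward_max_damping Om V x0 y0 z0 e N) in Hb; [| |exact Hin|].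
        * assert (Rabs (V x0 y0 z0) <= F).
          { set (m := Rabs (V x0 y0 z0)) in *.
            assert ((S * (2 * Q + 2) + 1) * m <= N * m) by (apply Rmult_le_compat_r; lra).
            assert (Rabs (U x0 y0 z0) <= m) by nra.
            assert (S * (Rabs (U x0 y0 z0) + m) <= S * (m + m))
              by (apply Rmult_le_compat_l; lra).
            assert (0 <= S * Q * m) by (apply Rmult_le_pos; [apply Rmult_le_pos|]; lra).
            nra. }
          unfold K. apply Rle_trans with (a * F); [|lra]. nra.
        * exact HVmax.
        * nra. }
  pose proof (Hmax _ _ _ Hxyz) as Hm.
  pose proof (Rmax_l (a * Rabs (U x y z)) (Rabs (V x y z))).
  pose proof (Rmax_r (a * Rabs (U x y z)) (Rabs (V x y z))).
  fold (W x y z) in *. pose proof (Rabs_pos (U x y z)).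
  split; [|unfold K in *; lra]. change (Rabs (U x y z) <= K). nra.
Qed.

(** * Goursat systems on the triangle *)

Definition tr_u (p l : R -> R) (u : C1_T) (x xi : R) : R :=
  p x * d_x u x xi - l xi * d_xi u x xi.

Definition tr_v (p : R -> R) (v : C1_T) (x xi : R) : R :=
  p x * d_x v x xi + p xi * d_xi v x xi.

Lemma rderiv_exp (N x c : R) :
  rderiv (fun t => exp (- N * (x + t * c))) (- N * c * exp (- N * x)).
Proof.
  apply rderiv_is_derive. auto_derive; [exact I|].
  replace (x + 0 * c) with x by ring. ring.
Qed.

Lemma T_path_u (x xi a b : R) :
  T x xi -> xi < x -> 0 <= a -> 0 <= b ->
  exists del, 0 < del /\ forall t, 0 < t < del -> T (x + t * - a) (xi + t * b).
Proof.
  intros [H1 H2] Hlt Ha Hb.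
  exists ((x - xi) / (a + b + 1)).
  split. { apply Rdiv_lt_0_compat; lra. }
  intros t [Ht1 Ht2].
  assert (t * (a + b + 1) < x - xi).
  { apply Rlt_le_trans with ((x - xi) / (a + b + 1) * (a + b + 1)).
    - apply Rmult_lt_compat_r; lra.
    - right. field. lra. }
  unfold T. nra.
Qed.

Lemma T_path_v (p : R -> R) (x xi : R) :
  T x xi -> 0 < xi -> 0 <= p x -> 0 <= p xi ->
  exists del, 0 < del /\ forall t, 0 < t < del -> T (x + t * - p x) (xi + t * - p xi).
Proof.
  intros [H1 H2] Hpos Ha Hb.
  set (a := p x) in *. set (b := p xi) in *.
  destruct (Rlt_le_dec xi x) as [Hlt|Hge].
  - set (m := Rmin xi (x - xi)).
    assert (Hm : 0 < m) by (apply Rmin_glb_lt; lra).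
    exists (m / (a + b + 1)).
    split. { apply Rdiv_lt_0_compat; lra. }
    intros t [Ht1 Ht2].
    assert (t * (a + b + 1) < m).
    { apply Rlt_le_trans with (m / (a + b + 1) * (a + b + 1)).
      - apply Rmult_lt_compat_r; lra.
      - right. field. lra. }
    assert (m <= xi) by apply Rmin_l. assert (m <= x - xi) by apply Rmin_r.
    unfold T. nra.
  - (* on the diagonal both components of the path move at the same speed *)
    assert (x = xi) by lra. subst x. subst a b.
    set (b := p xi) in *.
    exists (xi / (b + 1)). split. { apply Rdiv_lt_0_compat; lra. }
    intros t [Ht1 Ht2].
    assert (t * (b + 1) < xi).
    { apply Rlt_le_trans with (xi / (b + 1) * (b + 1)).
      - apply Rmult_lt_compat_r; lra.
      - right. field. lra. }
    unfold T. nra.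
Qed.

(** The maximum principle applies to [exp (- N x) u] and [exp (- N x) v] with [N]
    so large that the damping [N P] dominates the coupling; undoing the weight
    costs the factor [exp N]. *)
Lemma goursat_sup_bound (P S Q F G H : R) (p l : R -> R) (u v : C1_T) :
  0 < P -> 0 <= S -> 0 <= Q -> 0 <= F -> 0 <= G -> 0 <= H ->
  (forall x, I01 x -> P <= p x) -> (forall x, I01 x -> 0 <= l x) ->
  (forall x xi, T x xi -> Rabs (tr_u p l u x xi) <= S * (Rabs (u x xi) + Rabs (v x xi)) + F) ->
  (forall x xi, T x xi -> Rabs (tr_v p v x xi) <= S * (Rabs (u x xi) + Rabs (v x xi)) + F) ->
  (forall x, I01 x -> Rabs (u x x) <= G) ->
  (forall x, I01 x -> Rabs (v x 0) <= Q * Rabs (u x 0) + H) ->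
  forall x xi, T x xi ->
    Rabs (u x xi) <= exp ((S * (2 * Q + 2) + 1) / P) * ((2 * Q + 1) * (F + G) + 2 * H) /\
    Rabs (v x xi) <= exp ((S * (2 * Q + 2) + 1) / P) * ((2 * Q + 1) * (F + G) + 2 * H).
Proof.
  intros HP HS HQ HF HG HH Hp Hl Hu Hv Hdiag Hbot.
  set (N := (S * (2 * Q + 2) + 1) / P).
  set (K := (2 * Q + 1) * (F + G) + 2 * H).
  assert (HN0 : 0 < S * (2 * Q + 2) + 1) by nra.
  assert (HN : 0 < N) by (apply Rdiv_lt_0_compat; lra).
  assert (HNP : N * P = S * (2 * Q + 2) + 1) by (unfold N; field; lra).
  set (U := fun x (_ : R) xi => exp (- N * x) * u x xi).
  set (V := fun x (_ : R) xi => exp (- N * x) * v x xi).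
  assert (HexpC : cont_on slice_T (fun x _ _ => exp (- N * x))).
  { apply (cont_on_comp slice_T (fun t => exp (- N * t)) (fun x _ _ => x)).
    - intros. apply (continuous_of_derive (fun t => exp (- N * t))).
      auto_derive. exact I.
    - apply cont_on_proj1. }
  assert (Hcont : forall w : C1_T, cont_on slice_T (fun x _ xi => exp (- N * x) * w x xi)).
  { intros w. apply (cont_on_mult slice_T (fun x _ _ => exp (- N * x)) (fun x _ xi => w x xi)).
    - exact HexpC.
    - apply cont_on_T13. intros x y z [_ Hz]; exact Hz. apply C1_T_cont. }
  (* along a backward path the weight contributes the damping [N p x] *)
  assert (Hin : forall (w : C1_T) x xi b, T x xi ->
    (exists del, 0 < del /\ forall t, 0 < t < del -> T (x + t * - p x) (xi + t * b)) ->
    inward slice_T (fun x _ xi => exp (- N * x) * w x xi) x 0 xi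
      (N * p x * (exp (- N * x) * w x xi)
       - exp (- N * x) * (p x * d_x w x xi - b * d_xi w x xi))).
  { intros w x xi b HT Hpath. exists (- p x), 0, b. split.
    - destruct Hpath as [del [Hd Hpath]]. exists del. split; [exact Hd|].
      intros t Ht. split; [ring|]. now apply Hpath.
    - pose proof (rderiv_mult _ _ _ _ (rderiv_exp N x (- p x)) (rderiv_C1_T w x xi _ _ HT Hpath)) as Hr.
      cbv beta in Hr.
      replace (x + 0 * - p x) with x in Hr by ring.
      replace (xi + 0 * b) with xi in Hr by ring.
      match type of Hr with rderiv _ ?e1 => match goal with |- rderiv _ ?e2 =>
        replace e2 with e1 by ring end end.
      exact Hr. }
  assert (Hexp : forall x, I01 x -> 0 < exp (- N * x) <= 1).
  { intros x [Hx _]. split; [apply exp_pos|]. rewrite <- exp_0. apply exp_le_compat. nra. }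
  assert (HTI : forall x xi, T x xi -> I01 x /\ I01 xi).
  { intros x xi [A B]. unfold I01. lra. }
  assert (HNp : forall x, I01 x -> S * (2 * Q + 2) + 1 <= N * p x).
  { intros x Hx. rewrite <- HNP. apply Rmult_le_compat_l; [lra|]. now apply Hp. }
  assert (Hsrc : forall E a b c, 0 < E <= 1 -> Rabs c <= S * (Rabs a + Rabs b) + F ->
    Rabs (- (E * c)) <= S * (Rabs (E * a) + Rabs (E * b)) + F).
  { intros E a b c [E0 E1] Hc. rewrite Rabs_Ropp, !Rabs_mult, (Rabs_right E) by lra.
    apply Rle_trans with (E * (S * (Rabs a + Rabs b) + F)).
    - apply Rmult_le_compat_l; lra.
    - nra. }
  assert (Hmain := max_principle slice_T U V Q S F G H slice_T_attains_max
    (Hcont u) (Hcont v) HQ HS HF HG HH).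
  assert (HMP : forall x xi, T x xi -> Rabs (U x 0 xi) <= K /\ Rabs (V x 0 xi) <= K).
  { intros x0 xi0 HT0. apply Hmain; [| |now split].
    - intros x y xi [-> HT]. destruct (HTI _ _ HT) as [Ix Ixi].
      destruct (Rlt_le_dec xi x) as [Hlt|Hge].
      + right. eexists. exists (N * p x). split; [now apply HNp|]. split.
        * apply (Hin u x xi (l xi) HT). apply T_path_u; auto.
          specialize (Hp x Ix). lra.
        * unfold U, V.
          match goal with |- Rabs ?a <= _ =>
            replace a with (- (exp (- N * x) * tr_u p l u x xi)) by (unfold tr_u; ring) end.
          apply Hsrc; [now apply Hexp|]. now apply Hu.
      + left. assert (x = xi) by (destruct HT; lra). subst xi.
        unfold U. rewrite Rabs_mult. specialize (Hexp x Ix). specialize (Hdiag x Ix).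
        rewrite (Rabs_right (exp _)) by lra. pose proof (Rabs_pos (u x x)). nra.
    - intros x y xi [-> HT]. destruct (HTI _ _ HT) as [Ix Ixi].
      destruct (Rlt_le_dec 0 xi) as [Hlt|Hge].
      + right. eexists. exists (N * p x). split; [now apply HNp|]. split.
        * apply (Hin v x xi (- p xi) HT). apply T_path_v; auto.
          specialize (Hp x Ix). lra. specialize (Hp xi Ixi). lra.
        * unfold U, V.
          match goal with |- Rabs ?a <= _ =>
            replace a with (- (exp (- N * x) * tr_v p v x xi)) by (unfold tr_v; ring) end.
          apply Hsrc; [now apply Hexp|]. now apply Hv.
      + left. assert (xi = 0) by (destruct HT; lra). subst xi.
        unfold U, V. rewrite !Rabs_mult. specialize (Hexp x Ix). specialize (Hbot x Ix).
        rewrite (Rabs_right (exp _)) by lra. nra. }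
  intros x xi HT. destruct (HTI _ _ HT) as [Ix _].
  assert (Hunw : forall a, Rabs (exp (- N * x) * a) <= K -> Rabs a <= exp N * K).
  { intros a Ha.
    replace a with (exp (N * x) * (exp (- N * x) * a)).
    - rewrite Rabs_mult. rewrite (Rabs_right (exp (N * x))) by (left; apply exp_pos).
      apply Rmult_le_compat; [left; apply exp_pos|apply Rabs_pos| |exact Ha].
      apply exp_le_compat. destruct Ix. nra.
    - rewrite <- Rmult_assoc, <- exp_plus.
      replace (N * x + - N * x) with 0 by ring. rewrite exp_0. ring. }
  destruct (HMP x xi HT) as [B1 B2]. split; apply Hunw; assumption.
Qed.

(** The barrier [K (x - xi)] grows along the characteristics faster than [u] and
    its trace can change, so the difference of [u] and its trace stays below it. *)
Lemma goursat_near_diagonal (P C Lg : R) (p l : R -> R) (u : C1_T) :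
  0 < P -> 0 <= C -> 0 <= Lg ->
  (forall x, I01 x -> P <= p x) -> (forall x, I01 x -> 0 <= l x) ->
  (forall x xi, T x xi -> Rabs (tr_u p l u x xi) <= C) ->
  (forall x y, I01 x -> I01 y -> Rabs (u x x - u y y) <= Lg * Rabs (x - y)) ->
  forall x xi, T x xi -> Rabs (u x xi - u xi xi) <= (Lg + C / P + 1) * (x - xi).
Proof.
  intros HP HC HL Hp Hl Hu Hg.
  set (K := Lg + C / P + 1).
  assert (HCP : 0 <= C / P) by (apply Rdiv_le_0_compat; lra).
  assert (Hside : forall s, s = 1 \/ s = -1 -> forall x xi, T x xi ->
    s * (u x xi - u xi xi) <= K * (x - xi)).
  { intros s Hs.
    set (Z := fun x xi => s * (u x xi - u xi xi) - K * (x - xi)).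
    assert (HZ : cont_T Z).
    { apply (cont_T_minus (fun x xi => s * (u x xi - u xi xi)) (fun x xi => K * (x - xi))).
      - apply (cont_T_mult (fun _ _ => s)); [apply cont_T_const|].
        apply cont_T_minus; [apply C1_T_cont|].
        intros x xi HT eps He.
        destruct (C1_T_cont u xi xi) with (eps := eps) as [d [Hd H]]; [unfold T in *; lra|exact He|].
        exists d. split; [exact Hd|]. intros x' xi' HT' _ A. apply H; auto. unfold T in *; lra.
      - apply (cont_T_mult (fun _ _ => K)); [apply cont_T_const|].
        apply cont_T_minus; [apply cont_T_x|apply cont_T_xi]. }
    destruct (cont_T_max Z HZ) as [x [xi [HT Hmax]]].
    assert (HZ0 : Z x xi <= 0).
    { destruct (Rlt_le_dec xi x) as [Hlt|Hge].
      - exfalso.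
        assert (Ix : I01 x) by (unfold T, I01 in *; lra).
        assert (Ixi : I01 xi) by (unfold T, I01 in *; lra).
        pose proof (Hp x Ix) as Hpx. pose proof (Hl xi Ixi) as Hlxi.
        destruct (T_path_u x xi (p x) (l xi) HT Hlt ltac:(lra) Hlxi) as [del [Hd Hpath]].
        set (g := fun t => s * u (x + t * - p x) (xi + t * l xi)
                           - (- (K * (p x + l xi)) + Lg * l xi) * t).
        assert (Hr : rderiv g (s * (- tr_u p l u x xi)
            - (- (K * (p x + l xi)) + Lg * l xi))).
        { apply rderiv_minus.
          - pose proof (rderiv_mult (fun _ => s) _ 0 _
              (rderiv_is_derive _ _ (is_derive_const (K := R_AbsRing) (V := R_NormedModule) s 0))
              (rderiv_C1_T u x xi _ _ HT (ex_intro _ del (conj Hd Hpath)))) as Hm.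
            cbv beta in Hm.
            match type of Hm with rderiv _ ?e1 => match goal with |- rderiv _ ?e2 =>
              replace e2 with e1 by (unfold tr_u; ring) end end.
            exact Hm.
          - apply rderiv_is_derive. auto_derive; [exact I|ring]. }
        apply (rderiv_nonpos g _ del Hd) in Hr.
        + specialize (Hu x xi HT).
          assert (Hk : C < K * p x - 0).
          { unfold K. apply Rlt_le_trans with (C / P * P + P * 1).
            - replace (C / P * P) with C by (field; lra). lra.
            - assert (C / P * P <= C / P * p x) by (apply Rmult_le_compat_l; lra).
              assert (0 <= Lg * p x) by (apply Rmult_le_pos; lra). lra. }
          assert (Lg * l xi <= K * l xi).
          { apply Rmult_le_compat_r; [lra|]. unfold K. lra. }
          apply Rabs_le_between in Hu. destruct Hs as [-> | ->]; lra.
        + intros t Ht. unfold g.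
          specialize (Hmax _ _ (Hpath t Ht)). unfold Z in Hmax.
          assert (It : I01 (xi + t * l xi)).
          { specialize (Hpath t Ht). unfold T, I01 in *. lra. }
          specialize (Hg (xi + t * l xi) xi It Ixi).
          replace (xi + t * l xi - xi) with (t * l xi) in Hg by ring.
          rewrite (Rabs_right (t * l xi)) in Hg by (apply Rle_ge, Rmult_le_pos; lra).
          apply Rabs_le_between in Hg.
          replace (x + 0 * - p x) with x by ring. replace (xi + 0 * l xi) with xi by ring.
          destruct Hs as [-> | ->]; lra.
      - assert (x = xi) by (destruct HT; lra). subst xi. unfold Z. lra. }
    intros x' xi' HT'. specialize (Hmax x' xi' HT'). unfold Z in *. lra. }
  intros x xi HT.
  pose proof (Hside 1 (or_introl eq_refl) x xi HT).
  pose proof (Hside (-1) (or_intror eq_refl) x xi HT).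
  apply Rabs_le. lra.
Qed.

(** The variable [x] is doubled: the difference
    [u x xi - u y xi] solves a system of the same form in [(x, y, xi)].  Divided
    by [x - y + h] it vanishes for [x = y] and its equation only gains a term of
    the size of the Lipschitz constant of [p], whatever [h > 0]; the maximum
    principle then gives a bound that survives [h -> 0]. *)
Lemma goursat_lipschitz_x (P S L Q F G : R) (p l : R -> R) (u v : C1_T) :
  0 < P -> 0 <= S -> 0 <= L -> 0 <= Q -> 0 <= F -> 0 <= G ->
  (forall x, I01 x -> P <= p x) -> (forall x, I01 x -> 0 <= l x) -> lipschitz L p ->
  (forall x y xi, doubled_T x y xi ->
     Rabs (tr_u p l u x xi - tr_u p l u y xi)
     <= S * (Rabs (u x xi - u y xi) + Rabs (v x xi - v y xi)) + F * (x - y)) ->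
  (forall x y xi, doubled_T x y xi ->
     Rabs (tr_v p v x xi - tr_v p v y xi)
     <= S * (Rabs (u x xi - u y xi) + Rabs (v x xi - v y xi)) + F * (x - y)) ->
  (forall x xi, T x xi -> Rabs (u x xi - u xi xi) <= G * (x - xi)) ->
  (forall x y, doubled_T x y 0 -> Rabs (v x 0 - v y 0) <= Q * Rabs (u x 0 - u y 0)) ->
  forall x y xi, doubled_T x y xi ->
    Rabs (u x xi - u y xi)
      <= exp (((S + L) * (2 * Q + 2) + 1) / P) * ((2 * Q + 1) * (F + G)) * (x - y) /\
    Rabs (v x xi - v y xi)
      <= exp (((S + L) * (2 * Q + 2) + 1) / P) * ((2 * Q + 1) * (F + G)) * (x - y).
Proof.
  intros HP HS HL HQ HF HG Hp Hl Hlip Hu Hv Hdiag Hbot.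
  set (S' := S + L).
  set (N := (S' * (2 * Q + 2) + 1) / P).
  set (K := (2 * Q + 1) * (F + G)).
  assert (HS' : 0 <= S') by (unfold S'; lra).
  assert (HN0 : 0 < S' * (2 * Q + 2) + 1) by nra.
  assert (HN : 0 < N) by (apply Rdiv_lt_0_compat; lra).
  assert (HNP : N * P = S' * (2 * Q + 2) + 1) by (unfold N; field; lra).
  assert (HTx : forall x y xi, doubled_T x y xi -> T x xi) by (unfold doubled_T, T; intros; lra).
  assert (HTy : forall x y xi, doubled_T x y xi -> T y xi) by (unfold doubled_T, T; intros; lra).
  assert (HI : forall x y xi, doubled_T x y xi -> I01 x /\ I01 y /\ I01 xi)
    by (unfold doubled_T, I01; intros; lra).
  assert (HNp : forall x, I01 x -> S' * (2 * Q + 2) + 1 <= N * p x).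
  { intros x Hx. rewrite <- HNP. apply Rmult_le_compat_l; [lra|]. now apply Hp. }
  assert (Hexp : forall x, I01 x -> 0 < exp (- N * x) <= 1).
  { intros x [Hx _]. split; [apply exp_pos|]. rewrite <- exp_0. apply exp_le_compat. nra. }
  assert (Hh : forall h, 0 < h -> forall x y xi, doubled_T x y xi ->
    Rabs (exp (- N * x) * (u x xi - u y xi) * / (x - y + h)) <= K /\
    Rabs (exp (- N * x) * (v x xi - v y xi) * / (x - y + h)) <= K).
  { intros h Hh.
    set (W := fun (w : C1_T) x y xi => exp (- N * x) * (w x xi - w y xi) * / (x - y + h)).
    assert (Hcont : forall w, cont_on doubled_T (W w)).
    { intros w.
      apply (cont_on_mult doubled_T (fun x y xi => exp (- N * x) * (w x xi - w y xi))
        (fun x y _ => / (x - y + h))).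
      - apply (cont_on_mult doubled_T (fun x _ _ => exp (- N * x))
          (fun x y xi => w x xi - w y xi)).
        + apply (cont_on_comp doubled_T (fun t => exp (- N * t)) (fun x _ _ => x)).
          * intros.
            apply (continuous_of_derive (fun t => exp (- N * t))). auto_derive. exact I.
          * apply cont_on_proj1.
        + apply (cont_on_plus doubled_T (fun x _ xi => w x xi) (fun _ y xi => - w y xi)).
          * apply cont_on_T13. exact HTx. apply C1_T_cont.
          * apply (cont_on_T23 doubled_T (fun y xi => - w y xi)). exact HTy.
            apply cont_T_opp, C1_T_cont.
      - apply (cont_on_comp doubled_T Rinv (fun x y _ => x - y + h)).
        + intros x y xi [_ H]. apply continuous_Rinv. lra.
        + apply cont_on_plus; [|apply cont_on_const].
          apply (cont_on_plus doubled_T (fun x _ _ => x) (fun _ y _ => - y)).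
          * apply cont_on_proj1.
          * apply (cont_on_comp doubled_T Ropp (fun _ y _ => y)).
            -- intros. apply (continuous_opp (fun t : R => t)), continuous_id.
            -- apply cont_on_proj2. }
    assert (Hin : forall (w : C1_T) x y xi b, doubled_T x y xi ->
      (exists del, 0 < del /\ forall t, 0 < t < del ->
         doubled_T (x + t * - p x) (y + t * - p y) (xi + t * b)) ->
      inward doubled_T (W w) x y xi
        (N * p x * W w x y xi
         - exp (- N * x) * ((p x * d_x w x xi - b * d_xi w x xi)
                            - (p y * d_x w y xi - b * d_xi w y xi)) * / (x - y + h)
         + W w x y xi * ((p x - p y) * / (x - y + h)))).
    { intros w x y xi b HD [del [Hd Hpath]]. exists (- p x), (- p y), b.
      split; [exists del; now split|].
      assert (Hw : x - y + h <> 0) by (destruct HD; lra).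
      pose proof (rderiv_C1_T w x xi (- p x) b (HTx _ _ _ HD)
        (ex_intro _ del (conj Hd (fun t Ht => HTx _ _ _ (Hpath t Ht))))) as R1.
      pose proof (rderiv_C1_T w y xi (- p y) b (HTy _ _ _ HD)
        (ex_intro _ del (conj Hd (fun t Ht => HTy _ _ _ (Hpath t Ht))))) as R2.
      assert (R3 : rderiv (fun t => / (x + t * - p x - (y + t * - p y) + h))
        ((p x - p y) * / (x - y + h) * / (x - y + h))).
      { apply rderiv_is_derive. auto_derive.
        - replace (x + 0 * - p x + - (y + 0 * - p y) + h) with (x - y + h) by ring. exact Hw.
        - replace (x + 0 * - p x + - (y + 0 * - p y) + h) with (x - y + h) by ring. field. exact Hw. }
      pose proof (rderiv_mult _ _ _ _
        (rderiv_mult _ _ _ _ (rderiv_exp N x (- p x)) (rderiv_minus _ _ _ _ R1 R2)) R3) as Hr.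
      cbv beta in Hr.
      replace (x + 0 * - p x) with x in Hr by ring.
      replace (y + 0 * - p y) with y in Hr by ring.
      replace (xi + 0 * b) with xi in Hr by ring.
      unfold W.
      match type of Hr with rderiv _ ?e1 => match goal with |- rderiv _ ?e2 =>
        replace e2 with e1 by (field; exact Hw) end end.
      exact Hr. }
    assert (Hsrc : forall x y xi a b c, doubled_T x y xi ->
      Rabs c <= S * (Rabs a + Rabs b) + F * (x - y) ->
      forall A B w, A = exp (- N * x) * a * / (x - y + h) ->
      B = exp (- N * x) * b * / (x - y + h) -> Rabs w <= Rabs A + Rabs B ->
      Rabs (- (exp (- N * x) * c * / (x - y + h)) + w * ((p x - p y) * / (x - y + h)))
      <= S' * (Rabs A + Rabs B) + F).
    { intros x y xi a b c HD Hc A B w EA EB Hw.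
      destruct (HI _ _ _ HD) as [Ix [Iy _]].
      specialize (Hexp x Ix). set (E := exp (- N * x)) in *.
      assert (Hxy : 0 <= x - y) by (destruct HD; lra).
      assert (Hi : 0 < / (x - y + h)) by (apply Rinv_0_lt_compat; lra).
      assert (Hi1 : (x - y) * / (x - y + h) <= 1).
      { apply (Rmult_le_reg_r (x - y + h)); [lra|].
        rewrite Rmult_assoc, Rinv_l by lra. lra. }
      set (j := / (x - y + h)) in *.
      assert (EA' : Rabs A = E * Rabs a * j).
      { rewrite EA, !Rabs_mult, (Rabs_right E), (Rabs_right j) by lra. reflexivity. }
      assert (EB' : Rabs B = E * Rabs b * j).
      { rewrite EB, !Rabs_mult, (Rabs_right E), (Rabs_right j) by lra. reflexivity. }
      eapply Rle_trans; [apply Rabs_triang|].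
      assert (T1 : Rabs (- (E * c * j)) <= S * (Rabs A + Rabs B) + F).
      { rewrite Rabs_Ropp, !Rabs_mult, (Rabs_right E), (Rabs_right j) by lra.
        rewrite EA', EB'.
        apply Rle_trans with (E * j * (S * (Rabs a + Rabs b) + F * (x - y))).
        - replace (E * Rabs c * j) with (E * j * Rabs c) by ring.
          apply Rmult_le_compat_l; [|exact Hc]. apply Rmult_le_pos; lra.
        - assert (E * (F * ((x - y) * j)) <= 1 * (F * 1)).
          { apply Rmult_le_compat; try lra.
            - apply Rmult_le_pos; [lra|]. apply Rmult_le_pos; lra.
            - apply Rmult_le_compat_l; lra. }
          lra. }
      assert (T2 : Rabs (w * ((p x - p y) * j)) <= L * (Rabs A + Rabs B)).
      { rewrite Rabs_mult, Rmult_comm.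
        apply Rmult_le_compat; try apply Rabs_pos; [|exact Hw].
        rewrite Rabs_mult, (Rabs_right j) by lra.
        specialize (Hlip x y Ix Iy). rewrite (Rabs_right (x - y)) in Hlip by lra.
        apply Rle_trans with (L * (x - y) * j).
        - apply Rmult_le_compat_r; lra.
        - rewrite Rmult_assoc. rewrite <- (Rmult_1_r L) at 2.
          apply Rmult_le_compat_l; lra. }
      unfold S'. lra. }
    assert (Hzero : forall w x xi, W w x x xi = 0) by (intros; unfold W; ring).
    intros x0 y0 xi0 HD0.
    change (Rabs (W u x0 y0 xi0) <= K /\ Rabs (W v x0 y0 xi0) <= K).
    replace K with ((2 * Q + 1) * (F + G) + 2 * 0) by (unfold K; ring).
    apply (max_principle doubled_T (W u) (W v) Q S' F G 0 doubled_T_attains_max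
      (Hcont u) (Hcont v) HQ HS' HF HG (Rle_refl 0)); [| |exact HD0].
    - intros x y xi HD. destruct (HI _ _ _ HD) as [Ix [Iy Ixi]].
      destruct (Req_dec x y) as [->|Hne].
      { left. rewrite Hzero, Rabs_R0. exact HG. }
      assert (Hlt : y < x) by (destruct HD; lra).
      destruct (Rlt_le_dec xi y) as [Hy|Hy].
      + right. eexists. exists (N * p x). split; [now apply HNp|]. split.
        * apply (Hin u x y xi (l xi) HD).
          destruct (T_path_u y xi (p y) (l xi) (HTy _ _ _ HD) Hy) as [d1 [D1 H1]].
          { specialize (Hp y Iy). lra. } { now apply Hl. }
          set (a := p x) in *. set (b := p y) in *.
          assert (Ha : P <= a) by now apply Hp. assert (Hb : P <= b) by now apply Hp.
          assert (D2 : 0 < (x - y) / a) by (apply Rdiv_lt_0_compat; lra).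
          exists (Rmin d1 ((x - y) / a)). split; [now apply Rmin_glb_lt|].
          intros t Ht. pose proof (Rmin_l d1 ((x - y) / a)). pose proof (Rmin_r d1 ((x - y) / a)).
          specialize (H1 t ltac:(lra)).
          assert (t * a <= x - y).
          { apply Rle_trans with ((x - y) / a * a); [|right; field; lra].
            apply Rmult_le_compat_r; lra. }
          unfold doubled_T, T in *. nra.
        * match goal with |- Rabs ?a <= _ => replace a with
            (- (exp (- N * x) * (tr_u p l u x xi - tr_u p l u y xi) * / (x - y + h))
             + W u x y xi * ((p x - p y) * / (x - y + h))) by (unfold tr_u; ring) end.
          apply (Hsrc x y xi (u x xi - u y xi) (v x xi - v y xi)); try reflexivity; auto.
          pose proof (Rabs_pos (W v x y xi)). lra.
      + left. assert (y = xi) by (destruct HD; lra). subst y. unfold W.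
        specialize (Hdiag x xi (HTx _ _ _ HD)). specialize (Hexp x Ix).
        assert (Hi : 0 < / (x - xi + h)) by (apply Rinv_0_lt_compat; lra).
        rewrite !Rabs_mult, (Rabs_right (exp _)), (Rabs_right (/ _)) by lra.
        apply Rle_trans with (1 * (G * (x - xi)) * / (x - xi + h)).
        * apply Rmult_le_compat_r; [lra|].
          apply Rmult_le_compat; [lra|apply Rabs_pos|lra|exact Hdiag].
        * apply (Rmult_le_reg_r (x - xi + h)); [lra|].
          rewrite Rmult_assoc, Rinv_l by lra. nra.
    - intros x y xi HD. destruct (HI _ _ _ HD) as [Ix [Iy Ixi]].
      destruct (Req_dec x y) as [->|Hne].
      { left. rewrite !Hzero, Rabs_R0. lra. }
      assert (Hlt : y < x) by (destruct HD; lra).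
      destruct (Rlt_le_dec 0 xi) as [Hy|Hy].
      + right. eexists. exists (N * p x). split; [now apply HNp|]. split.
        * apply (Hin v x y xi (- p xi) HD).
          pose proof (Hp x Ix) as Ha. pose proof (Hp y Iy) as Hb. pose proof (Hp xi Ixi).
          destruct (T_path_v p y xi (HTy _ _ _ HD) Hy) as [d1 [D1 H1]]; [lra|lra|].
          set (a := p x) in *. set (b := p y) in *.
          assert (D2 : 0 < (x - y) / a) by (apply Rdiv_lt_0_compat; lra).
          exists (Rmin d1 ((x - y) / a)). split; [now apply Rmin_glb_lt|].
          intros t Ht. pose proof (Rmin_l d1 ((x - y) / a)). pose proof (Rmin_r d1 ((x - y) / a)).
          specialize (H1 t ltac:(lra)).
          assert (t * a <= x - y).
          { apply Rle_trans with ((x - y) / a * a); [|right; field; lra].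
            apply Rmult_le_compat_r; lra. }
          unfold doubled_T, T in *. nra.
        * match goal with |- Rabs ?a <= _ => replace a with
            (- (exp (- N * x) * (tr_v p v x xi - tr_v p v y xi) * / (x - y + h))
             + W v x y xi * ((p x - p y) * / (x - y + h))) by (unfold tr_v; ring) end.
          apply (Hsrc x y xi (u x xi - u y xi) (v x xi - v y xi)); try reflexivity; auto.
          pose proof (Rabs_pos (W u x y xi)). lra.
      + left. assert (xi = 0) by (destruct HD; lra). subst xi. unfold W.
        specialize (Hbot x y HD). specialize (Hexp x Ix).
        assert (Hi : 0 < / (x - y + h)) by (apply Rinv_0_lt_compat; lra).
        rewrite !Rabs_mult, (Rabs_right (exp _)), (Rabs_right (/ _)) by lra.
        set (E := exp (- N * x)) in *. set (j := / (x - y + h)) in *.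
        replace (Q * (E * Rabs (u x 0 - u y 0) * j) + 0)
          with (E * (Q * Rabs (u x 0 - u y 0)) * j) by ring.
        apply Rmult_le_compat_r; [lra|]. apply Rmult_le_compat_l; lra. }
  assert (HK : 0 <= K) by (unfold K; nra).
  assert (Hunw : forall x y a, I01 x -> y <= x ->
    (forall h, 0 < h -> Rabs (exp (- N * x) * a * / (x - y + h)) <= K) ->
    Rabs a <= exp N * K * (x - y)).
  { intros x y a Ix Hxy Ha. apply le_epsilon. intros eps Heps.
    pose proof (exp_pos N) as HeN.
    assert (Hden : 0 < exp N * K + 1) by nra.
    set (h := eps / (exp N * K + 1)).
    assert (Hh0 : 0 < h) by (apply Rdiv_lt_0_compat; lra).
    specialize (Ha h Hh0).
    assert (Hw : 0 < x - y + h) by lra.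
    assert (HE : exp N * exp (- N * x) >= 1).
    { rewrite <- exp_plus, <- exp_0. apply Rle_ge, exp_le_compat. destruct Ix. nra. }
    rewrite !Rabs_mult, (Rabs_right (exp _)), (Rabs_right (/ _)) in Ha;
      [|left; now apply Rinv_0_lt_compat|left; apply exp_pos].
    assert (Ha' : exp (- N * x) * Rabs a <= K * (x - y + h)).
    { apply (Rmult_le_reg_r (/ (x - y + h))); [now apply Rinv_0_lt_compat|].
      rewrite (Rmult_assoc K), Rinv_r by lra. lra. }
    apply Rle_trans with (exp N * (exp (- N * x) * Rabs a)).
    { rewrite <- Rmult_assoc. pose proof (Rabs_pos a). nra. }
    apply Rle_trans with (exp N * (K * (x - y + h))).
    { apply Rmult_le_compat_l; lra. }
    assert (exp N * K * h <= eps).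
    { unfold h. apply Rle_trans with ((exp N * K + 1) * (eps / (exp N * K + 1))).
      - apply Rmult_le_compat_r; [fold h; lra|lra].
      - right. field. lra. }
    lra. }
  intros x y xi HD. destruct (HI _ _ _ HD) as [Ix _].
  assert (Hyx : y <= x) by (destruct HD; lra).
  split; apply Hunw; auto; intros h Hh0; apply (Hh h Hh0 x y xi HD).
Qed.

Lemma d_x_bound_of_lipschitz (u : C1_T) (L : R) :
  (forall x y xi, doubled_T x y xi -> Rabs (u x xi - u y xi) <= L * (x - y)) ->
  forall x xi, T x xi -> Rabs (d_x u x xi) <= L.
Proof.
  intros HL.
  assert (Hoff : forall x xi, T x xi -> xi < x -> Rabs (d_x u x xi) <= L).
  { intros x xi HT Hlt.
    assert (Hpath : forall t, 0 < t < x - xi -> T (x + t * -1) (xi + t * 0))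
      by (unfold T in *; intros; lra).
    assert (Hd : 0 < x - xi) by lra.
    pose proof (rderiv_C1_T u x xi (-1) 0 HT (ex_intro _ _ (conj Hd Hpath))) as Hr.
    assert (Hlip : forall t, 0 < t < x - xi ->
      Rabs (u x xi - u (x + t * -1) (xi + t * 0)) <= L * t).
    { intros t Ht. replace (xi + t * 0) with xi by ring.
      replace (L * t) with (L * (x - (x + t * -1))) by ring.
      apply HL. unfold doubled_T, T in *. lra. }
    apply Rabs_le. split.
    - pose proof (rderiv_minus _ _ _ _ Hr
        (rderiv_is_derive (fun t => L * t) L ltac:(auto_derive; [exact I|ring]))) as Hm.
      apply (rderiv_nonpos _ _ _ Hd) in Hm; [lra|].
      intros t Ht. specialize (Hlip t Ht). cbv beta.
      replace (x + 0 * -1) with x by ring. replace (xi + 0 * 0) with xi by ring.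
      apply Rabs_le_between in Hlip. lra.
    - pose proof (rderiv_minus _ _ _ _
        (rderiv_is_derive (fun t => - L * t) (- L) ltac:(auto_derive; [exact I|ring])) Hr) as Hm.
      apply (rderiv_nonpos _ _ _ Hd) in Hm; [lra|].
      intros t Ht. specialize (Hlip t Ht). cbv beta.
      replace (x + 0 * -1) with x by ring. replace (xi + 0 * 0) with xi by ring.
      apply Rabs_le_between in Hlip. lra. }
  (* a point of the diagonal is a limit of points off it, the corner (1,1) included *)
  intros x xi HT. destruct (Rlt_le_dec xi x) as [Hlt|Hge]; [now apply Hoff|].
  assert (xi = x) by (destruct HT; lra). subst xi.
  apply le_epsilon. intros eps Heps.
  destruct (d_x_cont_T u x x HT eps Heps) as [d [Hd Hc]].
  assert (Hnear : exists x' xi', T x' xi' /\ xi' < x' /\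
    Rabs (x' - x) < d /\ Rabs (xi' - x) < d).
  { destruct (Rlt_le_dec 0 x) as [H0|H0].
    - exists x, (Rmax 0 (x - d / 2)). pose proof (Rmax_l 0 (x - d / 2)).
      unfold T in *. replace (x - x) with 0 by ring. rewrite Rabs_R0.
      assert (Rmax 0 (x - d / 2) < x) by (apply Rmax_lub_lt; lra).
      pose proof (Rmax_r 0 (x - d / 2)).
      repeat split; try lra. apply Rabs_def1; lra.
    - exists (Rmin 1 (d / 2)), 0. pose proof (Rmin_l 1 (d / 2)). pose proof (Rmin_r 1 (d / 2)).
      assert (0 < Rmin 1 (d / 2)) by (apply Rmin_glb_lt; lra).
      assert (x = 0) by (destruct HT; lra). subst x.
      unfold T. repeat split; try lra; apply Rabs_def1; lra. }
  destruct Hnear as [x' [xi' [HT' [Hlt [A1 A2]]]]].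
  specialize (Hc x' xi' HT' A1 A2). specialize (Hoff x' xi' HT' Hlt).
  rewrite Rabs_minus_sym in Hc.
  replace (d_x u x x) with ((d_x u x x - d_x u x' xi') + d_x u x' xi') by ring.
  eapply Rle_trans; [apply Rabs_triang|]. lra.
Qed.

Definition coef_ok (S L : R) (A : R -> R -> R) : Prop :=
  (forall x xi, T x xi -> Rabs (A x xi) <= S) /\
  (forall x y xi, T x xi -> T y xi -> Rabs (A x xi - A y xi) <= L * Rabs (x - y)).

(** Common form of the two kernel systems, with [x] as time: [u] enters through
    the diagonal, [v] through [xi = 0], and the coefficients are Lipschitz in
    time. *)
Record goursat_system (P S L Q : R) (p l : R -> R) (A B C D : R -> R -> R) (r : R)
    (u v : C1_T) : Prop := {
  gs_p_lower : forall x, I01 x -> P <= p x;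
  gs_l_lower : forall x, I01 x -> P <= l x;
  gs_p_upper : forall x, I01 x -> p x <= S;
  gs_p_lip : lipschitz L p;
  gs_A : coef_ok S L A;
  gs_B : coef_ok S L B;
  gs_C : coef_ok S L C;
  gs_D : coef_ok S L D;
  gs_r : Rabs r <= Q;
  gs_trace : forall x, I01 x -> Rabs (u x x) <= S;
  gs_trace_lip : lipschitz L (fun x => u x x);
  gs_u : forall x xi, T x xi -> tr_u p l u x xi = A x xi * u x xi + B x xi * v x xi;
  gs_v : forall x xi, T x xi -> tr_v p v x xi = C x xi * u x xi + D x xi * v x xi;
  gs_bottom : forall x, I01 x -> v x 0 = r * u x 0 }.

Lemma Rabs_mult_le (a b x y : R) : Rabs a <= x -> Rabs b <= y -> Rabs (a * b) <= x * y.
Proof. intros. rewrite Rabs_mult. apply Rmult_le_compat; auto using Rabs_pos. Qed.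

Lemma Rabs_plus_le (a b x y : R) : Rabs a <= x -> Rabs b <= y -> Rabs (a + b) <= x + y.
Proof. intros. eapply Rle_trans; [apply Rabs_triang|]. lra. Qed.

Lemma Rabs_minus_le (a b x y : R) : Rabs a <= x -> Rabs b <= y -> Rabs (a - b) <= x + y.
Proof. intros. unfold Rminus. apply Rabs_plus_le; [|rewrite Rabs_Ropp]; assumption. Qed.

Lemma T_I01 (x xi : R) : T x xi -> I01 x /\ I01 xi.
Proof. unfold T, I01. lra. Qed.

(** The sup bound controls the difference of [u] and its diagonal trace, which is
    the boundary condition of the doubled system; that system bounds the
    derivatives in [x], and since the speeds are bounded below the equations give
    those in [xi]. *)
Lemma goursat_C1_bound (P S L Q : R) :
  0 < P -> 0 <= S -> 0 <= L -> 0 <= Q ->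
  exists M, 0 < M /\ forall p l A B C D r u v,
    goursat_system P S L Q p l A B C D r u v ->
    forall x xi, T x xi ->
      Rabs (u x xi) <= M /\ Rabs (d_x u x xi) <= M /\ Rabs (d_xi u x xi) <= M /\
      Rabs (v x xi) <= M /\ Rabs (d_x v x xi) <= M /\ Rabs (d_xi v x xi) <= M.
Proof.
  intros HP HS HL HQ.
  set (M0 := exp ((S * (2 * Q + 2) + 1) / P) * ((2 * Q + 1) * (0 + S) + 2 * 0)).
  assert (HM0 : 0 <= M0).
  { apply Rmult_le_pos; [left; apply exp_pos|]. nra. }
  set (C0 := S * (M0 + M0)).
  assert (HC0 : 0 <= C0) by (apply Rmult_le_pos; lra).
  set (G := L + C0 / P + 1).
  assert (0 <= C0 / P) by (apply Rdiv_le_0_compat; lra).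
  assert (HG : 0 <= G) by (unfold G; lra).
  set (F := L * M0 + L * M0).
  assert (HF : 0 <= F) by (unfold F; nra).
  set (M1 := exp (((S + L) * (2 * Q + 2) + 1) / P) * ((2 * Q + 1) * (F + G))).
  assert (HM1 : 0 <= M1).
  { apply Rmult_le_pos; [left; apply exp_pos|]. nra. }
  set (M2 := (S * M1 + C0) / P).
  assert (HM2 : 0 <= M2) by (apply Rdiv_le_0_compat; nra).
  exists (M0 + M1 + M2 + 1). split; [lra|].
  intros p l A B C D r u v Hs.
  destruct Hs as [Hp Hl HpS Hplip [HA HA'] [HB HB'] [HC HC'] [HD HD'] Hr Htr Htrl Hu Hv Hb].
  assert (Hl0 : forall x, I01 x -> 0 <= l x) by (intros x Hx; specialize (Hl x Hx); lra).
  assert (Hgen : forall E E' : R -> R -> R, forall a b x xi, T x xi ->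
    Rabs (E x xi) <= S -> Rabs (E' x xi) <= S ->
    Rabs (E x xi * a + E' x xi * b) <= S * (Rabs a + Rabs b)).
  { intros E E' a b x xi HT H1 H2. rewrite Rmult_plus_distr_l.
    apply Rabs_plus_le; apply Rabs_mult_le; auto; apply Rle_refl. }
  assert (B0 : forall x xi, T x xi -> Rabs (u x xi) <= M0 /\ Rabs (v x xi) <= M0).
  { apply (goursat_sup_bound P S Q 0 S 0 p l u v); auto; try lra.
    - intros x xi HT. rewrite Rplus_0_r, Hu by assumption. auto.
    - intros x xi HT. rewrite Rplus_0_r, Hv by assumption. auto.
    - intros x Hx. rewrite Rplus_0_r, Hb by assumption.
      apply Rabs_mult_le; [assumption|apply Rle_refl]. }
  assert (Bu : forall x xi, T x xi -> Rabs (tr_u p l u x xi) <= C0).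
  { intros x xi HT. rewrite Hu by assumption. destruct (B0 x xi HT).
    eapply Rle_trans; [apply Hgen; auto|]. apply Rmult_le_compat_l; lra. }
  assert (Bv : forall x xi, T x xi -> Rabs (tr_v p v x xi) <= C0).
  { intros x xi HT. rewrite Hv by assumption. destruct (B0 x xi HT).
    eapply Rle_trans; [apply Hgen; auto|]. apply Rmult_le_compat_l; lra. }
  assert (Hdiff : forall E E' : R -> R -> R, coef_ok S L E -> coef_ok S L E' ->
    forall x y xi, doubled_T x y xi ->
    Rabs ((E x xi * u x xi + E' x xi * v x xi) - (E y xi * u y xi + E' y xi * v y xi))
    <= S * (Rabs (u x xi - u y xi) + Rabs (v x xi - v y xi)) + F * (x - y)).
  { intros E E' [H1 H2] [H3 H4] x y xi HDb.
    assert (Tx : T x xi) by (unfold doubled_T, T in *; lra).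
    assert (Ty : T y xi) by (unfold doubled_T, T in *; lra).
    assert (Hxy : 0 <= x - y) by (destruct HDb; lra).
    destruct (B0 y xi Ty) as [N1 N2].
    pose proof (H2 x y xi Tx Ty) as H2'. pose proof (H4 x y xi Tx Ty) as H4'.
    rewrite (Rabs_right (x - y)) in H2', H4' by lra.
    replace (E x xi * u x xi + E' x xi * v x xi - (E y xi * u y xi + E' y xi * v y xi))
      with ((E x xi * (u x xi - u y xi) + E' x xi * (v x xi - v y xi))
        + ((E x xi - E y xi) * u y xi + (E' x xi - E' y xi) * v y xi)) by ring.
    apply Rabs_plus_le; [now apply Hgen; auto|].
    replace (F * (x - y)) with (L * (x - y) * M0 + L * (x - y) * M0) by (unfold F; ring).
    apply Rabs_plus_le; now apply Rabs_mult_le. }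
  assert (B1 : forall x y xi, doubled_T x y xi ->
    Rabs (u x xi - u y xi) <= M1 * (x - y) /\ Rabs (v x xi - v y xi) <= M1 * (x - y)).
  { apply (goursat_lipschitz_x P S L Q F G p l u v); auto.
    - intros x y xi HDb.
      rewrite !Hu by (unfold doubled_T, T in *; lra).
      apply Hdiff; [split|split|]; assumption.
    - intros x y xi HDb.
      rewrite !Hv by (unfold doubled_T, T in *; lra).
      apply Hdiff; [split|split|]; assumption.
    - now apply (goursat_near_diagonal P C0 L p l u).
    - intros x y HDb.
      rewrite !Hb by (unfold doubled_T, I01 in *; lra).
      rewrite <- Rmult_minus_distr_l. apply Rabs_mult_le; [assumption|apply Rle_refl]. }
  assert (Bux : forall x xi, T x xi -> Rabs (d_x u x xi) <= M1)
    by (apply d_x_bound_of_lipschitz; intros; now apply B1).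
  assert (Bvx : forall x xi, T x xi -> Rabs (d_x v x xi) <= M1)
    by (apply d_x_bound_of_lipschitz; intros; now apply B1).
  assert (Hdiv : forall a e, P <= a -> Rabs (a * e) <= S * M1 + C0 -> Rabs e <= M2).
  { intros a e Ha He. apply (Rmult_le_reg_l P); [lra|].
    replace (P * M2) with (S * M1 + C0) by (unfold M2; field; lra).
    eapply Rle_trans; [|exact He]. rewrite Rabs_mult.
    apply Rmult_le_compat_r; [apply Rabs_pos|]. rewrite Rabs_right; lra. }
  intros x xi HT. destruct (T_I01 _ _ HT) as [Ix Ixi].
  specialize (Bux x xi HT). specialize (Bvx x xi HT).
  specialize (Bu x xi HT). specialize (Bv x xi HT). destruct (B0 x xi HT).
  assert (Hpx : Rabs (p x) <= S).
  { rewrite Rabs_right; [auto|]. specialize (Hp x Ix). lra. }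
  assert (Rabs (d_xi u x xi) <= M2).
  { apply (Hdiv (l xi)); [auto|].
    replace (l xi * d_xi u x xi) with (p x * d_x u x xi - tr_u p l u x xi) by (unfold tr_u; ring).
    apply Rabs_minus_le; [apply Rabs_mult_le|]; auto. }
  assert (Rabs (d_xi v x xi) <= M2).
  { apply (Hdiv (p xi)); [auto|].
    replace (p xi * d_xi v x xi) with (- (p x * d_x v x xi - tr_v p v x xi)) by (unfold tr_v; ring).
    rewrite Rabs_Ropp.
    apply Rabs_minus_le; [apply Rabs_mult_le|]; auto. }
  repeat split; lra.
Qed.

Lemma diff_T_plus (f fx fxi g gx gxi : R -> R -> R) :
  diff_T f fx fxi -> diff_T g gx gxi ->
  diff_T (fun x xi => f x xi + g x xi) (fun x xi => fx x xi + gx x xi)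
    (fun x xi => fxi x xi + gxi x xi).
Proof.
  intros Hf Hg x xi HT eps He.
  destruct (Hf x xi HT (eps / 2) ltac:(lra)) as [d1 [D1 H1]].
  destruct (Hg x xi HT (eps / 2) ltac:(lra)) as [d2 [D2 H2]].
  exists (Rmin d1 d2). split; [now apply Rmin_glb_lt|].
  intros x' xi' HT' A1 A2.
  pose proof (Rmin_l d1 d2). pose proof (Rmin_r d1 d2).
  specialize (H1 x' xi' HT' ltac:(lra) ltac:(lra)).
  specialize (H2 x' xi' HT' ltac:(lra) ltac:(lra)).
  pose proof (Rabs_plus_le _ _ _ _ H1 H2) as H3.
  match type of H3 with Rabs ?a <= _ => match goal with |- Rabs ?b <= _ =>
    replace b with a by ring end end.
  lra.
Qed.

Lemma diff_T_opp (f fx fxi : R -> R -> R) : diff_T f fx fxi ->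
  diff_T (fun x xi => - f x xi) (fun x xi => - fx x xi) (fun x xi => - fxi x xi).
Proof.
  intros Hf x xi HT eps He. destruct (Hf x xi HT eps He) as [d [Hd H]].
  exists d. split; [exact Hd|]. intros x' xi' HT' A1 A2.
  rewrite <- Rabs_Ropp. specialize (H x' xi' HT' A1 A2).
  match type of H with Rabs ?a <= _ => match goal with |- Rabs ?b <= _ =>
    replace b with a by ring end end.
  exact H.
Qed.

Definition C1_minus (f g : C1_T) : C1_T :=
  make_C1_T (fun x xi => f x xi - g x xi)
    (fun x xi => d_x f x xi - d_x g x xi) (fun x xi => d_xi f x xi - d_xi g x xi)
    (diff_T_plus _ _ _ _ _ _ (C1_T_diff f) (diff_T_opp _ _ _ (C1_T_diff g)))
    (cont_T_minus _ _ (d_x_cont_T f) (d_x_cont_T g))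
    (cont_T_minus _ _ (d_xi_cont_T f) (d_xi_cont_T g)).

(** The difference of the solutions solves the first system with a source that
    is [del] times first derivatives of the second solution, so the uniform bound
    on those derivatives makes the constant independent of the solutions. *)
Lemma goursat_stability (P S L Q : R) :
  0 < P -> 0 <= S -> 0 <= L -> 0 <= Q ->
  exists M, 0 < M /\ forall p l A B C D r u v p' l' A' B' C' D' r' u' v' del,
    goursat_system P S L Q p l A B C D r u v ->
    goursat_system P S L Q p' l' A' B' C' D' r' u' v' ->
    0 <= del ->
    (forall x, I01 x -> Rabs (p x - p' x) <= del) ->
    (forall x, I01 x -> Rabs (l x - l' x) <= del) ->
    (forall x xi, T x xi -> Rabs (A x xi - A' x xi) <= del) ->
    (forall x xi, T x xi -> Rabs (B x xi - B' x xi) <= del) ->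
    (forall x xi, T x xi -> Rabs (C x xi - C' x xi) <= del) ->
    (forall x xi, T x xi -> Rabs (D x xi - D' x xi) <= del) ->
    Rabs (r - r') <= del ->
    (forall x, I01 x -> Rabs (u x x - u' x x) <= del) ->
    forall x xi, T x xi ->
      Rabs (u x xi - u' x xi) <= M * del /\ Rabs (v x xi - v' x xi) <= M * del.
Proof.
  intros HP HS HL HQ.
  destruct (goursat_C1_bound P S L Q HP HS HL HQ) as [M [HM Hbound]].
  exists (exp ((S * (2 * Q + 2) + 1) / P) * ((2 * Q + 1) * (4 * M + 1) + 2 * M)).
  split. { apply Rmult_lt_0_compat; [apply exp_pos|]. nra. }
  intros p l A B C D r u v p' l' A' B' C' D' r' u' v' del Hs Hs' Hdel
    Hp Hl HA HB HC HD Hr Htr.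
  specialize (Hbound _ _ _ _ _ _ _ _ _ Hs').
  destruct Hs as [Ap Al _ _ [AA _] [AB _] [AC _] [AD _] Ar _ _ Au Av Ab].
  destruct Hs' as [_ _ _ _ _ _ _ _ _ _ _ Au' Av' Ab'].
  set (w := C1_minus u u'). set (z := C1_minus v v').
  assert (Hrhs : forall E E' F F' a b a' b',
    Rabs E <= S -> Rabs E' <= S -> Rabs (E - F) <= del -> Rabs (E' - F') <= del ->
    Rabs a' <= M -> Rabs b' <= M ->
    Rabs ((E * a + E' * b) - (F * a' + F' * b'))
    <= S * (Rabs (a - a') + Rabs (b - b')) + 2 * (del * M)).
  { intros E E' F F' a b a' b' H1 H2 H3 H4 H5 H6.
    replace (E * a + E' * b - (F * a' + F' * b'))
      with ((E * (a - a') + E' * (b - b')) + ((E - F) * a' + (E' - F') * b')) by ring.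
    replace (S * (Rabs (a - a') + Rabs (b - b')) + 2 * (del * M))
      with ((S * Rabs (a - a') + S * Rabs (b - b')) + (del * M + del * M)) by ring.
    apply Rabs_plus_le; apply Rabs_plus_le; apply Rabs_mult_le; auto; apply Rle_refl. }
  assert (Hmain := goursat_sup_bound P S Q (4 * M * del) del (M * del) p l w z HP HS HQ).
  assert (HMd : 0 <= M * del) by (apply Rmult_le_pos; lra).
  intros x0 xi0 HT0.
  replace (exp ((S * (2 * Q + 2) + 1) / P) * ((2 * Q + 1) * (4 * M + 1) + 2 * M) * del)
    with (exp ((S * (2 * Q + 2) + 1) / P)
      * ((2 * Q + 1) * (4 * M * del + del) + 2 * (M * del))) by ring.
  change (u x0 xi0 - u' x0 xi0) with (w x0 xi0).
  change (v x0 xi0 - v' x0 xi0) with (z x0 xi0).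
  apply Hmain; auto; try lra.
  - intros x Hx. specialize (Al x Hx). lra.
  - intros x xi HT. destruct (T_I01 _ _ HT) as [Ix Ixi].
    destruct (Hbound x xi HT) as [B1 [B2 [B3 [B4 [B5 B6]]]]].
    change (tr_u p l w x xi) with
      (p x * (d_x u x xi - d_x u' x xi) - l xi * (d_xi u x xi - d_xi u' x xi)).
    replace (p x * (d_x u x xi - d_x u' x xi) - l xi * (d_xi u x xi - d_xi u' x xi))
      with ((tr_u p l u x xi - tr_u p' l' u' x xi)
        + ((l xi - l' xi) * d_xi u' x xi - (p x - p' x) * d_x u' x xi)) by (unfold tr_u; ring).
    rewrite Au, Au' by assumption.
    replace (S * (Rabs (w x xi) + Rabs (z x xi)) + 4 * M * del)
      with ((S * (Rabs (w x xi) + Rabs (z x xi)) + 2 * (del * M)) + (del * M + del * M)) by ring.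
    apply Rabs_plus_le; [apply Hrhs; auto|].
    apply Rabs_minus_le; apply Rabs_mult_le; auto.
  - intros x xi HT. destruct (T_I01 _ _ HT) as [Ix Ixi].
    destruct (Hbound x xi HT) as [B1 [B2 [B3 [B4 [B5 B6]]]]].
    change (tr_v p z x xi) with
      (p x * (d_x v x xi - d_x v' x xi) + p xi * (d_xi v x xi - d_xi v' x xi)).
    replace (p x * (d_x v x xi - d_x v' x xi) + p xi * (d_xi v x xi - d_xi v' x xi))
      with ((tr_v p v x xi - tr_v p' v' x xi)
        - ((p xi - p' xi) * d_xi v' x xi + (p x - p' x) * d_x v' x xi)) by (unfold tr_v; ring).
    rewrite Av, Av' by assumption.
    replace (S * (Rabs (w x xi) + Rabs (z x xi)) + 4 * M * del)
      with ((S * (Rabs (w x xi) + Rabs (z x xi)) + 2 * (del * M)) + (del * M + del * M)) by ring.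
    apply Rabs_minus_le; [apply Hrhs; auto|].
    apply Rabs_plus_le; apply Rabs_mult_le; auto.
  - intros x Hx.
    assert (HT : T x 0) by (unfold T, I01 in *; lra).
    change (Rabs (v x 0 - v' x 0) <= Q * Rabs (u x 0 - u' x 0) + M * del).
    rewrite Ab, Ab' by assumption.
    replace (r * u x 0 - r' * u' x 0) with (r * (u x 0 - u' x 0) + (r - r') * u' x 0) by ring.
    rewrite (Rmult_comm M). apply Rabs_plus_le; apply Rabs_mult_le; auto; try apply Rle_refl.
    apply (Hbound x 0 HT).
Qed.

(** * Uniform bounds and stability of the kernels *)

Lemma T_reflect (x xi : R) : T x xi -> T (1 - xi) (1 - x).
Proof. unfold T. lra. Qed.

Lemma I01_reflect (x : R) : I01 x -> I01 (1 - x).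
Proof. unfold I01. lra. Qed.

Lemma cont_T_reflect (u : R -> R -> R) :
  cont_T u -> cont_T (fun x xi => u (1 - xi) (1 - x)).
Proof.
  intros Hu x xi HT eps He.
  destruct (Hu _ _ (T_reflect _ _ HT) eps He) as [d [Hd H]].
  exists d. split; [exact Hd|]. intros x' xi' HT' A1 A2.
  apply H; [now apply T_reflect| |].
  - replace (1 - xi' - (1 - xi)) with (- (xi' - xi)) by ring. now rewrite Rabs_Ropp.
  - replace (1 - x' - (1 - x)) with (- (x' - x)) by ring. now rewrite Rabs_Ropp.
Qed.

Lemma diff_T_reflect (u ux uxi : R -> R -> R) :
  diff_T u ux uxi ->
  diff_T (fun x xi => u (1 - xi) (1 - x)) (fun x xi => - uxi (1 - xi) (1 - x))
    (fun x xi => - ux (1 - xi) (1 - x)).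
Proof.
  intros Hu x xi HT eps He.
  destruct (Hu _ _ (T_reflect _ _ HT) eps He) as [d [Hd H]].
  exists d. split; [exact Hd|]. intros x' xi' HT' A1 A2.
  specialize (H _ _ (T_reflect _ _ HT')).
  replace (1 - xi' - (1 - xi)) with (- (xi' - xi)) in H by ring.
  replace (1 - x' - (1 - x)) with (- (x' - x)) in H by ring.
  rewrite !Rabs_Ropp in H. specialize (H A2 A1).
  match type of H with Rabs ?a <= _ => match goal with |- Rabs ?b <= _ =>
    replace b with a by ring end end.
  lra.
Qed.

(** The symmetry of the triangle that turns the system of [m1, m2], solved from
    [x = 1] backwards, into a Goursat system solved forwards from [xi = 0]. *)
Definition reflect (u : C1_T) : C1_T :=
  make_C1_T (fun x xi => u (1 - xi) (1 - x))
    (fun x xi => - d_xi u (1 - xi) (1 - x)) (fun x xi => - d_x u (1 - xi) (1 - x))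
    (diff_T_reflect _ _ _ (C1_T_diff u))
    (cont_T_opp _ (cont_T_reflect _ (d_xi_cont_T u)))
    (cont_T_opp _ (cont_T_reflect _ (d_x_cont_T u))).

Lemma quotient_diff (P a a' s s' d1 d2 B : R) :
  0 < P -> P <= s -> P <= s' -> Rabs (a - a') <= d1 -> Rabs (s - s') <= d2 ->
  Rabs a' <= B -> Rabs (a / s - a' / s') <= d1 / P + B * d2 / (P * P).
Proof.
  intros HP Hs Hs' H1 H2 H3.
  replace (a / s - a' / s') with ((a - a') * / s + (a' * (s' - s)) * (/ s * / s'))
    by (field; lra).
  assert (I1 : Rabs (/ s) <= / P).
  { rewrite Rabs_right. apply Rinv_le_contravar; lra.
    left. apply Rinv_0_lt_compat. lra. }
  assert (I2 : Rabs (/ s') <= / P).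
  { rewrite Rabs_right. apply Rinv_le_contravar; lra.
    left. apply Rinv_0_lt_compat. lra. }
  unfold Rdiv. apply Rabs_plus_le.
  - now apply Rabs_mult_le.
  - rewrite Rinv_mult. apply Rabs_mult_le; apply Rabs_mult_le; auto.
    now rewrite Rabs_minus_sym.
Qed.

Record coef_close (del : R) (f g : coefficients) : Prop := {
  cc_lambda : forall x, I01 x -> Rabs (lambda f x - lambda g x) <= del;
  cc_mu : forall x, I01 x -> Rabs (mu f x - mu g x) <= del;
  cc_sigma : forall x, I01 x -> Rabs (sigma f x - sigma g x) <= del;
  cc_omega : forall x, I01 x -> Rabs (omega f x - omega g x) <= del;
  cc_theta : forall x, I01 x -> Rabs (theta f x - theta g x) <= del;
  cc_lambda' : forall x, I01 x -> Rabs (lambda' f x - lambda' g x) <= del;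
  cc_mu' : forall x, I01 x -> Rabs (mu' f x - mu' g x) <= del;
  cc_q : Rabs (q f - q g) <= del }.

Definition speed_min (b : class_constants) : R := Rmin (lambda_min b) (mu_min b).
(** The last summands of [coef_sup] and [coef_lip] come from the traces
    [theta / (lambda + mu)] and [omega / (lambda + mu)] on the diagonal. *)
Definition coef_sup (b : class_constants) : R :=
  B_lambda b + B_mu b + B_sigma b + B_omega b + B_theta b + B_lambda' b + B_mu' b
  + (B_omega b + B_theta b) / speed_min b.
Definition coef_lip (b : class_constants) : R :=
  Lip b + Lip b / speed_min b
  + (B_omega b + B_theta b) * (2 * Lip b) / (speed_min b * speed_min b).
Definition reflection_sup (b : class_constants) : R := B_q b * B_lambda b / speed_min b.

Lemma speed_min_pos b : positive_constants b -> 0 < speed_min b.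
Proof. intros (H1 & H2 & _). now apply Rmin_glb_lt. Qed.

Lemma class_speed b f x : in_class b f -> I01 x ->
  speed_min b <= lambda f x /\ speed_min b <= mu f x.
Proof.
  intros Hf Hx. split.
  - eapply Rle_trans; [apply Rmin_l|]. now apply (lambda_lower b f Hf).
  - eapply Rle_trans; [apply Rmin_r|]. now apply (mu_lower b f Hf).
Qed.

Lemma class_constants_nonneg b : positive_constants b ->
  0 <= coef_sup b /\ 0 <= coef_lip b /\ 0 <= reflection_sup b.
Proof.
  intros Hb. pose proof (speed_min_pos b Hb) as HP.
  destruct Hb as (?&?&?&?&?&?&?&?&?&?&?).
  assert (0 <= (B_omega b + B_theta b) / speed_min b) by (apply Rdiv_le_0_compat; lra).
  assert (0 <= Lip b / speed_min b) by (apply Rdiv_le_0_compat; lra).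
  assert (0 <= (B_omega b + B_theta b) * (2 * Lip b) / (speed_min b * speed_min b)).
  { apply Rdiv_le_0_compat; [apply Rmult_le_pos; lra|]. now apply Rmult_lt_0_compat. }
  assert (0 <= B_q b * B_lambda b / speed_min b).
  { apply Rdiv_le_0_compat; [apply Rmult_le_pos; lra|lra]. }
  unfold coef_sup, coef_lip, reflection_sup. lra.
Qed.

Lemma trace_bounds (b : class_constants) (f : coefficients) (g : R -> R) (B : R) :
  positive_constants b -> in_class b f -> 0 <= B <= B_omega b + B_theta b ->
  sup_le B g -> lipschitz (Lip b) g ->
  (forall x, I01 x -> Rabs (g x / (lambda f x + mu f x)) <= coef_sup b) /\
  lipschitz (coef_lip b) (fun x => g x / (lambda f x + mu f x)).
Proof.
  intros Hb Hf HB Hg Hlip. pose proof (speed_min_pos b Hb) as HP.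
  set (P := speed_min b) in *.
  destruct Hb as (?&?&?&?&?&?&?&?&?&?&?).
  assert (HBP : B / P <= (B_omega b + B_theta b) / P).
  { apply Rmult_le_compat_r; [left; now apply Rinv_0_lt_compat|lra]. }
  split.
  - intros x Hx. destruct (class_speed b f x Hf Hx) as [V1 V2]. fold P in V1, V2.
    apply Rle_trans with (B / P).
    + unfold Rdiv. apply Rabs_mult_le; [now apply Hg|].
      rewrite Rabs_right; [apply Rinv_le_contravar; lra|].
      left. apply Rinv_0_lt_compat. lra.
    + unfold coef_sup. fold P. lra.
  - intros x y Hx Hy.
    destruct (class_speed b f x Hf Hx) as [V1 V2]. fold P in V1, V2.
    destruct (class_speed b f y Hf Hy) as [V3 V4]. fold P in V3, V4.
    eapply Rle_trans.
    + apply (quotient_diff P _ _ _ _ (Lip b * Rabs (x - y)) (2 * Lip b * Rabs (x - y)) B);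
        try lra; [now apply Hlip| |now apply Hg].
      replace (lambda f x + mu f x - (lambda f y + mu f y))
        with ((lambda f x - lambda f y) + (mu f x - mu f y)) by ring.
      replace (2 * Lip b * Rabs (x - y))
        with (Lip b * Rabs (x - y) + Lip b * Rabs (x - y)) by ring.
      apply Rabs_plus_le; [now apply (lambda_lip b f Hf)|now apply (mu_lip b f Hf)].
    + unfold coef_lip. fold P.
      set (d := Rabs (x - y)). assert (0 <= d) by apply Rabs_pos.
      assert (Hq : B * (2 * Lip b) / (P * P) <= (B_omega b + B_theta b) * (2 * Lip b) / (P * P)).
      { apply Rmult_le_compat_r.
        - left. apply Rinv_0_lt_compat. now apply Rmult_lt_0_compat.
        - apply Rmult_le_compat_r; lra. }
      replace (Lip b * d / P + B * (2 * Lip b * d) / (P * P))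
        with ((Lip b / P + B * (2 * Lip b) / (P * P)) * d) by (field; lra).
      apply Rmult_le_compat_r; lra.
Qed.

Lemma coef_ok_xi (S L B : R) (g : R -> R) :
  0 <= L -> B <= S -> sup_le B g -> coef_ok S L (fun _ xi => g xi).
Proof.
  intros HL HB Hg. split.
  - intros x xi HT. apply T_I01 in HT. specialize (Hg xi (proj2 HT)). lra.
  - intros x y xi _ _. replace (g xi - g xi) with 0 by ring. rewrite Rabs_R0.
    apply Rmult_le_pos; [exact HL|apply Rabs_pos].
Qed.

Definition system_k (b : class_constants) (f : coefficients) (u v : C1_T) : Prop :=
  goursat_system (speed_min b) (coef_sup b) (coef_lip b) (reflection_sup b)
    (mu f) (lambda f)
    (fun _ xi => lambda' f xi + sigma f xi) (fun _ xi => theta f xi)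
    (fun _ xi => omega f xi) (fun _ xi => - mu' f xi) (q f * lambda f 0 / mu f 0) u v.

Definition system_m (b : class_constants) (f : coefficients) (u v : C1_T) : Prop :=
  goursat_system (speed_min b) (coef_sup b) (coef_lip b) (reflection_sup b)
    (fun y => mu f (1 - y)) (fun y => lambda f (1 - y))
    (fun y eta => mu' f (1 - y) + sigma f (1 - eta)) (fun _ eta => omega f (1 - eta))
    (fun _ eta => theta f (1 - eta)) (fun y _ => mu' f (1 - y)) 0 (reflect u) (reflect v).

Lemma goursat_k_system b f u v :
  positive_constants b -> in_class b f -> goursat_k f u v -> system_k b f u v.
Proof.
  intros Hb Hf Hk. pose proof (speed_min_pos b Hb) as HP.
  pose proof (class_constants_nonneg b Hb) as [HS [HL HQ]].
  pose proof Hb as (?&?&?&?&?&?&?&?&?&?&?).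
  destruct (trace_bounds b f (theta f) (B_theta b) Hb Hf) as [Tr1 Tr2];
    [lra|apply (theta_sup b f Hf)|apply (theta_lip b f Hf)|].
  assert (Hq0 : 0 <= (B_omega b + B_theta b) / speed_min b) by (apply Rdiv_le_0_compat; lra).
  assert (Hq1 : 0 <= Lip b / speed_min b) by (apply Rdiv_le_0_compat; lra).
  assert (Hq2 : 0 <= (B_omega b + B_theta b) * (2 * Lip b) / (speed_min b * speed_min b)).
  { apply Rdiv_le_0_compat; [apply Rmult_le_pos; lra|]. now apply Rmult_lt_0_compat. }
  assert (I0 : I01 0) by (unfold I01; lra).
  constructor.
  - intros x Hx. apply (class_speed b f x Hf Hx).
  - intros x Hx. apply (class_speed b f x Hf Hx).
  - intros x Hx. pose proof (mu_sup b f Hf x Hx) as Hm. apply Rabs_le_between in Hm.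
    unfold coef_sup. lra.
  - intros x y Hx Hy. eapply Rle_trans; [apply (mu_lip b f Hf); assumption|].
    apply Rmult_le_compat_r; [apply Rabs_pos|]. unfold coef_lip. lra.
  - apply (coef_ok_xi _ _ (B_lambda' b + B_sigma b) (fun xi => lambda' f xi + sigma f xi));
      [exact HL|unfold coef_sup; lra|].
    intros x Hx. apply Rabs_plus_le; [now apply (lambda'_sup b f Hf)|now apply (sigma_sup b f Hf)].
  - apply (coef_ok_xi _ _ (B_theta b)); [exact HL|unfold coef_sup; lra|apply (theta_sup b f Hf)].
  - apply (coef_ok_xi _ _ (B_omega b)); [exact HL|unfold coef_sup; lra|apply (omega_sup b f Hf)].
  - apply (coef_ok_xi _ _ (B_mu' b) (fun xi => - mu' f xi)); [exact HL|unfold coef_sup; lra|].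
    intros x Hx. rewrite Rabs_Ropp. now apply (mu'_sup b f Hf).
  - unfold reflection_sup, Rdiv. destruct (class_speed b f 0 Hf I0).
    apply Rabs_mult_le.
    + apply Rabs_mult_le; [apply (q_bound b f Hf)|now apply (lambda_sup b f Hf)].
    + rewrite Rabs_right; [apply Rinv_le_contravar; lra|]. left. apply Rinv_0_lt_compat. lra.
  - intros x Hx. rewrite (bc_k1 f u v Hk) by assumption. rewrite Rabs_Ropp. auto.
  - intros x y Hx Hy. rewrite !(bc_k1 f u v Hk) by assumption.
    replace (- (theta f x / (lambda f x + mu f x)) - - (theta f y / (lambda f y + mu f y)))
      with (- (theta f x / (lambda f x + mu f x) - theta f y / (lambda f y + mu f y))) by ring.
    rewrite Rabs_Ropp. now apply Tr2.
  - intros x xi HT. unfold tr_u. rewrite (pde_k1 f u v Hk) by assumption. ring.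
  - intros x xi HT. unfold tr_v. rewrite (pde_k2 f u v Hk) by assumption. ring.
  - intros x Hx. destruct (class_speed b f 0 Hf I0).
    apply (Rmult_eq_reg_l (mu f 0)); [|lra].
    rewrite (bc_k2 f u v Hk) by assumption. field. lra.
Qed.

Lemma goursat_m_system b f u v :
  positive_constants b -> in_class b f -> goursat_m f u v -> system_m b f u v.
Proof.
  intros Hb Hf Hm. pose proof (speed_min_pos b Hb) as HP.
  pose proof (class_constants_nonneg b Hb) as [HS [HL HQ]].
  pose proof Hb as (?&?&?&?&?&?&?&?&?&?&?).
  destruct (trace_bounds b f (omega f) (B_omega b) Hb Hf) as [Tr1 Tr2];
    [lra|apply (omega_sup b f Hf)|apply (omega_lip b f Hf)|].
  assert (Hq0 : 0 <= (B_omega b + B_theta b) / speed_min b) by (apply Rdiv_le_0_compat; lra).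
  assert (Hq1 : 0 <= Lip b / speed_min b) by (apply Rdiv_le_0_compat; lra).
  assert (Hq2 : 0 <= (B_omega b + B_theta b) * (2 * Lip b) / (speed_min b * speed_min b)).
  { apply Rdiv_le_0_compat; [apply Rmult_le_pos; lra|]. now apply Rmult_lt_0_compat. }
  assert (Hrl : forall g, lipschitz (Lip b) g -> forall x y, I01 x -> I01 y ->
    Rabs (g (1 - x) - g (1 - y)) <= coef_lip b * Rabs (x - y)).
  { intros g Hg x y Hx Hy.
    eapply Rle_trans; [apply Hg; now apply I01_reflect|].
    replace (1 - x - (1 - y)) with (- (x - y)) by ring. rewrite Rabs_Ropp.
    apply Rmult_le_compat_r; [apply Rabs_pos|]. unfold coef_lip. lra. }
  assert (Hrs : forall B g, sup_le B g -> sup_le B (fun x => g (1 - x))).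
  { intros B g Hg x Hx. apply Hg. now apply I01_reflect. }
  constructor.
  - intros x Hx. apply (class_speed b f (1 - x) Hf). now apply I01_reflect.
  - intros x Hx. apply (class_speed b f (1 - x) Hf). now apply I01_reflect.
  - intros x Hx. pose proof (Hrs _ _ (mu_sup b f Hf) x Hx) as Hmu. apply Rabs_le_between in Hmu.
    unfold coef_sup. lra.
  - intros x y Hx Hy. now apply (Hrl (mu f) (mu_lip b f Hf)).
  - split.
    + intros x xi HT. destruct (T_I01 _ _ HT) as [Ix Ixi].
      eapply Rle_trans.
      * apply Rabs_plus_le; [apply (Hrs _ _ (mu'_sup b f Hf) x Ix)|
          apply (Hrs _ _ (sigma_sup b f Hf) xi Ixi)].
      * unfold coef_sup. lra.
    + intros x y xi HT HT'. destruct (T_I01 _ _ HT) as [Ix Ixi].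
      destruct (T_I01 _ _ HT') as [Iy _].
      replace (mu' f (1 - x) + sigma f (1 - xi) - (mu' f (1 - y) + sigma f (1 - xi)))
        with (mu' f (1 - x) - mu' f (1 - y)) by ring.
      now apply (Hrl (mu' f) (mu'_lip b f Hf)).
  - apply (coef_ok_xi _ _ (B_omega b) (fun xi => omega f (1 - xi)));
      [exact HL|unfold coef_sup; lra|apply Hrs, (omega_sup b f Hf)].
  - apply (coef_ok_xi _ _ (B_theta b) (fun xi => theta f (1 - xi)));
      [exact HL|unfold coef_sup; lra|apply Hrs, (theta_sup b f Hf)].
  - split.
    + intros x xi HT. destruct (T_I01 _ _ HT) as [Ix Ixi].
      pose proof (Hrs _ _ (mu'_sup b f Hf) x Ix). cbv beta in *. unfold coef_sup. lra.
    + intros x y xi HT HT'. destruct (T_I01 _ _ HT) as [Ix Ixi].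
      destruct (T_I01 _ _ HT') as [Iy _].
      now apply (Hrl (mu' f) (mu'_lip b f Hf)).
  - rewrite Rabs_R0. exact HQ.
  - intros x Hx. simpl. rewrite (bc_m1 f u v Hm) by now apply I01_reflect.
    apply Tr1. now apply I01_reflect.
  - intros x y Hx Hy. simpl. rewrite !(bc_m1 f u v Hm) by now apply I01_reflect.
    eapply Rle_trans; [apply Tr2; now apply I01_reflect|].
    replace (1 - x - (1 - y)) with (- (x - y)) by ring. rewrite Rabs_Ropp. lra.
  - intros x xi HT. pose proof (pde_m1 f u v Hm _ _ (T_reflect _ _ HT)) as E.
    unfold tr_u. simpl. lra.
  - intros x xi HT. pose proof (pde_m2 f u v Hm _ _ (T_reflect _ _ HT)) as E.
    unfold tr_v. simpl. lra.
  - intros x Hx. simpl. replace (1 - 0) with 1 by ring.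
    rewrite (bc_m2 f u v Hm) by now apply I01_reflect. ring.
Qed.

Lemma kernels_C1_bound (b : class_constants) :
  positive_constants b -> exists M, 0 < M /\
  forall f k, in_class b f -> is_K f k -> forall i x xi, T x xi ->
    Rabs (K_value k i x xi) <= M /\ Rabs (d_x (K_value k i) x xi) <= M /\
    Rabs (d_xi (K_value k i) x xi) <= M.
Proof.
  intros Hb. pose proof (class_constants_nonneg b Hb) as [HS [HL HQ]].
  destruct (goursat_C1_bound _ _ _ _ (speed_min_pos b Hb) HS HL HQ) as [M [HM H]].
  exists M. split; [exact HM|].
  intros f k Hf [Hk Hm] i x xi HT.
  pose proof (H _ _ _ _ _ _ _ _ _ (goursat_k_system b f _ _ Hb Hf Hk) x xi HT) as Bk.
  pose proof (H _ _ _ _ _ _ _ _ _ (goursat_m_system b f _ _ Hb Hf Hm) _ _ (T_reflect _ _ HT)) as Bm.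
  cbn [c1t d_x d_xi reflect make_C1_T] in Bm.
  replace (1 - (1 - x)) with x in Bm by ring. replace (1 - (1 - xi)) with xi in Bm by ring.
  rewrite !Rabs_Ropp in Bm.
  destruct i; simpl; tauto.
Qed.

Lemma kernels_stability (b : class_constants) :
  positive_constants b -> exists M, 0 < M /\
  forall f k g h del, in_class b f -> is_K f k -> in_class b g -> is_K g h ->
    0 <= del -> coef_close del f g -> forall i x xi, T x xi ->
    Rabs (K_value k i x xi - K_value h i x xi) <= M * del.
Proof.
  intros Hb. pose proof (class_constants_nonneg b Hb) as [HS [HL HQ]].
  pose proof (speed_min_pos b Hb) as HP.
  destruct (goursat_stability _ _ _ _ HP HS HL HQ) as [M [HM H]].
  set (P := speed_min b) in *.
  pose proof Hb as (?&?&?&?&?&?&?&?&?&?&?).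
  set (c1 := 1 / P + (B_omega b + B_theta b) * 2 / (P * P)).
  set (c2 := (B_lambda b + B_q b) / P + B_q b * B_lambda b / (P * P)).
  assert (HPP : 0 < P * P) by now apply Rmult_lt_0_compat.
  assert (Hc1 : 0 <= c1).
  { assert (0 <= 1 / P) by (apply Rdiv_le_0_compat; lra).
    assert (0 <= (B_omega b + B_theta b) * 2 / (P * P)) by (apply Rdiv_le_0_compat; lra).
    unfold c1. lra. }
  assert (Hc2 : 0 <= c2).
  { assert (0 <= (B_lambda b + B_q b) / P) by (apply Rdiv_le_0_compat; lra).
    assert (0 <= B_q b * B_lambda b / (P * P)) by (apply Rdiv_le_0_compat; [nra|lra]).
    unfold c2. lra. }
  set (c := 2 + c1 + c2).
  exists (M * c). split. { apply Rmult_lt_0_compat; unfold c; lra. }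
  intros f k g h del Hf [Hk Hm] Hg [Hk' Hm'] Hdel Hcl i x xi HT.
  destruct Hcl as [C1 C2 C3 C4 C5 C6 C7 C8].
  assert (Hcd : 0 <= c * del) by (apply Rmult_le_pos; unfold c; lra).
  assert (Hcd1 : del <= c * del) by (unfold c; nra).
  assert (Hcd2 : del + del <= c * del).
  { unfold c. assert (0 <= (c1 + c2) * del) by (apply Rmult_le_pos; lra). lra. }
  assert (Hs : forall x, I01 x ->
    Rabs (lambda f x + mu f x - (lambda g x + mu g x)) <= 2 * del).
  { intros y Hy. replace (lambda f y + mu f y - (lambda g y + mu g y))
      with ((lambda f y - lambda g y) + (mu f y - mu g y)) by ring.
    replace (2 * del) with (del + del) by ring. apply Rabs_plus_le; auto. }
  assert (Htr : forall a a' : R -> R, (forall x, I01 x -> Rabs (a x - a' x) <= del) ->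
    forall B, B <= B_omega b + B_theta b -> sup_le B a' -> forall x, I01 x ->
    Rabs (a x / (lambda f x + mu f x) - a' x / (lambda g x + mu g x)) <= c * del).
  { intros a a' Ha B HB Ha' y Hy.
    destruct (class_speed b f y Hf Hy). destruct (class_speed b g y Hg Hy).
    eapply Rle_trans.
    - apply (quotient_diff P _ _ _ _ del (2 * del) (B_omega b + B_theta b)); auto; try (unfold P in *; lra).
      specialize (Ha' y Hy). lra.
    - replace (del / P + (B_omega b + B_theta b) * (2 * del) / (P * P)) with (c1 * del)
        by (unfold c1; field; lra).
      apply Rmult_le_compat_r; [exact Hdel|unfold c; lra]. }
  assert (I0 : I01 0) by (unfold I01; lra).
  assert (Hr : Rabs (q f * lambda f 0 / mu f 0 - q g * lambda g 0 / mu g 0) <= c * del).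
  { destruct (class_speed b f 0 Hf I0). destruct (class_speed b g 0 Hg I0).
    eapply Rle_trans.
    - apply (quotient_diff P _ _ _ _ (del * B_lambda b + B_q b * del) del (B_q b * B_lambda b));
        auto; try (unfold P in *; lra).
      + replace (q f * lambda f 0 - q g * lambda g 0)
          with ((q f - q g) * lambda f 0 + q g * (lambda f 0 - lambda g 0)) by ring.
        apply Rabs_plus_le; apply Rabs_mult_le; auto.
        * now apply (lambda_sup b f Hf).
        * apply (q_bound b g Hg).
      + apply Rabs_mult_le; [apply (q_bound b g Hg)|now apply (lambda_sup b g Hg)].
    - replace ((del * B_lambda b + B_q b * del) / P + B_q b * B_lambda b * del / (P * P))
        with (c2 * del) by (unfold c2; field; lra).
      apply Rmult_le_compat_r; [exact Hdel|unfold c; lra]. }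
  assert (Sk := H _ _ _ _ _ _ _ _ _ _ _ _ _ _ _ _ _ _ (c * del)
    (goursat_k_system b f _ _ Hb Hf Hk) (goursat_k_system b g _ _ Hb Hg Hk') Hcd).
  assert (Sm := H _ _ _ _ _ _ _ _ _ _ _ _ _ _ _ _ _ _ (c * del)
    (goursat_m_system b f _ _ Hb Hf Hm) (goursat_m_system b g _ _ Hb Hg Hm') Hcd).
  assert (L1 : forall e e', (forall x, I01 x -> Rabs (e x - e' x) <= del) ->
    forall x, I01 x -> Rabs (e x - e' x) <= c * del).
  { intros e e' He y Hy. specialize (He y Hy). lra. }
  assert (L2 : forall e e', (forall x, I01 x -> Rabs (e x - e' x) <= del) ->
    forall x, I01 x -> Rabs (e (1 - x) - e' (1 - x)) <= c * del).
  { intros e e' He y Hy. apply (L1 e e' He). now apply I01_reflect. }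
  assert (Bk : forall x xi, T x xi -> Rabs (k1 k x xi - k1 h x xi) <= M * (c * del) /\
     Rabs (k2 k x xi - k2 h x xi) <= M * (c * del)).
  { apply Sk; auto.
    - intros y eta HT'. destruct (T_I01 _ _ HT') as [Iy Ie].
      replace (lambda' f eta + sigma f eta - (lambda' g eta + sigma g eta))
        with ((lambda' f eta - lambda' g eta) + (sigma f eta - sigma g eta)) by ring.
      eapply Rle_trans; [apply Rabs_plus_le; auto|exact Hcd2].
    - intros y eta HT'. apply T_I01 in HT'. now apply L1.
    - intros y eta HT'. apply T_I01 in HT'. now apply L1.
    - intros y eta HT'. apply T_I01 in HT'.
      replace (- mu' f eta - - mu' g eta) with (- (mu' f eta - mu' g eta)) by ring.
      rewrite Rabs_Ropp. now apply L1.
    - intros y Hy. rewrite (bc_k1 _ _ _ Hk), (bc_k1 _ _ _ Hk') by assumption.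
      replace (- (theta f y / (lambda f y + mu f y)) - - (theta g y / (lambda g y + mu g y)))
        with (- (theta f y / (lambda f y + mu f y) - theta g y / (lambda g y + mu g y))) by ring.
      rewrite Rabs_Ropp. apply (Htr _ _ C5 (B_theta b)); auto; [lra|apply (theta_sup b g Hg)]. }
  assert (Bm : forall x xi, T x xi ->
     Rabs (reflect (m1 k) x xi - reflect (m1 h) x xi) <= M * (c * del) /\
     Rabs (reflect (m2 k) x xi - reflect (m2 h) x xi) <= M * (c * del)).
  { apply Sm; auto.
    - intros y eta HT'. destruct (T_I01 _ _ HT') as [Iy Ie].
      apply I01_reflect in Iy, Ie.
      replace (mu' f (1 - y) + sigma f (1 - eta) - (mu' g (1 - y) + sigma g (1 - eta)))
        with ((mu' f (1 - y) - mu' g (1 - y)) + (sigma f (1 - eta) - sigma g (1 - eta))) by ring.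
      eapply Rle_trans; [apply Rabs_plus_le; auto|exact Hcd2].
    - intros y eta HT'. apply T_I01 in HT'. now apply (L2 (omega f) (omega g)).
    - intros y eta HT'. apply T_I01 in HT'. now apply (L2 (theta f) (theta g)).
    - intros y eta HT'. apply T_I01 in HT'. now apply (L2 (mu' f) (mu' g)).
    - replace (0 - 0) with 0 by ring. now rewrite Rabs_R0.
    - intros y Hy. apply I01_reflect in Hy. simpl.
      rewrite (bc_m1 _ _ _ Hm), (bc_m1 _ _ _ Hm') by assumption.
      apply (Htr _ _ C4 (B_omega b)); auto; [lra|apply (omega_sup b g Hg)]. }
  specialize (Bk x xi HT). specialize (Bm _ _ (T_reflect _ _ HT)).
  cbn [c1t reflect make_C1_T] in Bm.
  replace (1 - (1 - x)) with x in Bm by ring. replace (1 - (1 - xi)) with xi in Bm by ring.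
  rewrite (Rmult_assoc M). destruct i; simpl; tauto.
Qed.

(** * Volterra equations on the triangle *)

Definition clamp (a b t : R) : R := Rmax a (Rmin t b).

Lemma clamp_in a b t : a <= b -> a <= clamp a b t <= b.
Proof.
  intros H. unfold clamp. split; [apply Rmax_l|].
  apply Rmax_lub; [exact H|apply Rmin_r].
Qed.

Lemma clamp_id a b t : a <= t <= b -> clamp a b t = t.
Proof. intros H. unfold clamp. rewrite Rmin_left by lra. apply Rmax_right. lra. Qed.

Lemma clamp_lipschitz a b s t : Rabs (clamp a b s - clamp a b t) <= Rabs (s - t).
Proof.
  unfold clamp, Rmax, Rmin.
  repeat destruct (Rle_dec _ _); unfold Rabs; repeat destruct (Rcase_abs _); lra.
Qed.

Definition cont_seg (a b : R) (f : R -> R) : Prop :=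
  forall s, a <= s <= b -> forall eps, 0 < eps -> exists del, 0 < del /\
    forall t, a <= t <= b -> Rabs (t - s) < del -> Rabs (f t - f s) < eps.

Lemma cont_seg_clamp a b f : a <= b -> cont_seg a b f ->
  forall t, continuous (fun s => f (clamp a b s)) t.
Proof.
  intros Hab Hf t. apply filterlim_locally. intros eps.
  destruct (Hf (clamp a b t) (clamp_in a b t Hab) eps (cond_pos eps)) as [d [Hd H]].
  exists (mkposreal d Hd). intros s Hs. apply H; [now apply clamp_in|].
  eapply Rle_lt_trans; [apply clamp_lipschitz|exact Hs].
Qed.

Lemma ex_RInt_seg a b f : a <= b -> cont_seg a b f -> ex_RInt f a b.
Proof.
  intros Hab Hf.
  apply (ex_RInt_ext (fun s => f (clamp a b s))).
  - intros s Hs. rewrite Rmin_left, Rmax_right in Hs by lra. rewrite clamp_id by lra. reflexivity.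
  - apply (ex_RInt_continuous (V := R_CompleteNormedModule)). intros. now apply cont_seg_clamp.
Qed.

Lemma cont_seg_mult a b f g :
  cont_seg a b f -> cont_seg a b g -> cont_seg a b (fun s => f s * g s).
Proof.
  intros Hf Hg s Hs eps He.
  set (K := 1 + Rabs (f s) + Rabs (g s)).
  pose proof (Rabs_pos (f s)). pose proof (Rabs_pos (g s)).
  set (e := Rmin 1 (eps / (3 * K))).
  assert (HK : 1 <= K) by (unfold K; lra).
  assert (H3 : 0 < eps / (3 * K)) by (apply Rdiv_lt_0_compat; lra).
  assert (He0 : 0 < e) by (apply Rmin_glb_lt; lra).
  assert (He1 : e <= 1) by apply Rmin_l.
  assert (HeK : e * K <= eps / 3).
  { apply Rle_trans with (eps / (3 * K) * K); [apply Rmult_le_compat_r; [lra|apply Rmin_r]|].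
    right. field. lra. }
  destruct (Hf s Hs e He0) as [d1 [D1 F1]]. destruct (Hg s Hs e He0) as [d2 [D2 F2]].
  exists (Rmin d1 d2). split; [now apply Rmin_glb_lt|].
  intros t Ht Hts. pose proof (Rmin_l d1 d2). pose proof (Rmin_r d1 d2).
  specialize (F1 t Ht ltac:(lra)). specialize (F2 t Ht ltac:(lra)).
  replace (f t * g t - f s * g s)
    with ((f t - f s) * (g t - g s) + (f t - f s) * g s + f s * (g t - g s)) by ring.
  apply Rle_lt_trans with (e * 1 + e * Rabs (g s) + Rabs (f s) * e).
  - apply Rabs_plus_le; [apply Rabs_plus_le|]; apply Rabs_mult_le; lra.
  - unfold K in HeK. lra.
Qed.

Lemma cont_T_row a x : I01 x -> cont_T a -> cont_seg 0 x (fun s => a x s).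
Proof.
  intros Hx Ha s Hs eps He.
  destruct (Ha x s ltac:(unfold T, I01 in *; lra) eps He) as [d [Hd H]].
  exists d. split; [exact Hd|]. intros t Ht Hts. apply H; auto.
  - unfold T, I01 in *; lra.
  - replace (x - x) with 0 by ring. now rewrite Rabs_R0.
Qed.

Lemma cont_T_column b xi : I01 xi -> cont_T b -> cont_seg xi 1 (fun s => b s xi).
Proof.
  intros Hx Ha s Hs eps He.
  destruct (Ha s xi ltac:(unfold T, I01 in *; lra) eps He) as [d [Hd H]].
  exists d. split; [exact Hd|]. intros t Ht Hts. apply H; auto.
  - unfold T, I01 in *; lra.
  - replace (xi - xi) with 0 by ring. now rewrite Rabs_R0.
Qed.

Lemma cont_seg_sub a b a' b' f : a <= a' -> b' <= b -> cont_seg a b f -> cont_seg a' b' f.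
Proof.
  intros Ha Hb Hf s Hs eps He. destruct (Hf s ltac:(lra) eps He) as [d [Hd H]].
  exists d. split; [exact Hd|]. intros t Ht. apply H. lra.
Qed.

Lemma cont_seg_abs a b f : cont_seg a b f -> cont_seg a b (fun s => Rabs (f s)).
Proof.
  intros Hf s Hs eps He. destruct (Hf s Hs eps He) as [d [Hd H]].
  exists d. split; [exact Hd|]. intros t Ht Hts. specialize (H t Ht Hts).
  eapply Rle_lt_trans; [apply Rabs_triang_inv2|exact H].
Qed.

Definition volterra (a b : R -> R -> R) (x xi : R) : R :=
  RInt (fun s => a x s * b s xi) xi x.

Lemma cont_seg_volterra a b x xi : T x xi -> cont_T a -> cont_T b ->
  cont_seg xi x (fun s => a x s * b s xi).
Proof.
  intros HT Ha Hb. destruct (T_I01 _ _ HT) as [Ix Ixi].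
  apply cont_seg_mult.
  - apply (cont_seg_sub 0 x); [unfold T in *; lra|lra|]. now apply cont_T_row.
  - apply (cont_seg_sub xi 1); [lra|unfold T in *; lra|]. now apply cont_T_column.
Qed.

Lemma ex_RInt_volterra a b x xi : T x xi -> cont_T a -> cont_T b ->
  ex_RInt (fun s => a x s * b s xi) xi x.
Proof.
  intros HT Ha Hb. apply ex_RInt_seg; [unfold T in *; lra|]. now apply cont_seg_volterra.
Qed.

Lemma cont_seg_volterra_abs a x xi : T x xi -> cont_T a -> cont_seg xi x (fun s => Rabs (a x s)).
Proof.
  intros HT Ha. destruct (T_I01 _ _ HT). apply cont_seg_abs.
  apply (cont_seg_sub 0 x); [unfold T in *; lra|lra|]. now apply cont_T_row.
Qed.

Lemma Rabs_volterra_le a b M x xi : T x xi -> cont_T a -> cont_T b ->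
  (forall x xi, T x xi -> Rabs (b x xi) <= M) ->
  Rabs (volterra a b x xi) <= RInt (fun s => M * Rabs (a x s)) xi x.
Proof.
  intros HT Ha Hb HM. unfold volterra.
  assert (Hxx : xi <= x) by (unfold T in *; lra).
  apply (norm_RInt_le (V := R_NormedModule) (fun s => a x s * b s xi) (fun s => M * Rabs (a x s)) xi x).
  - exact Hxx.
  - intros s Hs. change (Rabs (a x s * b s xi) <= M * Rabs (a x s)).
    rewrite Rmult_comm. apply Rabs_mult_le; [|lra]. apply HM. unfold T in *; lra.
  - apply (RInt_correct (V := R_CompleteNormedModule)). now apply ex_RInt_volterra.
  - apply (RInt_correct (V := R_CompleteNormedModule)). apply ex_RInt_seg; [lra|].
    apply cont_seg_mult; [|now apply cont_seg_volterra_abs].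
    intros s Hs eps He. exists 1. split; [lra|]. intros. replace (M - M) with 0 by ring.
    now rewrite Rabs_R0.
Qed.

Lemma volterra_bound a b A M x xi : T x xi -> cont_T a -> cont_T b ->
  0 <= A -> 0 <= M ->
  (forall x xi, T x xi -> Rabs (a x xi) <= A) ->
  (forall x xi, T x xi -> Rabs (b x xi) <= M) ->
  Rabs (volterra a b x xi) <= A * M.
Proof.
  intros HT Ha Hb A0 M0 HA HM. unfold volterra.
  assert (Hxx : 0 <= x - xi <= 1) by (unfold T in *; lra).
  apply Rle_trans with ((x - xi) * (A * M)).
  - apply abs_RInt_le_const; [lra|now apply ex_RInt_volterra|].
    intros s Hs. apply Rabs_mult_le; [apply HA|apply HM]; unfold T in *; lra.
  - assert (0 <= A * M) by now apply Rmult_le_pos. nra.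
Qed.

Lemma volterra_minus_l a a' b x xi : T x xi -> cont_T a -> cont_T a' -> cont_T b ->
  volterra a b x xi - volterra a' b x xi = volterra (fun x xi => a x xi - a' x xi) b x xi.
Proof.
  intros HT Ha Ha' Hb. unfold volterra. symmetry.
  rewrite <- (RInt_minus (V := R_CompleteNormedModule) (fun s => a x s * b s xi)
    (fun s => a' x s * b s xi)) by now apply ex_RInt_volterra.
  apply RInt_ext. intros s _. unfold minus, plus, opp. simpl. ring.
Qed.

Lemma volterra_minus_r a b b' x xi : T x xi -> cont_T a -> cont_T b -> cont_T b' ->
  volterra a b x xi - volterra a b' x xi = volterra a (fun x xi => b x xi - b' x xi) x xi.
Proof.
  intros HT Ha Hb Hb'. unfold volterra. symmetry.
  rewrite <- (RInt_minus (V := R_CompleteNormedModule) (fun s => a x s * b s xi)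
    (fun s => a x s * b' s xi)) by now apply ex_RInt_volterra.
  apply RInt_ext. intros s _. unfold minus, plus, opp. simpl. ring.
Qed.

Lemma volterra_unit_interval a b x xi : T x xi -> cont_T a -> cont_T b ->
  let g := fun t => (x - xi) * (a x ((x - xi) * t + xi) * b ((x - xi) * t + xi) xi) in
  volterra a b x xi = RInt g 0 1 /\ ex_RInt g 0 1.
Proof.
  intros HT Ha Hb g.
  pose proof (ex_RInt_volterra a b x xi HT Ha Hb) as Hex.
  assert (E0 : (x - xi) * 0 + xi = xi) by ring. assert (E1 : (x - xi) * 1 + xi = x) by ring.
  split.
  - symmetry.
    transitivity (RInt (fun s => a x s * b s xi) ((x - xi) * 0 + xi) ((x - xi) * 1 + xi));
      [|now rewrite E0, E1].
    apply (RInt_comp_lin (V := R_CompleteNormedModule) (fun s => a x s * b s xi) (x - xi) xi 0 1).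
    rewrite E0, E1. exact Hex.
  - apply (ex_RInt_comp_lin (V := R_NormedModule) (fun s => a x s * b s xi) (x - xi) xi 0 1).
    rewrite E0, E1. exact Hex.
Qed.

(** On the unit interval the integrands for two points of [T] can be compared
    pointwise, which the moving limits [xi] and [x] would prevent. *)
Lemma cont_T_volterra a b : cont_T a -> cont_T b -> cont_T (volterra a b).
Proof.
  intros Ha Hb x xi HT eps He.
  destruct (cont_T_bounded a Ha) as [A [A0 HA]].
  destruct (cont_T_bounded b Hb) as [B [B0 HB]].
  set (K := A * B + A + B + 1).
  assert (HAB : 0 < A * B) by now apply Rmult_lt_0_compat.
  assert (HK : 1 <= K) by (unfold K; lra).
  set (e := eps / (4 * K)).
  assert (He0 : 0 < e) by (apply Rdiv_lt_0_compat; lra).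
  destruct (cont_T_uniform a Ha e He0) as [d1 [D1 F1]].
  destruct (cont_T_uniform b Hb e He0) as [d2 [D2 F2]].
  set (d := Rmin (Rmin d1 d2) e).
  assert (Hd : 0 < d) by (repeat apply Rmin_glb_lt; assumption).
  assert (d <= d1 /\ d <= d2 /\ d <= e) as [Hd1 [Hd2 Hd3]].
  { pose proof (Rmin_l (Rmin d1 d2) e). pose proof (Rmin_r (Rmin d1 d2) e).
    pose proof (Rmin_l d1 d2). pose proof (Rmin_r d1 d2). unfold d. lra. }
  exists (d / 2). split; [lra|]. intros x' xi' HT' H1 H2.
  destruct (volterra_unit_interval a b x xi HT Ha Hb) as [-> E1].
  destruct (volterra_unit_interval a b x' xi' HT' Ha Hb) as [-> E2].
  match goal with |- Rabs (RInt ?f 0 1 - RInt ?g 0 1) < _ =>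
    rewrite <- (RInt_minus (V := R_CompleteNormedModule) f g) by assumption;
    apply Rle_lt_trans with ((1 - 0) * (eps * (3 / 4)));
    [apply abs_RInt_le_const; [lra|now apply (ex_RInt_minus (V := R_NormedModule))|]|lra] end.
  intros t Ht. unfold minus, plus, opp. cbn.
  set (s := (x - xi) * t + xi). set (s' := (x' - xi') * t + xi').
  assert (Hs : xi <= s <= x) by (unfold s, T in *; nra).
  assert (Hs' : xi' <= s' <= x') by (unfold s', T in *; nra).
  assert (Hss : Rabs (s' - s) < d).
  { replace (s' - s) with (t * (x' - x) + (1 - t) * (xi' - xi)) by (unfold s, s'; ring).
    apply Rle_lt_trans with (t * (d / 2) + (1 - t) * (d / 2)); [|lra].
    apply Rabs_plus_le; apply Rabs_mult_le; try (rewrite Rabs_right; lra); lra. }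
  assert (Ga : Rabs (a x' s' - a x s) < e).
  { apply F1; [unfold T in *; lra|unfold T in *; lra| |]; lra. }
  assert (Gb : Rabs (b s' xi' - b s xi) < e).
  { apply F2; [unfold T in *; lra|unfold T in *; lra| |]; lra. }
  assert (La : Rabs (a x s) <= A) by (apply HA; unfold T in *; lra).
  assert (Lb : Rabs (b s xi) <= B) by (apply HB; unfold T in *; lra).
  assert (La' : Rabs (a x' s') <= A) by (apply HA; unfold T in *; lra).
  assert (Lb' : Rabs (b s' xi') <= B) by (apply HB; unfold T in *; lra).
  replace ((x' - xi') * (a x' s' * b s' xi') + - ((x - xi) * (a x s * b s xi)))
    with (((x' - x) - (xi' - xi)) * (a x' s' * b s' xi')
      + (x - xi) * (a x' s' * (b s' xi' - b s xi) + (a x' s' - a x s) * b s xi)) by ring.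
  apply Rle_trans with ((e / 2 + e / 2) * (A * B) + 1 * (A * e + e * B)).
  - apply Rabs_plus_le; apply Rabs_mult_le.
    + apply Rabs_minus_le; lra.
    + now apply Rabs_mult_le.
    + unfold T in *. rewrite Rabs_right; lra.
    + apply Rabs_plus_le; apply Rabs_mult_le; lra.
  - assert (e * K = eps / 4) by (unfold e; field; lra). unfold K in *. nra.
Qed.

Lemma exp_weight_bounds (M : R) : 0 < M -> forall x xi, T x xi ->
  1 <= exp (2 * M * (x - xi)) <= exp (2 * M).
Proof.
  intros HM x xi HT. unfold T in HT. split; [rewrite <- exp_0|]; apply exp_le_compat; nra.
Qed.

Lemma RInt_exp_weight (N M W x xi : R) : 0 < N ->
  is_RInt (fun s => M * (W * exp (N * (x - s)))) xi x
    (M * W * ((exp (N * (x - xi)) - 1) / N)).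
Proof.
  intros HN.
  replace (M * W * ((exp (N * (x - xi)) - 1) / N))
    with (minus ((fun s => - (M * W / N) * exp (N * (x - s))) x)
      ((fun s => - (M * W / N) * exp (N * (x - s))) xi)).
  - apply (is_RInt_derive (V := R_CompleteNormedModule)
      (fun s => - (M * W / N) * exp (N * (x - s))) (fun s => M * (W * exp (N * (x - s))))).
    + intros s _. auto_derive; [exact I|]. replace (x + - s) with (x - s) by ring. field. lra.
    + intros s _. apply (continuous_of_derive (fun s => M * (W * exp (N * (x - s))))). auto_derive. exact I.
  - unfold minus, plus, opp. cbn. replace (N * (x - x)) with 0 by ring. rewrite exp_0.
    field. lra.
Qed.

(** Integrating the weight [exp (2 M (x - s))] gains [1 / (2 M)], which leaves half
    of the weighted norm once the kernel is bounded by [M]. *)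
Lemma volterra_contraction a b M W : 0 < M -> 0 <= W -> cont_T a -> cont_T b ->
  (forall x xi, T x xi -> Rabs (b x xi) <= M) ->
  (forall x xi, T x xi -> Rabs (a x xi) <= W * exp (2 * M * (x - xi))) ->
  forall x xi, T x xi ->
    RInt (fun s => M * Rabs (a x s)) xi x <= W / 2 * exp (2 * M * (x - xi)) /\
    Rabs (volterra a b x xi) <= W / 2 * exp (2 * M * (x - xi)).
Proof.
  intros HM HW Ha Hb HbM HaW x xi HT.
  assert (H1 : RInt (fun s => M * Rabs (a x s)) xi x <= W / 2 * exp (2 * M * (x - xi))).
  { pose proof (RInt_exp_weight (2 * M) M W x xi ltac:(lra)) as HI.
    apply Rle_trans with (RInt (fun s => M * (W * exp (2 * M * (x - s)))) xi x).
    - apply RInt_le.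
      + unfold T in *; lra.
      + apply ex_RInt_seg; [unfold T in *; lra|].
        apply cont_seg_mult; [|now apply cont_seg_volterra_abs].
        intros s Hs eps He. exists 1. split; [lra|]. intros. replace (M - M) with 0 by ring.
        now rewrite Rabs_R0.
      + eexists. exact HI.
      + intros s Hs. apply Rmult_le_compat_l; [lra|]. apply HaW. unfold T in *; lra.
    - rewrite (is_RInt_unique _ _ _ _ HI).
      replace (M * W * ((exp (2 * M * (x - xi)) - 1) / (2 * M)))
        with (W / 2 * (exp (2 * M * (x - xi)) - 1)) by (field; lra).
      lra. }
  split; [exact H1|]. eapply Rle_trans; [|exact H1]. now apply Rabs_volterra_le.
Qed.

(** At a maximum of [|phi|] divided by the weight, the integral accounts for at
    most half of the maximal value. *)
Lemma volterra_gronwall phi F M : 0 < M -> 0 <= F -> cont_T phi ->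
  (forall x xi, T x xi ->
    Rabs (phi x xi) <= F + RInt (fun s => M * Rabs (phi x s)) xi x) ->
  forall x xi, T x xi -> Rabs (phi x xi) <= 2 * F * exp (2 * M).
Proof.
  intros HM HF Hphi Hineq.
  set (psi := fun x xi => exp (- (2 * M) * (x - xi)) * Rabs (phi x xi)).
  assert (Hpsi : cont_T psi).
  { apply (cont_T_mult (fun x xi => exp (- (2 * M) * (x - xi)))).
    - apply (cont_T_comp (fun t => exp (- (2 * M) * t)) (fun x xi => x - xi)).
      + intros t. apply (continuous_of_derive (fun t => exp (- (2 * M) * t))). auto_derive. exact I.
      + apply cont_T_minus; [apply cont_T_x|apply cont_T_xi].
    - apply (cont_T_comp Rabs); [exact continuous_Rabs_at|exact Hphi]. }
  destruct (cont_T_max psi Hpsi) as [x0 [xi0 [H0 Hmax]]].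
  set (W := psi x0 xi0).
  assert (HW0 : 0 <= W).
  { apply Rmult_le_pos; [left; apply exp_pos|apply Rabs_pos]. }
  assert (Hexp : forall t, exp (- (2 * M) * t) * exp (2 * M * t) = 1).
  { intros t. rewrite <- exp_plus. replace (- (2 * M) * t + 2 * M * t) with 0 by ring. apply exp_0. }
  assert (Hw : forall x xi, T x xi -> Rabs (phi x xi) <= W * exp (2 * M * (x - xi))).
  { intros x xi HT. specialize (Hmax x xi HT). fold W in Hmax. unfold psi in Hmax.
    replace (Rabs (phi x xi))
      with (exp (- (2 * M) * (x - xi)) * Rabs (phi x xi) * exp (2 * M * (x - xi))).
    - apply Rmult_le_compat_r; [left; apply exp_pos|exact Hmax].
    - rewrite Rmult_assoc, (Rmult_comm (Rabs _)), <- Rmult_assoc, Hexp. ring. }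
  assert (HW : W <= 2 * F).
  { destruct (volterra_contraction phi (fun _ _ => 0) M W HM HW0 Hphi (cont_T_const 0)
      (fun _ _ _ => Rle_trans _ 0 _ (Req_le _ _ Rabs_R0) (Rlt_le _ _ HM)) Hw x0 xi0 H0) as [HI _].
    specialize (Hineq x0 xi0 H0).
    assert (EW : Rabs (phi x0 xi0) = W * exp (2 * M * (x0 - xi0))).
    { unfold W, psi.
      rewrite Rmult_assoc, (Rmult_comm (Rabs _)), <- Rmult_assoc, Hexp. ring. }
    assert (HE : 1 <= exp (2 * M * (x0 - xi0))).
    { now apply exp_weight_bounds. }
    rewrite EW in Hineq.
    assert (W * 1 <= W * exp (2 * M * (x0 - xi0))) by (apply Rmult_le_compat_l; lra). lra. }
  intros x xi HT. eapply Rle_trans; [now apply Hw|].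
  apply Rmult_le_compat; [exact HW0|left; apply exp_pos|exact HW|].
  now apply exp_weight_bounds.
Qed.

Lemma geometric_limit (a : nat -> R) (C : R) :
  (forall n, Rabs (a (S n) - a n) <= C / 2 ^ n) ->
  { l : R | forall n, Rabs (a n - l) <= 2 * C / 2 ^ n }.
Proof.
  intros H.
  assert (HC : 0 <= C).
  { specialize (H 0%nat). simpl in H. pose proof (Rabs_pos (a 1%nat - a 0%nat)). lra. }
  assert (Hp : forall n, 0 < 2 ^ n) by (intros; apply pow_lt; lra).
  assert (Hs : forall n m, Rabs (a (n + m)%nat - a n) <= 2 * C / 2 ^ n - 2 * C / 2 ^ (n + m)).
  { intros n m. induction m as [|m IH].
    - rewrite Nat.add_0_r. replace (a n - a n) with 0 by ring. rewrite Rabs_R0. lra.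
    - rewrite Nat.add_succ_r.
      replace (a (S (n + m)) - a n) with ((a (S (n + m)) - a (n + m)%nat) + (a (n + m)%nat - a n)) by ring.
      eapply Rle_trans; [apply Rabs_plus_le; [apply H|exact IH]|].
      right. simpl. pose proof (Hp n). pose proof (Hp (n + m)%nat). field. lra. }
  assert (Hs' : forall n m, (n <= m)%nat -> Rabs (a m - a n) <= 2 * C / 2 ^ n).
  { intros n m Hnm. replace m with (n + (m - n))%nat by lia.
    eapply Rle_trans; [apply Hs|].
    assert (0 <= 2 * C / 2 ^ (n + (m - n))) by (apply Rdiv_le_0_compat; [lra|apply Hp]). lra. }
  destruct (Rcomplete.R_complete a) as [l Hl].
  { intros eps He.
    destruct (pow_lt_1_zero (/ 2) ltac:(rewrite Rabs_right; lra) (eps / (4 * C + 1))) as [n Hn].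
    { apply Rdiv_lt_0_compat; lra. }
    exists n. intros p q Hp' Hq.
    assert (Hb : 2 * C / 2 ^ n < eps / 2).
    { specialize (Hn n (le_n n)). rewrite pow_inv, Rabs_right in Hn
        by (left; apply Rinv_0_lt_compat, Hp).
      unfold Rdiv at 1. apply Rle_lt_trans with (2 * C * (eps / (4 * C + 1))).
      - apply Rmult_le_compat_l; lra.
      - apply (Rmult_lt_reg_r (4 * C + 1)); [lra|].
        replace (2 * C * (eps / (4 * C + 1)) * (4 * C + 1)) with (2 * C * eps) by (field; lra).
        nra. }
    pose proof (Hs' n p Hp') as B1. pose proof (Hs' n q Hq) as B2.
    unfold Rdist. replace (a p - a q) with ((a p - a n) - (a q - a n)) by ring.
    eapply Rle_lt_trans; [apply Rabs_minus_le; eassumption|]. lra. }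
  exists l. intros n. apply le_epsilon. intros eps He.
  destruct (Hl eps He) as [m Hm].
  specialize (Hm (max n m) (Nat.le_max_r n m)).
  specialize (Hs' n (max n m) (Nat.le_max_l n m)).
  unfold Rdist in Hm.
  replace (a n - l) with ((a (max n m) - l) - (a (max n m) - a n)) by ring.
  eapply Rle_trans; [apply Rabs_minus_le; [left; exact Hm|exact Hs']|]. lra.
Qed.

(** Picard iteration; the contraction makes the increments decay like [2 ^ - n]. *)
Lemma volterra_solution (g k : R -> R -> R) : cont_T g -> cont_T k ->
  exists kappa : C0_T, forall x xi, T x xi ->
    kappa x xi = g x xi + volterra kappa k x xi.
Proof.
  intros Hg Hk.
  destruct (cont_T_bounded g Hg) as [A [A0 HA]].
  destruct (cont_T_bounded k Hk) as [M [M0 HM]].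
  set (K := fix K (n : nat) : R -> R -> R := match n with
    | O => g | S n => fun x xi => g x xi + volterra (K n) k x xi end).
  assert (HK : forall n, cont_T (K n)).
  { induction n as [|n IH]; [exact Hg|]. simpl. apply cont_T_plus; [exact Hg|].
    now apply cont_T_volterra. }
  set (C := A * M).
  assert (HC : 0 < C) by now apply Rmult_lt_0_compat.
  assert (Hp : forall n, 0 < 2 ^ n) by (intros; apply pow_lt; lra).
  pose proof (exp_weight_bounds M M0) as Hexp1.
  assert (Hstep : forall n x xi, T x xi ->
    Rabs (K (S n) x xi - K n x xi) <= C / 2 ^ n * exp (2 * M * (x - xi))).
  { induction n as [|n IH]; intros x xi HT.
    - simpl. replace (g x xi + volterra g k x xi - g x xi) with (volterra g k x xi) by ring.
      pose proof (volterra_bound g k A M x xi HT Hg Hk ltac:(lra) ltac:(lra) HA HM).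
      specialize (Hexp1 x xi HT). fold C in H. rewrite Rdiv_1_r. nra.
    - replace (K (S (S n)) x xi - K (S n) x xi)
        with (volterra (K (S n)) k x xi - volterra (K n) k x xi) by (simpl; ring).
      rewrite volterra_minus_l by auto.
      replace (C / 2 ^ S n) with (C / 2 ^ n / 2) by (simpl; field; specialize (Hp n); lra).
      apply (volterra_contraction (fun x xi => K (S n) x xi - K n x xi) k M (C / 2 ^ n)); auto.
      + apply Rdiv_le_0_compat; [lra|apply Hp].
      + now apply cont_T_minus. }
  set (C' := C * exp (2 * M)).
  assert (HC' : 0 < C') by (apply Rmult_lt_0_compat; [lra|apply exp_pos]).
  assert (Hstep' : forall x xi, T x xi -> forall n,
    Rabs (K (S n) x xi - K n x xi) <= C' / 2 ^ n).
  { intros x xi HT n. eapply Rle_trans; [now apply Hstep|].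
    replace (C' / 2 ^ n) with (C / 2 ^ n * exp (2 * M)) by (unfold C'; field; specialize (Hp n); lra).
    apply Rmult_le_compat_l; [apply Rdiv_le_0_compat; [lra|apply Hp]|]. now apply Hexp1. }
  assert (Hlim : forall z : R * R, exists l, T (fst z) (snd z) -> forall n,
    Rabs (K n (fst z) (snd z) - l) <= 2 * C' / 2 ^ n).
  { intros [x xi]. destruct (classic (T x xi)) as [HT|HT].
    - destruct (geometric_limit _ _ (Hstep' x xi HT)) as [l Hl]. exists l. auto.
    - exists 0. intros H. contradiction. }
  destruct (functional_choice _ Hlim) as [ka Hka].
  set (kap := fun x xi => ka (x, xi)).
  assert (Hkap : forall x xi, T x xi -> forall n, Rabs (K n x xi - kap x xi) <= 2 * C' / 2 ^ n)
    by (intros x xi HT; apply (Hka (x, xi) HT)).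
  assert (Hsmall : forall eps, 0 < eps -> exists n, 2 * C' / 2 ^ n < eps).
  { intros eps He.
    destruct (pow_lt_1_zero (/ 2) ltac:(rewrite Rabs_right; lra) (eps / (2 * C'))) as [n Hn].
    { apply Rdiv_lt_0_compat; lra. }
    exists n. specialize (Hn n (le_n n)). rewrite pow_inv, Rabs_right in Hn
      by (left; apply Rinv_0_lt_compat, Hp).
    apply Rlt_le_trans with (2 * C' * (eps / (2 * C'))).
    - apply Rmult_lt_compat_l; lra.
    - right. field. lra. }
  assert (Hcont : cont_T kap).
  { intros x xi HT eps He. destruct (Hsmall (eps / 3) ltac:(lra)) as [n Hn].
    destruct (HK n x xi HT (eps / 3) ltac:(lra)) as [d [Hd H]].
    exists d. split; [exact Hd|]. intros x' xi' HT' A1 A2.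
    specialize (H x' xi' HT' A1 A2).
    pose proof (Hkap x xi HT n) as B1. pose proof (Hkap x' xi' HT' n) as B2.
    apply Rabs_def2 in H. apply Rabs_le_between in B1, B2. apply Rabs_def1; lra. }
  exists (make_C0_T kap Hcont). intros x xi HT.
  change (kap x xi = g x xi + volterra kap k x xi).
  apply Rminus_diag_uniq.
  destruct (Req_dec (kap x xi - (g x xi + volterra kap k x xi)) 0) as [E|E]; [exact E|exfalso].
  apply Rabs_pos_lt in E. set (w := Rabs (kap x xi - (g x xi + volterra kap k x xi))) in *.
  destruct (Hsmall (w / (2 * (1 + M)))) as [n Hn]. { apply Rdiv_lt_0_compat; lra. }
  assert (Hw : w <= 2 * C' / 2 ^ n * (1 + M)).
  { unfold w.
    replace (kap x xi - (g x xi + volterra kap k x xi))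
      with ((volterra (K n) k x xi - volterra kap k x xi) - (K (S n) x xi - kap x xi))
      by (simpl; ring).
    rewrite volterra_minus_l by auto.
    assert (0 <= 2 * C' / 2 ^ n) by (apply Rdiv_le_0_compat; [lra|apply Hp]).
    replace (2 * C' / 2 ^ n * (1 + M)) with (2 * C' / 2 ^ n * M + 2 * C' / 2 ^ n) by ring.
    apply Rabs_minus_le.
    - apply volterra_bound; auto; [now apply cont_T_minus|lra].
    - eapply Rle_trans; [now apply Hkap|]. simpl.
      unfold Rdiv. apply Rmult_le_compat_l; [lra|].
      apply Rinv_le_contravar; [apply Hp|]. specialize (Hp n). lra. }
  assert (w < w / 2); [|lra].
  eapply Rle_lt_trans; [exact Hw|].
  apply Rlt_le_trans with (w / (2 * (1 + M)) * (1 + M)).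
  - apply Rmult_lt_compat_r; lra.
  - right. field. lra.
Qed.

(** * Shallow networks approximate polynomials with their gradients *)

Definition dot (d : nat) (w v : nat -> R) : R := sum_below d (fun j => w j * v j).

(** A network with one hidden layer, as the list of its neurons
    (outer weight, inner weights, bias). *)
Definition shallow : Type := list (R * (nat -> R) * R).

Definition shallow_eval (act : R -> R) (d : nat) (l : shallow) (v : nat -> R) : R :=
  fold_right (fun a s => fst (fst a) * act (dot d (snd (fst a)) v + snd a) + s) 0 l.

Definition shallow_grad (act : R -> R) (d : nat) (l : shallow) (j : nat) (v : nat -> R) : R :=
  fold_right (fun a s =>
    fst (fst a) * (snd (fst a) j * Derive act (dot d (snd (fst a)) v + snd a)) + s) 0 l.

Lemma sum_below_ext n f g : (forall i, (i < n)%nat -> f i = g i) -> sum_below n f = sum_below n g.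
Proof.
  induction n as [|n IH]; intros H; [reflexivity|].
  simpl. rewrite IH by (intros; apply H; lia). rewrite H by lia. reflexivity.
Qed.

Lemma sum_below_zero n f : (forall i, (i < n)%nat -> f i = 0) -> sum_below n f = 0.
Proof.
  induction n as [|n IH]; intros H; [reflexivity|].
  simpl. rewrite IH by (intros; apply H; lia). rewrite H by lia. ring.
Qed.

Lemma sum_below_S n f : sum_below (S n) f = f 0%nat + sum_below n (fun i => f (S i)).
Proof.
  induction n as [|n IH]; [simpl; ring|].
  change (sum_below (S (S n)) f) with (sum_below (S n) f + f (S n)).
  rewrite IH. simpl. ring.
Qed.

Lemma sum_below_list {A : Type} (g : A -> R) (l : list A) (a0 : A) :
  sum_below (length l) (fun i => g (nth i l a0)) = fold_right (fun a s => g a + s) 0 l.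
Proof.
  induction l as [|a l IH]; [reflexivity|].
  simpl length. rewrite sum_below_S. simpl. now rewrite IH.
Qed.

Definition fnn_of_shallow (d : nat) (l : shallow) : fnn d :=
  let n0 := (0, (fun _ => 0), 0) in
  Hidden d (length l) (fun i => snd (fst (nth i l n0))) (fun i => snd (nth i l n0))
    (Output (length l) (fun i => fst (fst (nth i l n0))) 0).

Lemma fnn_of_shallow_eval act d l v :
  fnn_eval act d (fnn_of_shallow d l) v = shallow_eval act d l v.
Proof.
  simpl. rewrite Rplus_0_r.
  exact (sum_below_list (fun a => fst (fst a) * act (dot d (snd (fst a)) v + snd a)) l
    (0, (fun _ => 0), 0)).
Qed.

Definition in_box (d : nat) (r : R) (v : nat -> R) : Prop :=
  forall j, (j < d)%nat -> Rabs (v j) <= r.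

Definition net_approx (act : R -> R) (d : nat)
    (p : (nat -> R) -> R) (dp : nat -> (nat -> R) -> R) : Prop :=
  forall r eps, 0 < eps -> exists l, forall v, in_box d r v ->
    Rabs (shallow_eval act d l v - p v) <= eps /\
    forall j, (j < d)%nat -> Rabs (shallow_grad act d l j v - dp j v) <= eps.

Lemma shallow_eval_app act d l l' v :
  shallow_eval act d (l ++ l') v = shallow_eval act d l v + shallow_eval act d l' v.
Proof. induction l as [|a l IH]; simpl; [ring|]. rewrite IH. ring. Qed.

Lemma shallow_grad_app act d l l' j v :
  shallow_grad act d (l ++ l') j v = shallow_grad act d l j v + shallow_grad act d l' j v.
Proof. induction l as [|a l IH]; simpl; [ring|]. rewrite IH. ring. Qed.

Definition shallow_scal (c : R) (l : shallow) : shallow :=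
  map (fun a => (c * fst (fst a), snd (fst a), snd a)) l.

Lemma shallow_eval_scal act d c l v :
  shallow_eval act d (shallow_scal c l) v = c * shallow_eval act d l v.
Proof. induction l as [|a l IH]; simpl; [ring|]. rewrite IH. ring. Qed.

Lemma shallow_grad_scal act d c l j v :
  shallow_grad act d (shallow_scal c l) j v = c * shallow_grad act d l j v.
Proof. induction l as [|a l IH]; simpl; [ring|]. rewrite IH. ring. Qed.

Lemma net_approx_plus act d p dp p' dp' :
  net_approx act d p dp -> net_approx act d p' dp' ->
  net_approx act d (fun v => p v + p' v) (fun j v => dp j v + dp' j v).
Proof.
  intros H H' r eps He.
  destruct (H r (eps / 2) ltac:(lra)) as [l Hl].
  destruct (H' r (eps / 2) ltac:(lra)) as [l' Hl'].
  exists (l ++ l'). intros v Hv. destruct (Hl v Hv) as [A B]. destruct (Hl' v Hv) as [A' B'].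
  split.
  - rewrite shallow_eval_app.
    replace (shallow_eval act d l v + shallow_eval act d l' v - (p v + p' v))
      with ((shallow_eval act d l v - p v) + (shallow_eval act d l' v - p' v)) by ring.
    eapply Rle_trans; [apply Rabs_plus_le; eassumption|]. lra.
  - intros j Hj. rewrite shallow_grad_app.
    replace (shallow_grad act d l j v + shallow_grad act d l' j v - (dp j v + dp' j v))
      with ((shallow_grad act d l j v - dp j v) + (shallow_grad act d l' j v - dp' j v)) by ring.
    eapply Rle_trans; [apply Rabs_plus_le; auto|]. lra.
Qed.

Lemma net_approx_scal act d c p dp :
  net_approx act d p dp -> net_approx act d (fun v => c * p v) (fun j v => c * dp j v).
Proof.
  intros H r eps He.
  assert (Hc : 0 < Rabs c + 1) by (pose proof (Rabs_pos c); lra).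
  destruct (H r (eps / (Rabs c + 1))) as [l Hl]. { now apply Rdiv_lt_0_compat. }
  assert (Hs : forall a, Rabs a <= eps / (Rabs c + 1) -> Rabs (c * a) <= eps).
  { intros a Ha. apply Rle_trans with ((Rabs c + 1) * (eps / (Rabs c + 1))).
    - apply Rabs_mult_le; lra.
    - right. field. lra. }
  exists (shallow_scal c l). intros v Hv. destruct (Hl v Hv) as [A B]. split.
  - rewrite shallow_eval_scal, <- Rmult_minus_distr_l. auto.
  - intros j Hj. rewrite shallow_grad_scal, <- Rmult_minus_distr_l. auto.
Qed.

Lemma net_approx_ext act d p dp p' dp' :
  (forall v, p v = p' v) -> (forall j v, (j < d)%nat -> dp j v = dp' j v) ->
  net_approx act d p dp -> net_approx act d p' dp'.
Proof.
  intros E E' H r eps He. destruct (H r eps He) as [l Hl]. exists l. intros v Hv.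
  destruct (Hl v Hv) as [A B]. split.
  - now rewrite <- E.
  - intros j Hj. rewrite <- E' by assumption. auto.
Qed.

Lemma net_approx_limit act d p dp :
  (forall r eps, 0 < eps -> exists p' dp', net_approx act d p' dp' /\
     forall v, in_box d r v -> Rabs (p' v - p v) <= eps /\
       forall j, (j < d)%nat -> Rabs (dp' j v - dp j v) <= eps) ->
  net_approx act d p dp.
Proof.
  intros H r eps He.
  destruct (H r (eps / 2) ltac:(lra)) as [p' [dp' [Hn Hc]]].
  destruct (Hn r (eps / 2) ltac:(lra)) as [l Hl].
  exists l. intros v Hv. destruct (Hc v Hv) as [A B]. destruct (Hl v Hv) as [A' B'].
  split.
  - replace (shallow_eval act d l v - p v)
      with ((shallow_eval act d l v - p' v) + (p' v - p v)) by ring.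
    eapply Rle_trans; [apply Rabs_plus_le; eassumption|]. lra.
  - intros j Hj. replace (shallow_grad act d l j v - dp j v)
      with ((shallow_grad act d l j v - dp' j v) + (dp' j v - dp j v)) by ring.
    eapply Rle_trans; [apply Rabs_plus_le; auto|]. lra.
Qed.

Lemma Derive_n_is_derive act n x : smooth act ->
  is_derive (Derive_n act n) x (Derive_n act (S n) x).
Proof. intros H. apply Derive_correct. exact (H (S n) x). Qed.

Lemma Derive_n_bounded act n Z : smooth act ->
  exists B, 0 < B /\ forall z, Rabs z <= Z -> Rabs (Derive_n act n z) <= B.
Proof.
  intros H.
  destruct (bounded_continuity (K := R_AbsRing) (V := R_NormedModule) (Derive_n act n) (- Z) Z) as [B HB].
  { intros x _. apply continuous_of_derive.
    eexists. now apply Derive_n_is_derive. }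
  exists (Rabs B + 1). split. { pose proof (Rabs_pos B). lra. }
  intros z Hz. apply Rabs_le_between in Hz. specialize (HB z Hz).
  change (norm (Derive_n act n z)) with (Rabs (Derive_n act n z)) in HB.
  pose proof (Rle_abs B). lra.
Qed.

Lemma Derive_n_increment act n Z B : smooth act ->
  (forall z, Rabs z <= Z -> Rabs (Derive_n act (S n) z) <= B) ->
  forall x y, Rabs x <= Z -> Rabs y <= Z ->
  exists c, Rabs c <= Z /\ Rabs (c - x) <= Rabs (y - x) /\
    Derive_n act n y - Derive_n act n x = Derive_n act (S n) c * (y - x) /\
    Rabs (Derive_n act n y - Derive_n act n x) <= B * Rabs (y - x).
Proof.
  intros Hs HB x y Hx Hy.
  destruct (MVT_gen (Derive_n act n) x y (Derive_n act (S n))) as [c [Hc E]].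
  - intros. now apply Derive_n_is_derive.
  - intros z _. apply continuity_pt_filterlim.
    apply continuous_of_derive.
    eexists. now apply Derive_n_is_derive.
  - assert (HcZ : Rabs c <= Z).
    { apply Rabs_le_between in Hx, Hy. apply Rabs_le.
      unfold Rmin, Rmax in Hc. destruct (Rle_dec x y); lra. }
    exists c. split; [exact HcZ|]. split.
    + unfold Rmin, Rmax in Hc. unfold Rabs.
      destruct (Rle_dec x y); repeat destruct (Rcase_abs _); lra.
    + split; [exact E|]. rewrite E. apply Rabs_mult_le; [auto|lra].
Qed.

Lemma difference_quotient act n Z t0 eps : smooth act -> 0 <= Z -> 0 <= t0 -> 0 < eps ->
  exists h0, 0 < h0 <= 1 /\ forall h z t, 0 < h <= h0 -> Rabs z <= Z -> Rabs t <= t0 ->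
    Rabs ((Derive_n act n (z + h * t) - Derive_n act n z) / h - t * Derive_n act (S n) z) <= eps /\
    Rabs (Derive_n act n (z + h * t) - Derive_n act n z) <= eps.
Proof.
  intros Hs HZ Ht0 He.
  destruct (Derive_n_bounded act (S n) (Z + t0) Hs) as [B1 [P1 H1]].
  destruct (Derive_n_bounded act (S (S n)) (Z + t0) Hs) as [B2 [P2 H2]].
  set (K := B1 * t0 + t0 * B2 * t0 + 1).
  assert (0 <= B1 * t0) by (apply Rmult_le_pos; lra).
  assert (0 <= t0 * B2 * t0) by (repeat apply Rmult_le_pos; lra).
  assert (HK : 1 <= K) by (unfold K; lra).
  exists (Rmin 1 (eps / K)). split.
  { split; [|apply Rmin_l]. apply Rmin_glb_lt; [lra|]. apply Rdiv_lt_0_compat; lra. }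
  intros h z t [Hh Hh'] Hz Ht.
  assert (Hh1 : h <= 1) by (eapply Rle_trans; [exact Hh'|apply Rmin_l]).
  assert (HhK : h * K <= eps).
  { apply Rle_trans with (eps / K * K); [|right; field; lra].
    apply Rmult_le_compat_r; [lra|]. eapply Rle_trans; [exact Hh'|apply Rmin_r]. }
  assert (Hht : Rabs (h * t) <= h * t0).
  { rewrite Rabs_mult, (Rabs_right h) by lra. apply Rmult_le_compat_l; lra. }
  assert (Hy : Rabs (z + h * t) <= Z + t0).
  { apply Rabs_plus_le; [exact Hz|]. eapply Rle_trans; [exact Hht|]. nra. }
  destruct (Derive_n_increment act n (Z + t0) B1 Hs H1 z (z + h * t) ltac:(lra) Hy)
    as [c [Hc [Hcz [E Hb]]]].
  replace (z + h * t - z) with (h * t) in * by ring.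
  split.
  - rewrite E.
    destruct (Derive_n_increment act (S n) (Z + t0) B2 Hs H2 z c ltac:(lra) Hc)
      as [_ [_ [_ [_ Hb2]]]].
    replace (Derive_n act (S n) c * (h * t) / h - t * Derive_n act (S n) z)
      with (t * (Derive_n act (S n) c - Derive_n act (S n) z)) by (field; lra).
    apply Rle_trans with (t0 * (B2 * (h * t0))).
    + apply Rabs_mult_le; [exact Ht|]. eapply Rle_trans; [exact Hb2|].
      apply Rmult_le_compat_l; lra.
    + unfold K in HhK. nra.
  - eapply Rle_trans; [exact Hb|]. apply Rle_trans with (B1 * (h * t0)).
    + apply Rmult_le_compat_l; lra.
    + unfold K in HhK. nra.
Qed.

Fixpoint mon (al : list nat) (v : nat -> R) : R :=
  match al with [] => 1 | i :: al => v i * mon al v end.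

Definition delta (i j : nat) : R := if Nat.eqb i j then 1 else 0.

Fixpoint dmon (al : list nat) (j : nat) (v : nat -> R) : R :=
  match al with [] => 0 | i :: al => delta i j * mon al v + v i * dmon al j v end.

Lemma mon_bounded d al r : List.Forall (fun i => (i < d)%nat) al -> 0 <= r ->
  exists B, 0 < B /\ forall v, in_box d r v ->
    Rabs (mon al v) <= B /\ forall j, Rabs (dmon al j v) <= B.
Proof.
  intros Hal Hr. induction Hal as [|i al Hi Hal [B [HB IH]]].
  - exists 1. split; [lra|]. intros v _. simpl. rewrite Rabs_R0, Rabs_R1.
    split; [lra|]. intros; lra.
  - exists (1 * B + r * B). split; [nra|]. intros v Hv. destruct (IH v Hv) as [A1 A2].
    specialize (Hv i Hi). split.
    + simpl. apply Rle_trans with (r * B); [now apply Rabs_mult_le|lra].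
    + intros j. simpl. apply Rabs_plus_le; apply Rabs_mult_le; auto.
      unfold delta. destruct (Nat.eqb i j); rewrite ?Rabs_R1, ?Rabs_R0; lra.
Qed.

Lemma sum_below_bound n f B : (forall i, (i < n)%nat -> Rabs (f i) <= B i) ->
  Rabs (sum_below n f) <= sum_below n B.
Proof.
  induction n as [|n IH]; intros H; simpl.
  - rewrite Rabs_R0. lra.
  - apply Rabs_plus_le; [apply IH; intros; apply H; lia|apply H; lia].
Qed.

Lemma sum_below_nonneg n f : (forall i, (i < n)%nat -> 0 <= f i) -> 0 <= sum_below n f.
Proof.
  induction n as [|n IH]; intros H; simpl; [lra|].
  apply Rplus_le_le_0_compat; [apply IH; intros; apply H; lia|apply H; lia].
Qed.

Lemma dot_shift d w h i v : (i < d)%nat ->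
  dot d (fun j => w j + h * delta i j) v = dot d w v + h * v i.
Proof.
  unfold dot. induction d as [|d IH]; intros Hi; [lia|]. simpl.
  destruct (Nat.eq_dec i d) as [->|Hne].
  - replace (delta d d) with 1 by (unfold delta; now rewrite Nat.eqb_refl).
    replace (sum_below d (fun j => (w j + h * delta d j) * v j))
      with (sum_below d (fun j => w j * v j)).
    + ring.
    + apply sum_below_ext. intros j Hj. unfold delta.
      destruct (Nat.eqb_spec d j); [lia|ring].
  - rewrite IH by lia. unfold delta at 1. destruct (Nat.eqb_spec i d); [congruence|ring].
Qed.

(** Differentiating [act (w . v + b)] with respect to the weights brings down
    coordinates of [v]: difference quotients in [w] of functions that networks
    approximate are again approximated, so by induction all the products
    [v^al act^(|al|) (w . v + b)] are, together with their gradients. *)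
Lemma net_approx_ridge act d al : smooth act -> List.Forall (fun i => (i < d)%nat) al ->
  forall w b, net_approx act d
    (fun v => mon al v * Derive_n act (length al) (dot d w v + b))
    (fun j v => dmon al j v * Derive_n act (length al) (dot d w v + b)
      + mon al v * (w j * Derive_n act (S (length al)) (dot d w v + b))).
Proof.
  intros Hs Hal. induction Hal as [|i al Hi Hal IH]; intros w b.
  - intros r eps He. exists [(1, w, b)]. intros v _. simpl.
    split; [|intros j _].
    + replace (1 * act (dot d w v + b) + 0 - 1 * act (dot d w v + b)) with 0 by ring.
      rewrite Rabs_R0. lra.
    + match goal with |- Rabs ?a <= _ => replace a with 0 end.
      * rewrite Rabs_R0. lra.
      * change (Derive (fun x => act x)) with (Derive act). ring.
  - set (n := length al) in *. simpl length. fold n.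
    apply net_approx_limit. intros r0 eps He.
    set (r := Rmax r0 0).
    assert (Hr : 0 <= r) by apply Rmax_r.
    destruct (mon_bounded d al r Hal Hr) as [Bm [HBm Hmon]].
    set (Z := sum_below d (fun j => Rabs (w j) * r) + Rabs b).
    assert (HZ : 0 <= Z).
    { unfold Z. pose proof (Rabs_pos b).
      assert (0 <= sum_below d (fun j => Rabs (w j) * r)); [|lra].
      apply sum_below_nonneg. intros. apply Rmult_le_pos; [apply Rabs_pos|exact Hr]. }
    set (Wm := sum_below d (fun j => Rabs (w j)) + 1).
    assert (HWj : forall j, (j < d)%nat -> Rabs (w j) <= Wm).
    { unfold Wm. assert (Hg : forall d j, (j < d)%nat -> Rabs (w j) <= sum_below d (fun j => Rabs (w j))).
      { clear. induction d as [|d IHd]; intros j Hj; [lia|]. simpl.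
        destruct (Nat.eq_dec j d) as [->|Hne].
        - assert (0 <= sum_below d (fun j => Rabs (w j))); [|lra].
          apply sum_below_nonneg. intros. apply Rabs_pos.
        - specialize (IHd j ltac:(lia)). pose proof (Rabs_pos (w d)). lra. }
      intros j Hj. specialize (Hg d j Hj). lra. }
    assert (HWm : 1 <= Wm).
    { unfold Wm. assert (0 <= sum_below d (fun j => Rabs (w j))); [|lra].
      apply sum_below_nonneg. intros. apply Rabs_pos. }
    set (e := eps / (Bm * (Wm + 2))).
    assert (HBW : 0 < Bm * (Wm + 2)) by (apply Rmult_lt_0_compat; lra).
    assert (He0 : 0 < e) by now apply Rdiv_lt_0_compat.
    destruct (difference_quotient act n Z r e Hs HZ Hr He0) as [h1 [Hh1 D1]].
    destruct (difference_quotient act (S n) Z r e Hs HZ Hr He0) as [h2 [Hh2 D2]].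
    set (h := Rmin h1 h2).
    assert (Hh : 0 < h) by (apply Rmin_glb_lt; lra).
    assert (h <= h1) by apply Rmin_l. assert (h <= h2) by apply Rmin_r.
    set (w' := fun j => w j + h * delta i j).
    pose proof (net_approx_scal act d (/ h) _ _
      (net_approx_plus act d _ _ _ _ (IH w' b) (net_approx_scal act d (-1) _ _ (IH w b)))) as Hq.
    eexists. eexists. split; [exact Hq|]. cbv beta.
    intros v Hv0.
    assert (Hv : in_box d r v).
    { intros j Hj. eapply Rle_trans; [now apply Hv0|apply Rmax_l]. }
    set (z := dot d w v + b).
    assert (Hz : Rabs z <= Z).
    { apply Rabs_plus_le; [|lra]. apply sum_below_bound. intros j Hj.
      apply Rabs_mult_le; [lra|now apply Hv]. }
    assert (Ez : dot d w' v + b = z + h * v i).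
    { unfold w', z. rewrite dot_shift by assumption. ring. }
    rewrite Ez.
    destruct (Hmon v Hv) as [M1 M2].
    destruct (D1 h z (v i) ltac:(lra) Hz (Hv i Hi)) as [Q1 Q1'].
    destruct (D2 h z (v i) ltac:(lra) Hz (Hv i Hi)) as [Q2 Q2'].
    set (f0 := Derive_n act n z) in *. set (f0h := Derive_n act n (z + h * v i)) in *.
    set (f1 := Derive_n act (S n) z) in *. set (f1h := Derive_n act (S n) (z + h * v i)) in *.
    set (f2 := Derive_n act (S (S n)) z) in *.
    assert (Htot : Bm * (e * (Wm + 2)) = eps) by (unfold e; field; lra).
    split.
    + simpl mon.
      replace (/ h * (mon al v * f0h + -1 * (mon al v * f0)) - v i * mon al v * f1)
        with (mon al v * ((f0h - f0) / h - v i * f1)) by (field; lra).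
      rewrite <- Htot. apply Rabs_mult_le; [exact M1|]. nra.
    + intros j Hj. simpl mon. simpl dmon.
      replace (/ h * (dmon al j v * f0h + mon al v * (w' j * f1h)
          + -1 * (dmon al j v * f0 + mon al v * (w j * f1)))
          - ((delta i j * mon al v + v i * dmon al j v) * f1 + v i * mon al v * (w j * f2)))
        with (dmon al j v * ((f0h - f0) / h - v i * f1)
          + mon al v * (w j * ((f1h - f1) / h - v i * f2) + delta i j * (f1h - f1)))
        by (unfold w'; field; lra).
      apply Rle_trans with (Bm * e + Bm * (Wm * e + 1 * e)); [|lra].
      apply Rabs_plus_le; apply Rabs_mult_le; auto.
      apply Rabs_plus_le; apply Rabs_mult_le; auto.
      unfold delta. destruct (Nat.eqb i j); rewrite ?Rabs_R1, ?Rabs_R0; lra.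
Qed.

(** By induction: the derivative is a polynomial, hence so is its primitive. *)
Lemma Derive_n_zero_polynomial n : forall f, smooth f ->
  (forall x, Derive_n f n x = 0) -> polynomial_function f.
Proof.
  induction n as [|n IH]; intros f Hs H.
  - exists 0%nat, (fun _ => 0). intros x. exact (H x).
  - assert (E : forall m x, Derive_n (Derive f) m x = Derive_n f (S m) x).
    { intros m x. rewrite <- (Nat.add_1_r m). symmetry. now rewrite <- (Derive_n_comp f m 1). }
    destruct (IH (Derive f)) as [m [c Hc]].
    + intros m x. destruct m as [|m]; [exact I|].
      change (ex_derive (Derive_n (Derive f) m) x).
      apply (ex_derive_ext (Derive_n f (S m))); [intros; symmetry; apply E|].
      exact (Hs (S (S m)) x).
    + intros x. rewrite E. apply H.
    + set (c' := fun i => match i with O => f 0 | S i => c i / INR (S i) end).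
      set (g := fun x => sum_below (S m) (fun i => c' i * x ^ i)).
      exists (S m), c'. intros x. fold (g x).
      assert (Hg : forall x, is_derive g x (Derive f x)).
      { intros y. rewrite Hc. unfold g.
        apply (is_derive_ext (fun x => f 0 + sum_below m (fun i => c i / INR (S i) * x ^ S i))).
        { intros t. rewrite sum_below_S. simpl. ring. }
        replace (sum_below m (fun i => c i * y ^ i))
          with (plus 0 (sum_below m (fun i => c i * y ^ i))) by apply Rplus_0_l.
        apply (is_derive_plus (K := R_AbsRing) (V := R_NormedModule));
          [apply (is_derive_const (K := R_AbsRing) (V := R_NormedModule))|].
        clear. induction m as [|m IHm]; simpl sum_below.
        - apply (is_derive_const (K := R_AbsRing) (V := R_NormedModule)).
        - apply (is_derive_plus (K := R_AbsRing) (V := R_NormedModule)); [exact IHm|].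
          auto_derive; [exact I|].
          destruct m as [|m]; [simpl; field|].
          simpl Nat.pred. change (y ^ S m) with (y * y ^ m).
          pose proof (pos_INR (S m)). field. lra. }
      assert (Hd : forall y, is_derive (fun x => f x - g x) y 0).
      { intros y. replace 0 with (minus (Derive f y) (Derive f y)) by apply Rminus_diag.
        apply (is_derive_minus (K := R_AbsRing) (V := R_NormedModule)); [|apply Hg].
        apply Derive_correct. exact (Hs 1%nat y). }
      destruct (MVT_gen (fun x => f x - g x) 0 x (fun _ => 0)) as [z [_ Hz]].
      * intros; apply Hd.
      * intros y _. apply continuity_pt_filterlim.
        apply (continuous_of_derive (fun x => f x - g x)).
        exists 0. apply Hd.
      * assert (Eg : g 0 = f 0).
        { unfold g. rewrite sum_below_S.
          transitivity (c' 0%nat * 0 ^ 0 + 0); [f_equal|simpl; ring].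
          apply sum_below_zero. intros i _. simpl. ring. }
        lra.
Qed.

Lemma Derive_n_nonzero act n : admissible_activation act -> exists b, Derive_n act n b <> 0.
Proof.
  intros [Hs Hp]. apply NNPP. intros Hn. apply Hp.
  apply (Derive_n_zero_polynomial n act Hs). intros x. apply NNPP. intros Hx.
  apply Hn. now exists x.
Qed.

Lemma net_approx_mon act d al : admissible_activation act ->
  List.Forall (fun i => (i < d)%nat) al -> net_approx act d (mon al) (dmon al).
Proof.
  intros Hact Hal.
  destruct (Derive_n_nonzero act (length al) Hact) as [b Hb].
  assert (Hdot : forall v, dot d (fun _ => 0) v + b = b).
  { intros v. unfold dot. replace (sum_below d (fun j => 0 * v j)) with 0; [ring|].
    clear. induction d as [|d IH]; [reflexivity|]. simpl. rewrite <- IH. ring. }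
  apply (net_approx_ext act d _ _ _ _) with
    (3 := net_approx_scal act d (/ Derive_n act (length al) b) _ _
      (net_approx_ridge act d al (proj1 Hact) Hal (fun _ => 0) b)).
  - intros v. cbv beta. rewrite Hdot. field. exact Hb.
  - intros j v _. cbv beta. rewrite Hdot. field. exact Hb.
Qed.

(** The gradient is carried along, so that no polynomial ever has to be
    differentiated. *)
Definition poly_eval (l : list (R * list nat)) (v : nat -> R) : R :=
  fold_right (fun a s => fst a * mon (snd a) v + s) 0 l.

Definition poly_grad (l : list (R * list nat)) (j : nat) (v : nat -> R) : R :=
  fold_right (fun a s => fst a * dmon (snd a) j v + s) 0 l.

Definition is_poly (d : nat) (p : (nat -> R) -> R) (dp : nat -> (nat -> R) -> R) : Prop :=
  exists l, List.Forall (fun a => List.Forall (fun i => (i < d)%nat) (snd a)) l /\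
    forall v, p v = poly_eval l v /\ forall j, dp j v = poly_grad l j v.

Lemma net_approx_poly act d p dp :
  admissible_activation act -> is_poly d p dp -> net_approx act d p dp.
Proof.
  intros Hact [l [Hl E]].
  apply (net_approx_ext act d (poly_eval l) (poly_grad l)).
  { intros v. symmetry. apply E. } { intros j v _. symmetry. apply E. }
  clear E. induction Hl as [|[c al] l Hal Hl IH].
  - intros r eps He. exists []. intros v _. simpl.
    replace (0 - 0) with 0 by ring. rewrite Rabs_R0. split; [lra|]. intros; lra.
  - exact (net_approx_plus act d _ _ _ _
      (net_approx_scal act d c _ _ (net_approx_mon act d al Hact Hal)) IH).
Qed.

Lemma is_poly_ext d p dp p' dp' : (forall v, p v = p' v) -> (forall j v, dp j v = dp' j v) ->
  is_poly d p dp -> is_poly d p' dp'.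
Proof.
  intros E E' [l [Hl H]]. exists l. split; [exact Hl|]. intros v.
  rewrite <- E. split; [apply H|]. intros j. rewrite <- E'. apply H.
Qed.

Lemma is_poly_const d c : is_poly d (fun _ => c) (fun _ _ => 0).
Proof.
  exists [(c, [])]. split; [repeat constructor|]. intros v. split; [|intros j]; simpl; ring.
Qed.

Lemma is_poly_coord d i : (i < d)%nat -> is_poly d (fun v => v i) (fun j _ => delta i j).
Proof.
  intros Hi. exists [(1, [i])]. split; [repeat constructor; exact Hi|].
  intros v. split; [|intros j]; simpl; ring.
Qed.

Lemma poly_eval_app l l' v : poly_eval (l ++ l') v = poly_eval l v + poly_eval l' v.
Proof. induction l as [|a l IH]; simpl; [ring|]. rewrite IH. ring. Qed.

Lemma poly_grad_app l l' j v : poly_grad (l ++ l') j v = poly_grad l j v + poly_grad l' j v.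
Proof. induction l as [|a l IH]; simpl; [ring|]. rewrite IH. ring. Qed.

Lemma is_poly_plus d p dp p' dp' : is_poly d p dp -> is_poly d p' dp' ->
  is_poly d (fun v => p v + p' v) (fun j v => dp j v + dp' j v).
Proof.
  intros [l [Hl H]] [l' [Hl' H']]. exists (l ++ l'). split.
  - apply Forall_app. now split.
  - intros v. destruct (H v) as [A B]. destruct (H' v) as [A' B']. split.
    + rewrite poly_eval_app. congruence.
    + intros j. rewrite poly_grad_app, B, B'. reflexivity.
Qed.

Lemma mon_app al be v : mon (al ++ be) v = mon al v * mon be v.
Proof. induction al as [|i al IH]; simpl; [ring|]. rewrite IH. ring. Qed.

Lemma dmon_app al be j v :
  dmon (al ++ be) j v = dmon al j v * mon be v + mon al v * dmon be j v.
Proof. induction al as [|i al IH]; simpl; [ring|]. rewrite IH, mon_app. ring. Qed.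

Lemma is_poly_mult d p dp p' dp' : is_poly d p dp -> is_poly d p' dp' ->
  is_poly d (fun v => p v * p' v) (fun j v => dp j v * p' v + p v * dp' j v).
Proof.
  intros [l [Hl H]] [l' [Hl' H']].
  apply (is_poly_ext d (fun v => poly_eval l v * poly_eval l' v)
    (fun j v => poly_grad l j v * poly_eval l' v + poly_eval l v * poly_grad l' j v)).
  { intros v. now rewrite (proj1 (H v)), (proj1 (H' v)). }
  { intros j v. destruct (H v) as [A B]. destruct (H' v) as [A' B'].
    now rewrite A, A', B, B'. }
  clear H H'. induction Hl as [|[c al] l Hal Hl IH].
  - apply (is_poly_ext d (fun _ => 0) (fun _ _ => 0)); [| |apply is_poly_const];
      intros; simpl; ring.
  - apply (is_poly_ext d
      (fun v => c * mon al v * poly_eval l' v + poly_eval l v * poly_eval l' v)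
      (fun j v => (c * dmon al j v * poly_eval l' v + c * mon al v * poly_grad l' j v)
        + (poly_grad l j v * poly_eval l' v + poly_eval l v * poly_grad l' j v)));
      [intros; simpl; ring|intros; simpl; ring|].
    apply is_poly_plus; [|exact IH]. clear IH Hl l.
    exists (map (fun a => (c * fst a, al ++ snd a)) l'). simpl in Hal. split.
    + clear - Hal Hl'. induction Hl' as [|[c' be] l' Hbe Hl' IH]; constructor; [|exact IH].
      simpl in *. apply Forall_app. now split.
    + intros v. split; [|intros j]; clear Hl'; induction l' as [|[c' be] l' IH]; simpl; try ring.
      * rewrite <- IH, mon_app. ring.
      * rewrite <- IH, dmon_app. ring.
Qed.

(** * Bernstein averages over a simplex *)

Definition lsum {A : Type} (f : A -> R) (l : list A) : R :=
  fold_right (fun a s => f a + s) 0 l.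

Lemma lsum_ext {A} (f g : A -> R) l : (forall a, In a l -> f a = g a) -> lsum f l = lsum g l.
Proof.
  induction l as [|a l IH]; intros H; [reflexivity|]. simpl.
  rewrite H by now left. rewrite IH by (intros; apply H; now right). reflexivity.
Qed.

Lemma lsum_plus {A} (f g : A -> R) l : lsum (fun a => f a + g a) l = lsum f l + lsum g l.
Proof. induction l as [|a l IH]; simpl; [ring|]. rewrite IH. ring. Qed.

Lemma lsum_scal {A} c (f : A -> R) l : lsum (fun a => c * f a) l = c * lsum f l.
Proof. induction l as [|a l IH]; simpl; [ring|]. rewrite IH. ring. Qed.

Lemma lsum_le {A} (f g : A -> R) l : (forall a, In a l -> f a <= g a) -> lsum f l <= lsum g l.
Proof.
  induction l as [|a l IH]; intros H; simpl; [lra|].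
  apply Rplus_le_compat; [apply H; now left|]. apply IH. intros; apply H; now right.
Qed.

Lemma lsum_abs {A} (f g : A -> R) l : (forall a, In a l -> Rabs (f a) <= g a) ->
  Rabs (lsum f l) <= lsum g l.
Proof.
  induction l as [|a l IH]; intros H; simpl.
  - rewrite Rabs_R0. lra.
  - apply Rabs_plus_le; [apply H; now left|]. apply IH. intros; apply H; now right.
Qed.

Lemma lsum_swap {A B} (f : A -> B -> R) la lb :
  lsum (fun a => lsum (fun b => f a b) lb) la = lsum (fun b => lsum (fun a => f a b) la) lb.
Proof.
  induction la as [|a la IH]; simpl.
  - induction lb as [|b lb IHb]; simpl; [reflexivity|]. rewrite <- IHb. ring.
  - rewrite IH, <- lsum_plus. reflexivity.
Qed.

Lemma lsum_app {A} (f : A -> R) l l' : lsum f (l ++ l') = lsum f l + lsum f l'.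
Proof. induction l as [|a l IH]; simpl; [ring|]. rewrite IH. ring. Qed.

Lemma lsum_map {A B} (f : B -> R) (g : A -> B) l : lsum f (map g l) = lsum (fun a => f (g a)) l.
Proof. induction l as [|a l IH]; simpl; [reflexivity|]. now rewrite IH. Qed.

Lemma lsum_flat_map {A B} (f : B -> R) (g : A -> list B) l :
  lsum f (flat_map g l) = lsum (fun a => lsum f (g a)) l.
Proof. induction l as [|a l IH]; simpl; [reflexivity|]. now rewrite lsum_app, IH. Qed.

(** A vertex of a simplex with its barycentric coordinate, an affine function
    given with its constant gradient. *)
Record atom : Type := {
  wt : (nat -> R) -> R;
  dwt : nat -> R;
  vtx : nat -> R }.

Definition vadd (s v : nat -> R) : nat -> R := fun i => s i + v i.

Lemma vadd_comm s v v' : vadd (vadd s v) v' = vadd (vadd s v') v.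
Proof. apply functional_extensionality. intros i. unfold vadd. ring. Qed.

(** Expectation of [h] at [s] plus the sum of [n] independent vertices, drawn with
    the barycentric coordinates of [u] as probabilities.  As a function of [u] it
    is the Bernstein polynomial of the simplex. *)
Fixpoint expect (at_ : list atom) (n : nat) (h : (nat -> R) -> R) (s u : nat -> R) : R :=
  match n with
  | O => h s
  | S n => lsum (fun a => wt a u * expect at_ n h (vadd s (vtx a)) u) at_
  end.

Inductive reach (at_ : list atom) : nat -> (nat -> R) -> (nat -> R) -> Prop :=
  | reach_O s : reach at_ 0 s s
  | reach_S n s a s' : In a at_ -> reach at_ n (vadd s (vtx a)) s' -> reach at_ (S n) s s'.

Definition barycentric (at_ : list atom) (d : nat) (u : nat -> R) : Prop :=
  (forall a, In a at_ -> 0 <= wt a u) /\ lsum (fun a => wt a u) at_ = 1 /\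
  (forall i, (i < d)%nat -> lsum (fun a => wt a u * vtx a i) at_ = u i).

Lemma expect_le at_ d u : barycentric at_ d u -> forall n h h' s,
  (forall t, reach at_ n s t -> h t <= h' t) -> expect at_ n h s u <= expect at_ n h' s u.
Proof.
  intros [H0 _]. induction n as [|n IH]; intros h h' s H; simpl.
  - apply H. constructor.
  - apply lsum_le. intros a Ha. apply Rmult_le_compat_l; [auto|].
    apply IH. intros t Ht. apply H. econstructor; eassumption.
Qed.

Lemma expect_plus at_ n h h' s u :
  expect at_ n (fun t => h t + h' t) s u = expect at_ n h s u + expect at_ n h' s u.
Proof.
  revert s. induction n as [|n IH]; intros s; simpl; [reflexivity|].
  rewrite <- lsum_plus. apply lsum_ext. intros a _. rewrite IH. ring.
Qed.

Lemma expect_scal at_ n c h s u :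
  expect at_ n (fun t => c * h t) s u = c * expect at_ n h s u.
Proof.
  revert s. induction n as [|n IH]; intros s; simpl; [reflexivity|].
  rewrite <- lsum_scal. apply lsum_ext. intros a _. rewrite IH. ring.
Qed.

Lemma expect_const at_ d u : barycentric at_ d u -> forall n c s,
  expect at_ n (fun _ => c) s u = c.
Proof.
  intros [_ [H1 _]]. induction n as [|n IH]; intros c s; simpl; [reflexivity|].
  rewrite (lsum_ext _ (fun a => c * wt a u)) by (intros; rewrite IH; ring).
  rewrite lsum_scal, H1. ring.
Qed.

Lemma expect_shift at_ n h s v u :
  expect at_ n h (vadd s v) u = expect at_ n (fun t => h (vadd t v)) s u.
Proof.
  revert s. induction n as [|n IH]; intros s; simpl; [reflexivity|].
  apply lsum_ext. intros a _. rewrite vadd_comm, IH. reflexivity.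
Qed.

(** Variances of independent summands add up. *)
Lemma expect_square at_ d u D : barycentric at_ d u -> forall i, (i < d)%nat ->
  (forall a, In a at_ -> (vtx a i - u i) * (vtx a i - u i) <= D) ->
  forall n s c, expect at_ n (fun t => (t i - c) * (t i - c)) s u
    <= (s i + INR n * u i - c) * (s i + INR n * u i - c) + INR n * D.
Proof.
  intros [H0 [H1 H2]] i Hi HD.
  induction n as [|n IH]; intros s c.
  - simpl. apply Req_le. ring.
  - simpl expect. rewrite S_INR.
    set (A := s i + (INR n + 1) * u i - c).
    apply Rle_trans with (lsum (fun a => wt a u * (A * A + D + INR n * D)
      + (2 * A) * (wt a u * vtx a i + (- u i) * wt a u)) at_).
    + apply lsum_le. intros a Ha.
      eapply Rle_trans; [apply Rmult_le_compat_l; [auto|apply IH]|].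
      unfold vadd. specialize (H0 a Ha). specialize (HD a Ha).
      replace (s i + vtx a i + INR n * u i - c) with (A + (vtx a i - u i)) by (unfold A; ring).
      set (e := vtx a i - u i) in *.
      replace (vtx a i) with (e + u i) by (unfold e; ring).
      apply Rle_trans with (wt a u * (A * A + 2 * A * e + D + INR n * D)).
      * apply Rmult_le_compat_l; [exact H0|]. lra.
      * apply Req_le. ring.
    + apply Req_le. rewrite lsum_plus, lsum_scal, lsum_plus, lsum_scal, H1, (H2 i Hi).
      rewrite (lsum_ext _ (fun a => (A * A + D + INR n * D) * wt a u)) by (intros; ring).
      rewrite lsum_scal, H1. ring.
Qed.

Lemma expect_concentration at_ d u D : barycentric at_ d u ->
  (forall a i, In a at_ -> (i < d)%nat -> (vtx a i - u i) * (vtx a i - u i) <= D) ->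
  forall n h y e K, 0 <= K ->
  (forall t, reach at_ n (fun _ => 0) t ->
     Rabs (h t - y) <= e + K * sum_below d (fun i => (t i - INR n * u i) * (t i - INR n * u i))) ->
  Rabs (expect at_ n h (fun _ => 0) u - y) <= e + K * (INR d * (INR n * D)).
Proof.
  intros Hb HD n h y e K HK Hh.
  set (Sq := fun t : nat -> R => sum_below d (fun i => (t i - INR n * u i) * (t i - INR n * u i))) in *.
  assert (HSq : forall m, (m <= d)%nat ->
    expect at_ n (fun t => sum_below m (fun i => (t i - INR n * u i) * (t i - INR n * u i)))
      (fun _ => 0) u <= INR m * (INR n * D)).
  { induction m as [|m IH]; intros Hm.
    - simpl sum_below. rewrite (expect_const at_ d u Hb). simpl. lra.
    - simpl sum_below.
      rewrite (expect_plus at_ n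
        (fun t => sum_below m (fun i => (t i - INR n * u i) * (t i - INR n * u i)))
        (fun t => (t m - INR n * u m) * (t m - INR n * u m))).
      rewrite S_INR. specialize (IH ltac:(lia)).
      pose proof (expect_square at_ d u D Hb m ltac:(lia) (fun a Ha => HD a m Ha ltac:(lia))
        n (fun _ => 0) (INR n * u m)) as H.
      cbv beta in H. replace (0 + INR n * u m - INR n * u m) with 0 in H by ring. lra. }
  specialize (HSq d (le_n d)). fold Sq in HSq.
  assert (Hup : forall g, (forall t, reach at_ n (fun _ => 0) t -> g t <= y + e + K * Sq t) ->
    expect at_ n g (fun _ => 0) u <= y + e + K * (INR d * (INR n * D))).
  { intros g Hg. eapply Rle_trans; [apply (expect_le at_ d u Hb n g (fun t => (y + e) + K * Sq t)); exact Hg|].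
    rewrite (expect_plus at_ n (fun _ => y + e) (fun t => K * Sq t)), (expect_scal at_ n K Sq),
      (expect_const at_ d u Hb).
    assert (K * expect at_ n Sq (fun _ => 0) u <= K * (INR d * (INR n * D)))
      by (apply Rmult_le_compat_l; assumption).
    lra. }
  apply Rabs_le. split.
  - (* the lower bound is the upper bound for [2 y - h] *)
    assert (H := Hup (fun t => 2 * y + -1 * h t)).
    rewrite (expect_plus at_ n (fun _ => 2 * y) (fun t => -1 * h t)), (expect_scal at_ n (-1) h),
      (expect_const at_ d u Hb) in H.
    assert (2 * y + -1 * expect at_ n h (fun _ => 0) u <= y + e + K * (INR d * (INR n * D))); [|lra].
    apply H. intros t Ht. specialize (Hh t Ht). apply Rabs_le_between in Hh. fold (Sq t) in Hh. lra.
  - assert (H := Hup h). enough (expect at_ n h (fun _ => 0) u <= y + e + K * (INR d * (INR n * D))) by lra.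
    apply H. intros t Ht. specialize (Hh t Ht). apply Rabs_le_between in Hh. fold (Sq t) in Hh. lra.
Qed.

Lemma is_poly_lsum {A} d (p : A -> (nat -> R) -> R) (dp : A -> nat -> (nat -> R) -> R) l :
  (forall a, In a l -> is_poly d (p a) (dp a)) ->
  is_poly d (fun v => lsum (fun a => p a v) l) (fun j v => lsum (fun a => dp a j v) l).
Proof.
  induction l as [|a l IH]; intros H.
  - exact (is_poly_const d 0).
  - apply (is_poly_plus d (p a) (dp a)); [apply H; now left|]. apply IH. intros; apply H; now right.
Qed.

(** Differentiating a Bernstein polynomial takes differences of [h] along the
    edges of the simplex: these stay inside it, so no extension of [h] is
    needed. *)
Lemma expect_is_poly at_ d : (forall a, In a at_ -> is_poly d (wt a) (fun j _ => dwt a j)) ->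
  forall n h s, is_poly d (expect at_ n h s)
    (fun j u => INR n * lsum (fun a => dwt a j * expect at_ (pred n) h (vadd s (vtx a)) u) at_).
Proof.
  intros Hw. induction n as [|n IH]; intros h s.
  - apply (is_poly_ext d (fun _ => h s) (fun _ _ => 0)); [reflexivity| |apply is_poly_const].
    intros. simpl. ring.
  - pose proof (is_poly_lsum d _ _ at_ (fun a Ha =>
      is_poly_mult d _ _ _ _ (Hw a Ha) (IH h (vadd s (vtx a))))) as H.
    revert H. apply is_poly_ext; [reflexivity|].
    intros j u. simpl pred. rewrite S_INR, lsum_plus.
    assert (E : lsum (fun a => wt a u * (INR n * lsum (fun b =>
        dwt b j * expect at_ (pred n) h (vadd (vadd s (vtx a)) (vtx b)) u) at_)) at_
      = INR n * lsum (fun b => dwt b j * expect at_ n h (vadd s (vtx b)) u) at_).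
    { transitivity (INR n * lsum (fun a => lsum (fun b =>
        wt a u * (dwt b j * expect at_ (pred n) h (vadd (vadd s (vtx a)) (vtx b)) u)) at_) at_).
      - rewrite <- lsum_scal. apply lsum_ext. intros a _. rewrite lsum_scal. ring.
      - destruct n as [|n]; [simpl INR; ring|]. f_equal. rewrite lsum_swap.
        apply lsum_ext. intros b _. simpl expect. simpl pred. rewrite <- lsum_scal.
        apply lsum_ext. intros a _. rewrite vadd_comm. ring. }
    rewrite E. ring.
Qed.

(** Summing over words of [n] vertices exhibits the polynomial weights, which are
    what the branch networks have to approximate. *)
Lemma expect_words at_ d : (forall a, In a at_ -> is_poly d (wt a) (fun j _ => dwt a j)) ->
  forall n, exists l : list (((nat -> R) -> R) * (nat -> R)),
    (forall phi c, In (phi, c) l -> (exists dphi, is_poly d phi dphi) /\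
       forall u, (forall a, In a at_ -> 0 <= wt a u) -> 0 <= phi u) /\
    forall h s u, expect at_ n h s u = lsum (fun w => fst w u * h (vadd s (snd w))) l.
Proof.
  intros Hw. induction n as [|n [l [Hl HE]]].
  - exists [((fun _ => 1), (fun _ => 0))]. split.
    + intros phi c [E|[]]. injection E as <- <-. split; [|intros; lra].
      eexists. apply is_poly_const.
    + intros h s u. simpl. replace (vadd s (fun _ => 0)) with s; [ring|].
      apply functional_extensionality. intros i. unfold vadd. ring.
  - exists (flat_map (fun a => map (fun w => ((fun u => wt a u * fst w u), vadd (vtx a) (snd w))) l) at_).
    split.
    + intros phi c H. apply in_flat_map in H. destruct H as [a [Ha H]].
      apply in_map_iff in H. destruct H as [[phi' c'] [E H]]. injection E as <- <-. simpl.
      destruct (Hl _ _ H) as [[dphi Hp] Hpos]. split.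
      * eexists. apply is_poly_mult; [apply (Hw a Ha)|exact Hp].
      * intros u Hu. apply Rmult_le_pos; auto.
    + intros h s u. simpl. rewrite lsum_flat_map. apply lsum_ext. intros a _.
      rewrite HE, <- lsum_scal, lsum_map. apply lsum_ext. intros w _. simpl.
      replace (vadd (vadd s (vtx a)) (snd w)) with (vadd s (vadd (vtx a) (snd w))); [ring|].
      apply functional_extensionality. intros i. unfold vadd. ring.
Qed.

(** * Approximation by networks on the triangle *)

(** [T] is the simplex with vertices (0,0), (1,0), (1,1). *)
Definition atoms_T : list atom :=
  [ {| wt := fun u => 1 + -1 * u 0%nat; dwt := fun j => -1 * delta 0 j; vtx := fun _ => 0 |};
    {| wt := fun u => u 0%nat + -1 * u 1%nat;
       dwt := fun j => delta 0 j + -1 * delta 1 j; vtx := delta 0 |};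
    {| wt := fun u => u 1%nat; dwt := delta 1; vtx := vadd (delta 0) (delta 1) |} ].

Lemma atoms_T_poly a : In a atoms_T -> is_poly 2 (wt a) (fun j _ => dwt a j).
Proof.
  assert (Hc : forall c i, (i < 2)%nat -> is_poly 2 (fun u => c * u i) (fun j _ => c * delta i j)).
  { intros c i Hi.
    apply (is_poly_ext 2 (fun u => c * u i) (fun j u => 0 * u i + c * delta i j));
      [reflexivity|intros; ring|].
    apply (is_poly_mult 2 (fun _ => c) (fun _ _ => 0)); [apply is_poly_const|now apply is_poly_coord]. }
  intros [<-|[<-|[<-|[]]]]; simpl wt; simpl dwt.
  - apply (is_poly_ext 2 (fun u => 1 + -1 * u 0%nat) (fun j _ => 0 + -1 * delta 0 j));
      [reflexivity|intros; ring|].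
    apply (is_poly_plus 2 (fun _ => 1) (fun _ _ => 0)); [apply is_poly_const|apply Hc; lia].
  - apply (is_poly_plus 2 (fun u => u 0%nat) (fun j _ => delta 0 j)
      (fun u => -1 * u 1%nat) (fun j _ => -1 * delta 1 j));
      [apply is_poly_coord; lia|apply Hc; lia].
  - apply is_poly_coord. lia.
Qed.

Lemma lsum_atoms_T_x (f : (nat -> R) -> R) :
  lsum (fun a => dwt a 0 * f (vtx a)) atoms_T = f (delta 0) + -1 * f (fun _ => 0).
Proof. simpl. change (delta 0 0) with 1. change (delta 1 0) with 0. ring. Qed.

Lemma lsum_atoms_T_xi (f : (nat -> R) -> R) :
  lsum (fun a => dwt a 1 * f (vtx a)) atoms_T
  = f (vadd (delta 0) (delta 1)) + -1 * f (delta 0).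
Proof. simpl. change (delta 0 1) with 0. change (delta 1 1) with 1. ring. Qed.

Lemma atoms_T_barycentric x xi : T x xi -> barycentric atoms_T 2 (coords [x; xi]).
Proof.
  intros [H1 H2]. unfold coords. split; [|split].
  - intros a [<-|[<-|[<-|[]]]]; simpl; lra.
  - simpl. ring.
  - intros i Hi. destruct i as [|[|i]]; [| |lia]; simpl; unfold vadd, delta; simpl; ring.
Qed.

Lemma atoms_T_spread x xi a i : T x xi -> In a atoms_T -> (i < 2)%nat ->
  (vtx a i - coords [x; xi] i) * (vtx a i - coords [x; xi] i) <= 1.
Proof.
  intros [H1 H2] Ha Hi. unfold coords.
  destruct Ha as [<-|[<-|[<-|[]]]]; destruct i as [|[|i]]; try lia;
    simpl; unfold vadd, delta; simpl; nra.
Qed.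

Lemma reach_T n s t : reach atoms_T n s t ->
  0 <= t 1%nat - s 1%nat <= t 0%nat - s 0%nat /\ t 0%nat - s 0%nat <= INR n.
Proof.
  induction 1 as [s|n s a t Ha _ IH]; [simpl; lra|].
  rewrite S_INR.
  destruct Ha as [<-|[<-|[<-|[]]]]; simpl in IH; unfold vadd, delta in IH; simpl in IH; lra.
Qed.

(** The form of uniform continuity that an estimate of variances can use. *)
Lemma cont_T_quadratic g : cont_T g -> forall eps, 0 < eps -> exists K, 0 <= K /\
  forall x xi x' xi', T x xi -> T x' xi' ->
    Rabs (g x' xi' - g x xi) <= eps + K * ((x' - x) * (x' - x) + (xi' - xi) * (xi' - xi)).
Proof.
  intros Hg eps He.
  destruct (cont_T_uniform g Hg eps He) as [d [Hd Hu]].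
  destruct (cont_T_bounded g Hg) as [M [HM HgM]].
  assert (Hdd : 0 < d * d) by now apply Rmult_lt_0_compat.
  assert (HK : 0 < 2 * M / (d * d)) by (apply Rdiv_lt_0_compat; lra).
  exists (2 * M / (d * d)). split; [lra|].
  intros x xi x' xi' HT HT'.
  assert (Hsq : forall a, d <= Rabs a -> d * d <= a * a).
  { intros a Ha.     replace (a * a) with (Rabs a * Rabs a)
      by (unfold Rabs; destruct (Rcase_abs a); ring).
    apply Rmult_le_compat; lra. }
  assert (P1 : 0 <= (x' - x) * (x' - x)) by apply Rle_0_sqr.
  assert (P2 : 0 <= (xi' - xi) * (xi' - xi)) by apply Rle_0_sqr.
  set (q2 := (x' - x) * (x' - x) + (xi' - xi) * (xi' - xi)).
  destruct (Rlt_le_dec q2 (d * d)) as [Hlt|Hge].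
  - assert (Rabs (g x' xi' - g x xi) < eps).
    { apply Hu; auto; apply Rnot_le_lt; intros Hn; apply Hsq in Hn; unfold q2 in Hlt; lra. }
    assert (0 <= 2 * M / (d * d) * q2) by (apply Rmult_le_pos; unfold q2; lra). lra.
  - apply Rle_trans with (M + M); [apply Rabs_minus_le; auto|].
    assert (2 * M / (d * d) * (d * d) <= 2 * M / (d * d) * q2) by (apply Rmult_le_compat_l; lra).
    replace (2 * M / (d * d) * (d * d)) with (2 * M) in H by (field; lra). lra.
Qed.

(** The two lattices [m = n] and [m = n - 1] serve values and derivatives. *)
Lemma lattice_average g : cont_T g -> forall eps, 0 < eps -> exists N, forall m n,
  (N < n)%nat -> (m <= n <= S m)%nat ->
  forall G : (nat -> R) -> R,
  (forall t, reach atoms_T m (fun _ => 0) t -> exists x xi, T x xi /\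
     Rabs (x - t 0%nat / INR n) <= / INR n /\ Rabs (xi - t 1%nat / INR n) <= / INR n /\
     G t = g x xi) ->
  forall x xi, T x xi ->
    Rabs (expect atoms_T m G (fun _ => 0) (coords [x; xi]) - g x xi) <= eps.
Proof.
  intros Hg eps He.
  destruct (cont_T_quadratic g Hg (eps / 2) ltac:(lra)) as [K [HK Hq]].
  destruct (INR_unbounded (40 * K / eps)) as [N HN].
  exists N. intros m n Hn Hmn G HG x xi HT.
  assert (Hn0 : 0 < INR n) by (apply lt_0_INR; lia).
  assert (HnN : INR N <= INR n) by (apply le_INR; lia).
  assert (Hnm : INR m <= INR n <= INR m + 1).
  { rewrite <- S_INR. split; apply le_INR; lia. }
  assert (Hi0 : 0 < / INR n) by now apply Rinv_0_lt_compat.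
  assert (Hn1 : 1 <= INR n) by (change 1 with (INR 1); apply le_INR; lia).
  assert (Hi1 : / INR n <= 1) by (rewrite <- Rinv_1; apply Rinv_le_contravar; lra).
  assert (Hin : / INR n * INR n = 1) by (field; lra).
  set (i := / INR n) in *.
  eapply Rle_trans.
  - apply (expect_concentration atoms_T 2 (coords [x; xi]) 1 (atoms_T_barycentric x xi HT)
      (fun a j Ha Hj => atoms_T_spread x xi a j HT Ha Hj) m G (g x xi)
      (eps / 2 + K * (16 * (i * i))) (2 * K * (i * i))).
    { repeat apply Rmult_le_pos; lra. }
    intros t Ht. destruct (HG t Ht) as [x' [xi' [HT' [A1 [A2 ->]]]]].
    eapply Rle_trans; [apply (Hq x xi x' xi' HT HT')|].
    unfold coords. simpl sum_below. simpl nth.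
    assert (Hone : forall y z s, 0 <= y <= 1 -> Rabs (z - s / INR n) <= i ->
      (z - y) * (z - y) <= 8 * (i * i) + 2 * (i * i) * ((s - INR m * y) * (s - INR m * y))).
    { intros y z s Hy Hz. unfold Rdiv in Hz. fold i in Hz.
      set (p := z - y - i * (s - INR m * y)).
      assert (Hp : Rabs p <= 2 * i).
      { replace p with ((z - s * i) + - (y * ((INR n - INR m) * i))).
        - replace (2 * i) with (i + 1 * (1 * i)) by ring.
          apply Rabs_plus_le; [exact Hz|]. rewrite Rabs_Ropp.
          apply Rabs_mult_le; [rewrite Rabs_right; lra|].
          apply Rabs_mult_le; rewrite Rabs_right; lra.
        - unfold p. replace (z - y) with (z - y * (i * INR n)) by (rewrite Hin; ring). ring. }
      replace (z - y) with (p + i * (s - INR m * y)) by (unfold p; ring).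
      set (w := i * (s - INR m * y)).
      replace (2 * (i * i) * ((s - INR m * y) * (s - INR m * y))) with (2 * (w * w)) by (unfold w; ring).
      assert (p * p <= (2 * i) * (2 * i)).
      { replace (p * p) with (Rabs p * Rabs p) by (unfold Rabs; destruct (Rcase_abs p); ring).
        apply Rmult_le_compat; auto using Rabs_pos. }
      pose proof (Rle_0_sqr (p - w)) as Hsq. unfold Rsqr in Hsq. lra. }
    pose proof (Hone x x' (t 0%nat) ltac:(unfold T in HT; lra) A1) as B1.
    pose proof (Hone xi xi' (t 1%nat) ltac:(unfold T in HT; lra) A2) as B2.
    match goal with |- _ + K * ?q <= _ + _ + 2 * K * (i * i) * ?r =>
      assert (K * q <= K * (16 * (i * i) + 2 * (i * i) * r))
        by (apply Rmult_le_compat_l; lra) end.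
    lra.
  - assert (Hki : K * i <= eps / 40).
    { apply (Rmult_le_reg_r (INR n)); [lra|]. rewrite Rmult_assoc, Hin.
      assert (40 * K / eps * eps <= INR n * eps) by (apply Rmult_le_compat_r; lra).
      replace (40 * K / eps * eps) with (40 * K) in H by (field; lra). lra. }
    assert (Hmi : INR m * i <= 1).
    { rewrite <- Hin, Rmult_comm. apply Rmult_le_compat_l; lra. }
    assert (0 <= K * i) by (apply Rmult_le_pos; lra).
    assert (K * (i * i) <= K * i) by (rewrite <- Rmult_assoc; nra).
    assert (K * (i * i) * INR m <= K * i).
    { replace (K * (i * i) * INR m) with (K * i * (INR m * i)) by ring. nra. }
    simpl (INR 2). lra.
Qed.

Lemma mvt_segment a b f df : a < b -> cont_seg a b f ->
  (forall t, a < t < b -> is_derive f t (df t)) ->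
  exists c, a <= c <= b /\ f b - f a = df c * (b - a).
Proof.
  intros Hab Hf Hd.
  destruct (MVT_gen (fun t => f (clamp a b t)) a b df) as [c [Hc E]].
  - rewrite Rmin_left, Rmax_right by lra. intros t Ht.
    apply (is_derive_ext_loc f); [|now apply Hd].
    exists (mkposreal (Rmin (t - a) (b - t)) ltac:(apply Rmin_glb_lt; lra)).
    intros s Hs. change (Rabs (s - t) < Rmin (t - a) (b - t)) in Hs.
    pose proof (Rmin_l (t - a) (b - t)). pose proof (Rmin_r (t - a) (b - t)).
    apply Rabs_def2 in Hs. rewrite clamp_id; [reflexivity|lra].
  - intros t _. apply continuity_pt_filterlim. apply cont_seg_clamp; [lra|exact Hf].
  - rewrite Rmin_left, Rmax_right in Hc by lra.
    exists c. split; [exact Hc|]. rewrite !clamp_id in E by lra. exact E.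
Qed.

Lemma is_derive_eps (f : R -> R) x l :
  (forall eps, 0 < eps -> exists del, 0 < del /\ forall y, Rabs (y - x) < del ->
     Rabs (f y - f x - (y - x) * l) <= eps * Rabs (y - x)) -> is_derive f x l.
Proof.
  intros H. split; [apply (is_linear_scal_l (K := R_AbsRing) (V := R_NormedModule))|].
  intros z Hz. apply (is_filter_lim_locally_unique (K := R_AbsRing) (V := R_NormedModule)) in Hz.
  subst z. intros eps. destruct (H eps (cond_pos eps)) as [d [Hd H']].
  exists (mkposreal d Hd). intros y Hy. exact (H' y Hy).
Qed.

Lemma C1_T_mvt_x (u : C1_T) x y xi : T x xi -> T y xi -> x < y ->
  exists c, x <= c <= y /\ u y xi - u x xi = d_x u c xi * (y - x).
Proof.
  intros Hx Hy Hlt. apply (mvt_segment x y (fun t => u t xi) (fun t => d_x u t xi)); [exact Hlt| |].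
  - apply (cont_seg_sub xi 1); [unfold T in *; lra|unfold T in *; lra|].
    apply cont_T_column; [unfold T, I01 in *; lra|apply C1_T_cont].
  - intros t Ht. apply is_derive_eps. intros eps He.
    destruct (C1_T_diff u t xi ltac:(unfold T in *; lra) eps He) as [d [Hd H]].
    exists (Rmin d (Rmin (t - x) (y - t))). split; [repeat apply Rmin_glb_lt; lra|].
    intros s Hs. pose proof (Rmin_l d (Rmin (t - x) (y - t))).
    pose proof (Rmin_r d (Rmin (t - x) (y - t))).
    pose proof (Rmin_l (t - x) (y - t)). pose proof (Rmin_r (t - x) (y - t)).
    assert (T s xi). { apply Rabs_def2 in Hs. unfold T in *. lra. }
    assert (E : xi - xi = 0) by ring.
    specialize (H s xi ltac:(assumption) ltac:(lra) ltac:(rewrite E, Rabs_R0; lra)).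
    rewrite E, Rabs_R0, Rmult_0_l, !Rplus_0_r in H. exact H.
Qed.

Lemma C1_T_mvt_xi (u : C1_T) x xi eta : T x xi -> T x eta -> xi < eta ->
  exists c, xi <= c <= eta /\ u x eta - u x xi = d_xi u x c * (eta - xi).
Proof.
  intros Hx Hy Hlt. apply (mvt_segment xi eta (fun t => u x t) (fun t => d_xi u x t)); [exact Hlt| |].
  - apply (cont_seg_sub 0 x); [unfold T in *; lra|unfold T in *; lra|].
    apply cont_T_row; [unfold T, I01 in *; lra|apply C1_T_cont].
  - intros t Ht. apply is_derive_eps. intros eps He.
    destruct (C1_T_diff u x t ltac:(unfold T in *; lra) eps He) as [d [Hd H]].
    exists (Rmin d (Rmin (t - xi) (eta - t))). split; [repeat apply Rmin_glb_lt; lra|].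
    intros s Hs. pose proof (Rmin_l d (Rmin (t - xi) (eta - t))).
    pose proof (Rmin_r d (Rmin (t - xi) (eta - t))).
    pose proof (Rmin_l (t - xi) (eta - t)). pose proof (Rmin_r (t - xi) (eta - t)).
    assert (T x s). { apply Rabs_def2 in Hs. unfold T in *. lra. }
    assert (E : x - x = 0) by ring.
    specialize (H x s ltac:(assumption) ltac:(rewrite E, Rabs_R0; lra) ltac:(lra)).
    rewrite E, Rabs_R0, Rmult_0_l, !Rplus_0_l in H. exact H.
Qed.

Lemma in_box_T x xi : T x xi -> in_box 2 1 (coords [x; xi]).
Proof.
  intros [H1 H2] j Hj. unfold coords.
  destruct j as [|[|j]]; [| |lia]; simpl; rewrite Rabs_right; lra.
Qed.

Lemma lattice_point m n t : (0 < n)%nat -> (m <= n)%nat -> reach atoms_T m (fun _ => 0) t ->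
  T (t 0%nat / INR n) (t 1%nat / INR n).
Proof.
  intros Hn Hmn Ht. apply reach_T in Ht.
  assert (Hn0 : 0 < INR n) by (apply lt_0_INR; lia).
  assert (INR m <= INR n) by (apply le_INR; lia).
  assert (Hi : 0 < / INR n) by now apply Rinv_0_lt_compat.
  assert (E : INR n * / INR n = 1) by (field; lra).
  unfold T, Rdiv. set (i := / INR n) in *. nra.
Qed.

Lemma net_approx_C0_T act g eps : admissible_activation act -> cont_T g -> 0 < eps ->
  exists l, forall x xi, T x xi -> Rabs (shallow_eval act 2 l (coords [x; xi]) - g x xi) <= eps.
Proof.
  intros Hact Hg He.
  destruct (lattice_average g Hg (eps / 2) ltac:(lra)) as [N HN].
  set (n := S N). set (h := fun t : nat -> R => g (t 0%nat / INR n) (t 1%nat / INR n)).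
  destruct (net_approx_poly act 2 _ _ Hact (expect_is_poly atoms_T 2 atoms_T_poly n h (fun _ => 0))
    1 (eps / 2) ltac:(lra)) as [l Hl].
  exists l. intros x xi HT.
  destruct (Hl _ (in_box_T x xi HT)) as [A _].
  assert (B := HN n n ltac:(lia) ltac:(lia) h).
  assert (B' : Rabs (expect atoms_T n h (fun _ => 0) (coords [x; xi]) - g x xi) <= eps / 2).
  { apply B; [|exact HT]. intros t Ht. exists (t 0%nat / INR n), (t 1%nat / INR n).
    assert (0 < / INR n) by (apply Rinv_0_lt_compat, lt_0_INR; lia).
    split; [apply (lattice_point n n t); auto; lia|].
    rewrite !Rminus_diag, !Rabs_R0. repeat split; lra. }
  match type of A with Rabs (?a - ?b) <= _ =>
    replace (a - g x xi) with ((a - b) + (b - g x xi)) by ring end.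
  eapply Rle_trans; [apply Rabs_plus_le; eassumption|]. lra.
Qed.

Lemma net_approx_C1_T act (u : C1_T) eps : admissible_activation act -> 0 < eps ->
  exists l, forall x xi, T x xi ->
    Rabs (shallow_eval act 2 l (coords [x; xi]) - u x xi) <= eps /\
    Rabs (shallow_grad act 2 l 0 (coords [x; xi]) - d_x u x xi) <= eps /\
    Rabs (shallow_grad act 2 l 1 (coords [x; xi]) - d_xi u x xi) <= eps.
Proof.
  intros Hact He.
  destruct (lattice_average u (C1_T_cont u) (eps / 2) ltac:(lra)) as [N0 H0].
  destruct (lattice_average _ (d_x_cont_T u) (eps / 2) ltac:(lra)) as [N1 H1].
  destruct (lattice_average _ (d_xi_cont_T u) (eps / 2) ltac:(lra)) as [N2 H2].
  set (m := (N0 + N1 + N2)%nat). set (n := S m).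
  set (h := fun t : nat -> R => u (t 0%nat / INR n) (t 1%nat / INR n)).
  destruct (net_approx_poly act 2 _ _ Hact (expect_is_poly atoms_T 2 atoms_T_poly n h (fun _ => 0))
    1 (eps / 2) ltac:(lra)) as [l Hl].
  assert (Hn0 : 0 < INR n) by (apply lt_0_INR; lia).
  assert (Hi : 0 < / INR n) by now apply Rinv_0_lt_compat.
  exists l. intros x xi HT.
  destruct (Hl _ (in_box_T x xi HT)) as [A A'].
  assert (A0 := A' 0%nat ltac:(lia)). assert (A1 := A' 1%nat ltac:(lia)). clear A'.
  set (u0 := coords [x; xi]) in *.
  assert (Hn1 : INR n = INR m + 1) by (unfold n; apply S_INR).
  (* neighbouring lattice points along an edge are joined inside the triangle *)
  assert (Hlat : forall t, reach atoms_T m (fun _ => 0) t ->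
    T (t 0%nat / INR n) (t 1%nat / INR n) /\
    T ((t 0%nat + 1) / INR n) (t 1%nat / INR n) /\
    T ((t 0%nat + 1) / INR n) ((t 1%nat + 1) / INR n)).
  { intros t Ht. pose proof (reach_T _ _ _ Ht) as Hr.
    split; [apply (lattice_point m n t); auto; lia|].
    assert (E : INR n * / INR n = 1) by (field; lra).
    unfold T, Rdiv. set (i := / INR n) in *. nra. }
  assert (Hstep : forall a, (a + 1) / INR n - a / INR n = / INR n) by (intros; field; lra).
  assert (B0 : Rabs (expect atoms_T n h (fun _ => 0) u0 - u x xi) <= eps / 2).
  { apply (H0 n n); [lia|lia| |exact HT]. intros t Ht. exists (t 0%nat / INR n), (t 1%nat / INR n).
    split; [apply (lattice_point n n t); auto; lia|].
    rewrite !Rminus_diag, !Rabs_R0. repeat split; lra. }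
  assert (B1 : Rabs (expect atoms_T m (fun t => INR n *
      (h (vadd t (delta 0)) + -1 * h (vadd t (fun _ => 0)))) (fun _ => 0) u0 - d_x u x xi) <= eps / 2).
  { apply (H1 m n); [lia|lia| |exact HT]. intros t Ht. destruct (Hlat t Ht) as [L1 [L2 L3]].
    assert (Hlt : t 0%nat / INR n < (t 0%nat + 1) / INR n) by (specialize (Hstep (t 0%nat)); lra).
    destruct (C1_T_mvt_x u _ _ _ L1 L2 Hlt) as [c [Hc E]].
    exists c, (t 1%nat / INR n). rewrite Hstep in E. specialize (Hstep (t 0%nat)).
    split; [unfold T in *; lra|]. split; [rewrite Rabs_right; lra|].
    split; [rewrite Rminus_diag, Rabs_R0; lra|].
    unfold h, vadd, delta. cbn [Nat.eqb]. rewrite !Rplus_0_r.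
    replace (u ((t 0%nat + 1) / INR n) (t 1%nat / INR n) + -1 * u (t 0%nat / INR n) (t 1%nat / INR n))
      with (d_x u c (t 1%nat / INR n) * / INR n) by lra.
    field. lra. }
  assert (B2 : Rabs (expect atoms_T m (fun t => INR n *
      (h (vadd t (vadd (delta 0) (delta 1))) + -1 * h (vadd t (delta 0)))) (fun _ => 0) u0
      - d_xi u x xi) <= eps / 2).
  { apply (H2 m n); [lia|lia| |exact HT]. intros t Ht. destruct (Hlat t Ht) as [L1 [L2 L3]].
    assert (Hlt : t 1%nat / INR n < (t 1%nat + 1) / INR n) by (specialize (Hstep (t 1%nat)); lra).
    destruct (C1_T_mvt_xi u _ _ _ L2 L3 Hlt) as [c [Hc E]].
    exists ((t 0%nat + 1) / INR n), c. rewrite Hstep in E.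
    pose proof (Hstep (t 0%nat)). pose proof (Hstep (t 1%nat)).
    split; [unfold T in *; lra|]. split; [rewrite Rabs_right; lra|].
    split; [rewrite Rabs_right; lra|].
    unfold h, vadd, delta. cbn [Nat.eqb]. rewrite !Rplus_0_r, !Rplus_0_l.
    replace (u ((t 0%nat + 1) / INR n) ((t 1%nat + 1) / INR n)
        + -1 * u ((t 0%nat + 1) / INR n) (t 1%nat / INR n))
      with (d_xi u ((t 0%nat + 1) / INR n) c * / INR n) by lra.
    field. lra. }
  rewrite expect_scal, expect_plus, expect_scal, <- !expect_shift in B1, B2.
  split; [|split].
  - match type of A with Rabs (?a - ?b) <= _ =>
      replace (a - u x xi) with ((a - b) + (b - u x xi)) by ring end.
    eapply Rle_trans; [apply Rabs_plus_le; eassumption|]. lra.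
  - replace (shallow_grad act 2 l 0 u0 - d_x u x xi) with
      ((shallow_grad act 2 l 0 u0 - INR n * (expect atoms_T m h (vadd (fun _ => 0) (delta 0)) u0
        + -1 * expect atoms_T m h (vadd (fun _ => 0) (fun _ => 0)) u0))
       + (INR n * (expect atoms_T m h (vadd (fun _ => 0) (delta 0)) u0
        + -1 * expect atoms_T m h (vadd (fun _ => 0) (fun _ => 0)) u0) - d_x u x xi)) by ring.
    replace eps with (eps / 2 + eps / 2) by lra. apply Rabs_plus_le; [|exact B1].
    match type of A0 with Rabs (_ - INR n * ?a) <= _ =>
      match goal with |- Rabs (_ - INR n * ?b) <= _ => replace b with a; [exact A0|] end end.
    exact (lsum_atoms_T_x (fun v => expect atoms_T m h (vadd (fun _ => 0) v) u0)).
  - replace (shallow_grad act 2 l 1 u0 - d_xi u x xi) with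
      ((shallow_grad act 2 l 1 u0 - INR n * (expect atoms_T m h (vadd (fun _ => 0) (vadd (delta 0) (delta 1))) u0
        + -1 * expect atoms_T m h (vadd (fun _ => 0) (delta 0)) u0))
       + (INR n * (expect atoms_T m h (vadd (fun _ => 0) (vadd (delta 0) (delta 1))) u0
        + -1 * expect atoms_T m h (vadd (fun _ => 0) (delta 0)) u0) - d_xi u x xi)) by ring.
    replace eps with (eps / 2 + eps / 2) by lra. apply Rabs_plus_le; [|exact B2].
    match type of A1 with Rabs (_ - INR n * ?a) <= _ =>
      match goal with |- Rabs (_ - INR n * ?b) <= _ => replace b with a; [exact A1|] end end.
    exact (lsum_atoms_T_xi (fun v => expect atoms_T m h (vadd (fun _ => 0) v) u0)).
Qed.

(** * Branch networks: a polynomial partition of unity on the cube *)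

Lemma lsum_seq (f : nat -> R) n : lsum f (seq 0 n) = sum_below n f.
Proof.
  induction n as [|n IH]; [reflexivity|].
  rewrite seq_S, lsum_app, IH. simpl. ring.
Qed.

(** The cube [[-B, B]^s] lies in the simplex with corner [(-B, .., -B)] and legs of
    length [2 B s]. *)
Definition atoms_cube (s : nat) (B : R) : list atom :=
  {| wt := fun u => 1 + -1 * sum_below s (fun i => / (2 * B * INR s) * (u i + B));
     dwt := fun j => -1 * sum_below s (fun i => / (2 * B * INR s) * delta i j);
     vtx := fun _ => - B |}
  :: map (fun i => {| wt := fun u => / (2 * B * INR s) * (u i + B);
                      dwt := fun j => / (2 * B * INR s) * delta i j;
                      vtx := fun k => - B + 2 * B * INR s * delta i k |}) (seq 0 s).

Lemma is_poly_scal d c p dp : is_poly d p dp ->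
  is_poly d (fun v => c * p v) (fun j v => c * dp j v).
Proof.
  intros H. apply (is_poly_ext d (fun v => c * p v) (fun j v => 0 * p v + c * dp j v));
    [reflexivity|intros; ring|].
  apply (is_poly_mult d (fun _ => c) (fun _ _ => 0)); [apply is_poly_const|exact H].
Qed.

Lemma atoms_cube_poly s B a : In a (atoms_cube s B) -> is_poly s (wt a) (fun j _ => dwt a j).
Proof.
  assert (Hc : forall i, (i < s)%nat -> is_poly s
    (fun u => / (2 * B * INR s) * (u i + B)) (fun j _ => / (2 * B * INR s) * delta i j)).
  { intros i Hi. apply (is_poly_scal s _ (fun u => u i + B) (fun j _ => delta i j)).
    apply (is_poly_ext s (fun u => u i + B) (fun j _ => delta i j + 0));
      [reflexivity|intros; ring|].
    apply (is_poly_plus s (fun u => u i) (fun j _ => delta i j) (fun _ => B) (fun _ _ => 0));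
      [now apply is_poly_coord|apply is_poly_const]. }
  intros [<-|H].
  - simpl wt. simpl dwt.
    apply (is_poly_ext s
      (fun u => 1 + -1 * lsum (fun i => / (2 * B * INR s) * (u i + B)) (seq 0 s))
      (fun j _ => 0 + -1 * lsum (fun i => / (2 * B * INR s) * delta i j) (seq 0 s))).
    { intros v. now rewrite lsum_seq. } { intros j v. rewrite lsum_seq. ring. }
    apply (is_poly_plus s (fun _ => 1) (fun _ _ => 0)); [apply is_poly_const|].
    apply (is_poly_scal s (-1)
      (fun u => lsum (fun i => / (2 * B * INR s) * (u i + B)) (seq 0 s))
      (fun j _ => lsum (fun i => / (2 * B * INR s) * delta i j) (seq 0 s))).
    apply (is_poly_lsum s (fun i u => / (2 * B * INR s) * (u i + B))
      (fun i j _ => / (2 * B * INR s) * delta i j)).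
    intros i Hi. apply in_seq in Hi. apply Hc. lia.
  - apply in_map_iff in H. destruct H as [i [<- Hi]]. apply in_seq in Hi. apply Hc. lia.
Qed.

Lemma sum_below_delta s i f : (i < s)%nat -> sum_below s (fun j => f j * delta j i) = f i.
Proof.
  induction s as [|s IH]; intros Hi; [lia|]. simpl. unfold delta at 2.
  destruct (Nat.eqb_spec s i) as [->|Hne].
  - rewrite sum_below_zero; [ring|]. intros j Hj. unfold delta.
    destruct (Nat.eqb_spec j i); [lia|ring].
  - rewrite IH by lia. ring.
Qed.

Lemma sum_below_scal n c f : sum_below n (fun i => c * f i) = c * sum_below n f.
Proof. induction n as [|n IH]; simpl; [ring|]. rewrite IH. ring. Qed.

Lemma sum_below_plus n f g : sum_below n (fun i => f i + g i) = sum_below n f + sum_below n g.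
Proof. induction n as [|n IH]; simpl; [ring|]. rewrite IH. ring. Qed.

Lemma sum_below_le n f g : (forall i, (i < n)%nat -> f i <= g i) -> sum_below n f <= sum_below n g.
Proof.
  induction n as [|n IH]; intros H; simpl; [lra|].
  apply Rplus_le_compat; [apply IH; intros; apply H; lia|apply H; lia].
Qed.

Lemma sum_below_const n c : sum_below n (fun _ => c) = INR n * c.
Proof. induction n as [|n IH]; [simpl; ring|]. simpl sum_below. rewrite IH, S_INR. ring. Qed.

Lemma atoms_cube_barycentric s B u : (0 < s)%nat -> 0 < B -> in_box s B u ->
  barycentric (atoms_cube s B) s u.
Proof.
  intros Hs HB Hu.
  assert (Hs0 : 0 < INR s) by now apply lt_0_INR.
  assert (HBs : 0 < 2 * B * INR s) by (apply Rmult_lt_0_compat; lra).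
  assert (Hi : 0 < / (2 * B * INR s)) by now apply Rinv_0_lt_compat.
  assert (Hub : forall i, (i < s)%nat -> 0 <= u i + B <= 2 * B).
  { intros i Hlt. specialize (Hu i Hlt). apply Rabs_le_between in Hu. lra. }
  split; [|split].
  - intros a [<-|H].
    + simpl wt.
      assert (sum_below s (fun i => / (2 * B * INR s) * (u i + B)) <= 1); [|lra].
      apply Rle_trans with (sum_below s (fun _ => / (2 * B * INR s) * (2 * B))).
      * apply sum_below_le. intros i Hlt. apply Rmult_le_compat_l; [lra|]. now apply Hub.
      * rewrite sum_below_const. right. field. lra.
    + apply in_map_iff in H. destruct H as [i [<- Hin]]. apply in_seq in Hin. simpl.
      apply Rmult_le_pos; [lra|]. apply Hub. lia.
  - unfold atoms_cube. simpl. rewrite lsum_map. simpl.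
    rewrite lsum_seq. ring.
  - intros k Hk. unfold atoms_cube. simpl. rewrite lsum_map. simpl. rewrite lsum_seq.
    rewrite (sum_below_ext s
      (fun i => / (2 * B * INR s) * (u i + B) * (- B + 2 * B * INR s * delta i k)) (fun i => - B * (/ (2 * B * INR s) * (u i + B))
      + (u i + B) * delta i k)).
    2:{ intros i _. field. lra. }
    rewrite sum_below_plus, !sum_below_scal, (sum_below_delta s k (fun i => u i + B) Hk). ring.
Qed.

Definition near (s : nat) (del : R) (c u : nat -> R) : Prop :=
  forall j, (j < s)%nat -> Rabs (c j - u j) <= del.

Definition far_weight (s : nat) (del : R) (u c : nat -> R) (w : R) : R :=
  if excluded_middle_informative (near s del c u) then 0 else w.

Lemma cube_partition s B del eta : (0 < s)%nat -> 0 < B -> 0 < del -> 0 < eta ->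
  exists l : list (((nat -> R) -> R) * (nat -> R)),
    (forall w, In w l -> exists dphi, is_poly s (fst w) dphi) /\
    forall u, in_box s B u ->
      (forall w, In w l -> 0 <= fst w u) /\ lsum (fun w => fst w u) l = 1 /\
      lsum (fun w => far_weight s del u (snd w) (fst w u)) l <= eta.
Proof.
  intros Hs HB Hd He.
  assert (Hs0 : 0 < INR s) by now apply lt_0_INR.
  assert (HBs : 0 < 2 * B * INR s) by (apply Rmult_lt_0_compat; lra).
  set (r := 2 * B * INR s + 2 * B).
  set (D := r * r).
  assert (HD : 0 < D) by (unfold D, r; apply Rmult_lt_0_compat; lra).
  assert (Hdd : 0 < del * del) by now apply Rmult_lt_0_compat.
  destruct (INR_unbounded (INR s * D / (del * del * eta))) as [n Hn].
  assert (Hq : 0 < INR s * D / (del * del * eta)).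
  { apply Rdiv_lt_0_compat; apply Rmult_lt_0_compat; lra. }
  assert (Hn0 : 0 < INR n) by lra.
  destruct (expect_words (atoms_cube s B) s (atoms_cube_poly s B) n) as [l [Hl HE]].
  exists (map (fun w => (fst w, fun j => snd w j / INR n)) l). split.
  - intros w H. apply in_map_iff in H. destruct H as [[phi c] [<- H]]. apply (Hl _ _ H).
  - intros u Hu. pose proof (atoms_cube_barycentric s B u Hs HB Hu) as Hb.
    split; [|split].
    + intros w H. apply in_map_iff in H. destruct H as [[phi c] [<- H]]. simpl.
      apply (Hl _ _ H). apply Hb.
    + rewrite lsum_map. simpl.
      rewrite <- (expect_const _ s u Hb n 1 (fun _ => 0)), HE.
      apply lsum_ext. intros. ring.
    + rewrite lsum_map. simpl.
      set (h := fun t : nat -> R => far_weight s del u (fun j => t j / INR n) 1).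
      assert (EQ : lsum (fun w => far_weight s del u (fun j => snd w j / INR n) (fst w u)) l
        = expect (atoms_cube s B) n h (fun _ => 0) u).
      { rewrite HE. apply lsum_ext. intros [phi c] _. simpl. unfold h, vadd.
        replace (fun j => (0 + c j) / INR n) with (fun j => c j / INR n)
          by (apply functional_extensionality; intros j; now rewrite Rplus_0_l).
        unfold far_weight. destruct (excluded_middle_informative _); ring. }
      rewrite EQ.
      set (K := / (INR n * INR n * (del * del))).
      assert (HK : 0 < K).
      { apply Rinv_0_lt_compat. apply Rmult_lt_0_compat; [|lra]. now apply Rmult_lt_0_compat. }
      (* Chebyshev: a lattice point that is not near has one coordinate off by [del] *)
      assert (Hc : Rabs (expect (atoms_cube s B) n h (fun _ => 0) u - 0)
        <= 0 + K * (INR s * (INR n * D))).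
      { apply (expect_concentration _ s u D Hb); [|lra|].
        - intros a i Ha Hi. pose proof (Hu i Hi) as Hui. apply Rabs_le_between in Hui.
          assert (Hv : Rabs (vtx a i - u i) <= r).
          { assert (HsB : 0 <= 2 * B * INR s) by lra.
            destruct Ha as [<-|Ha].
            - simpl. apply Rabs_le. unfold r. lra.
            - apply in_map_iff in Ha. destruct Ha as [k [<- _]]. simpl.
              unfold delta. destruct (Nat.eqb k i); apply Rabs_le; unfold r; lra. }
          unfold D. replace ((vtx a i - u i) * (vtx a i - u i))
            with (Rabs (vtx a i - u i) * Rabs (vtx a i - u i))
            by (unfold Rabs; destruct (Rcase_abs (vtx a i - u i)); ring).
          apply Rmult_le_compat; auto using Rabs_pos.
        - intros t _. rewrite Rminus_0_r, Rplus_0_l. unfold h, far_weight.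
          set (q := fun i => (t i - INR n * u i) * (t i - INR n * u i)).
          assert (Hq0 : forall i, 0 <= q i) by (intros i; apply Rle_0_sqr).
          destruct (excluded_middle_informative _) as [Hnear|Hfar].
          + rewrite Rabs_R0. apply Rmult_le_pos; [lra|]. apply sum_below_nonneg. auto.
          + rewrite Rabs_R1.
            assert (Hex : exists i, (i < s)%nat /\ del < Rabs (t i / INR n - u i)).
            { apply NNPP. intros Hno. apply Hfar. intros i Hi. apply Rnot_lt_le. intros Hlt.
              apply Hno. now exists i. }
            destruct Hex as [i [Hi Hlt]].
            assert (Hsum : q i <= sum_below s q).
            { clear - Hi Hq0. induction s as [|s IH]; [lia|]. simpl.
              destruct (Nat.eq_dec i s) as [->|Hne].
              - assert (0 <= sum_below s q) by (apply sum_below_nonneg; auto). lra.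
              - specialize (IH ltac:(lia)). specialize (Hq0 s). lra. }
            assert (Hqi : INR n * INR n * (del * del) <= q i).
            { unfold q. replace ((t i - INR n * u i) * (t i - INR n * u i))
                with (INR n * INR n * (Rabs (t i / INR n - u i) * Rabs (t i / INR n - u i))).
              - apply Rmult_le_compat_l; [apply Rmult_le_pos; lra|].
                apply Rmult_le_compat; lra.
              - replace (Rabs (t i / INR n - u i) * Rabs (t i / INR n - u i))
                  with ((t i / INR n - u i) * (t i / INR n - u i))
                  by (unfold Rabs; destruct (Rcase_abs _); ring).
                field. lra. }
            apply Rle_trans with (K * (INR n * INR n * (del * del))).
            * right. unfold K. field. lra.
            * apply Rmult_le_compat_l; lra. }
      rewrite Rminus_0_r, Rplus_0_l in Hc. apply Rabs_le_between in Hc.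
      apply Rle_trans with (K * (INR s * (INR n * D))); [lra|].
      apply (Rmult_le_reg_r (del * del * INR n)); [apply Rmult_lt_0_compat; lra|].
      replace (K * (INR s * (INR n * D)) * (del * del * INR n)) with (INR s * D)
        by (unfold K; field; lra).
      assert (INR s * D / (del * del * eta) * (del * del * eta) <= INR n * (del * del * eta)).
      { apply Rmult_le_compat_r; [|lra]. apply Rmult_le_pos; lra. }
      replace (INR s * D / (del * del * eta) * (del * del * eta)) with (INR s * D) in H
        by (field; lra).
      lra.
Qed.

(** * Assembling branch and trunk *)

(** Values and derivatives are treated alike, as channels, so that the values
    alone can be asked for where the target is only continuous. *)
Definition channel_eval (act : R -> R) (l : shallow) (ch : nat) (v : nat -> R) : R :=
  match ch with O => shallow_eval act 2 l v | S j => shallow_grad act 2 l j v end.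

(** For fixed samples [u] the assembled output is again a shallow network in the
    point, hence an element of C1(T). *)
Definition assembled (act : R -> R) {I : Type} (s : nat) (l : list (shallow * (I -> shallow)))
    (i : I) (u : nat -> R) : shallow :=
  flat_map (fun a => shallow_scal (shallow_eval act s (fst a) u) (snd a i)) l.

Lemma channel_eval_assembled act I s l (i : I) u ch v :
  channel_eval act (assembled act s l i u) ch v
  = lsum (fun a => shallow_eval act s (fst a) u * channel_eval act (snd a i) ch v) l.
Proof.
  unfold assembled. destruct ch as [|j]; simpl; induction l as [|a l IH]; simpl; try reflexivity.
  - rewrite shallow_eval_app, shallow_eval_scal, IH. reflexivity.
  - rewrite shallow_grad_app, shallow_grad_scal, IH. reflexivity.
Qed.

Lemma lsum_const {A} (c : R) (l : list A) : lsum (fun _ => c) l = INR (length l) * c.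
Proof.
  induction l as [|a l IH]; [simpl; ring|].
  simpl lsum. simpl length. rewrite IH, S_INR. ring.
Qed.

(** Trunk networks approximate the targets of finitely many representative
    objects, one for each lattice point of the sample space; branch networks
    approximate the partition of unity.  Lattice points far from the samples of
    [o] carry little weight, so their representatives may be traded for [o]
    itself: the output is, up to [eta], a convex combination of targets of objects
    whose samples are close to those of [o]. *)
Lemma convex_approximation act (Ob I : Type) (s : nat) (B M : R)
    (sam : Ob -> nat -> R) (G : I -> nat -> Ob -> R -> R -> R) (chs : nat -> Prop) :
  admissible_activation act -> (0 < s)%nat -> 0 < B -> 0 < M ->
  (forall o, in_box s B (sam o)) ->
  (forall i ch o x xi, chs ch -> T x xi -> Rabs (G i ch o x xi) <= M) ->
  (forall i o eps, 0 < eps -> exists l, forall ch x xi, chs ch -> T x xi ->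
     Rabs (channel_eval act l ch (coords [x; xi]) - G i ch o x xi) <= eps) ->
  forall del eta, 0 < del -> 0 < eta ->
  exists l : list (shallow * (I -> shallow)), forall o,
    exists wl : list (R * Ob),
      (forall w, In w wl -> 0 <= fst w /\ near s del (sam (snd w)) (sam o)) /\
      lsum fst wl = 1 /\
      forall i ch x xi, chs ch -> T x xi ->
        Rabs (channel_eval act (assembled act s l i (sam o)) ch (coords [x; xi])
              - lsum (fun w => fst w * G i ch (snd w) x xi) wl) <= eta.
Proof.
  intros Hact Hs HB HM Hbox HG Happ del eta Hdel Heta.
  destruct (classic (inhabited Ob)) as [[o0]|Hemp].
  2:{ exists []. intros o. destruct (Hemp (inhabits o)). }
  set (eta1 := eta / (6 * M)).
  assert (Heta1 : 0 < eta1) by (apply Rdiv_lt_0_compat; lra).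
  destruct (cube_partition s B (del / 2) eta1 Hs HB ltac:(lra) Heta1) as [L [HL Hpart]].
  set (eps1 := eta / (3 * (INR (length L) + 1) * (M + 1))).
  pose proof (pos_INR (length L)) as HJ.
  assert (Heps1 : 0 < eps1).
  { apply Rdiv_lt_0_compat; [lra|]. apply Rmult_lt_0_compat; lra. }
  set (eps2 := Rmin 1 (eta / 3)).
  assert (Heps2 : 0 < eps2) by (apply Rmin_glb_lt; lra).
  assert (Heps2' : eps2 <= 1) by apply Rmin_l.
  assert (Heps2'' : eps2 <= eta / 3) by apply Rmin_r.
  assert (Hrep : forall c : nat -> R, exists o, forall o', near s (del / 2) c (sam o') ->
    near s (del / 2) c (sam o)).
  { intros c. destruct (classic (exists o', near s (del / 2) c (sam o'))) as [[o' H]|H].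
    - exists o'. auto.
    - exists o0. intros o' Ho'. destruct H. now exists o'. }
  destruct (functional_choice _ Hrep) as [rep Hrep'].
  assert (Hg : forall w : ((nat -> R) -> R) * (nat -> R), exists l, In w L ->
    forall u, in_box s B u -> Rabs (shallow_eval act s l u - fst w u) <= eps1).
  { intros w. destruct (classic (In w L)) as [Hin|Hnin].
    - destruct (HL w Hin) as [dphi Hphi].
      destruct (net_approx_poly act s _ _ Hact Hphi B eps1 Heps1) as [l Hl].
      exists l. intros _ u Hu. apply (Hl u Hu).
    - exists []. intros H. contradiction. }
  destruct (functional_choice _ Hg) as [g Hg'].
  assert (Hh : forall ci : (nat -> R) * I, exists l, forall ch x xi, chs ch -> T x xi ->
     Rabs (channel_eval act l ch (coords [x; xi]) - G (snd ci) ch (rep (fst ci)) x xi) <= eps2).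
  { intros [c i]. apply Happ. exact Heps2. }
  destruct (functional_choice _ Hh) as [hh Hh'].
  exists (map (fun w => (g w, fun i => hh (snd w, i))) L).
  intros o. set (u := sam o).
  destruct (Hpart u (Hbox o)) as [Hpos [Hone Hfar]].
  set (sel := fun c => if excluded_middle_informative (near s (del / 2) c u) then rep c else o).
  exists (map (fun w => (fst w u, sel (snd w))) L).
  split; [|split].
  - intros w H. apply in_map_iff in H. destruct H as [w' [<- Hin]]. simpl. split; [auto|].
    unfold sel. destruct (excluded_middle_informative _) as [Hn|Hn].
    + pose proof (Hrep' _ o Hn) as Hn'. intros j Hj. specialize (Hn j Hj). specialize (Hn' j Hj).
      fold u. replace (sam (rep (snd w')) j - u j)
        with ((snd w' j - u j) - (snd w' j - sam (rep (snd w')) j)) by ring.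
      eapply Rle_trans; [apply Rabs_minus_le; eassumption|]. lra.
    + intros j Hj. rewrite Rminus_diag, Rabs_R0. lra.
  - rewrite lsum_map. exact Hone.
  - intros i ch x xi Hch HT.
    rewrite channel_eval_assembled, !lsum_map. simpl.
    set (v := coords [x; xi]).
    assert (E : lsum (fun w => shallow_eval act s (g w) u * channel_eval act (hh (snd w, i)) ch v) L
       - lsum (fun w => fst w u * G i ch (sel (snd w)) x xi) L
       = lsum (fun w => shallow_eval act s (g w) u * channel_eval act (hh (snd w, i)) ch v
           + -1 * (fst w u * G i ch (sel (snd w)) x xi)) L).
    { rewrite lsum_plus, lsum_scal. ring. }
    rewrite E.
    apply Rle_trans with (lsum (fun w => (eps1 * (M + 1) + eps2 * fst w u)
      + (2 * M) * far_weight s (del / 2) u (snd w) (fst w u)) L).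
    + apply lsum_abs. intros w Hin.
      pose proof (Hg' w Hin u (Hbox o)) as A1.
      pose proof (Hh' (snd w, i) ch x xi Hch HT) as A2. simpl in A2. fold v in A2.
      pose proof (HG i ch (rep (snd w)) x xi Hch HT) as A3.
      pose proof (HG i ch (sel (snd w)) x xi Hch HT) as A4.
      specialize (Hpos w Hin).
      set (gv := shallow_eval act s (g w) u) in *.
      set (hv := channel_eval act (hh (snd w, i)) ch v) in *.
      replace (gv * hv + -1 * (fst w u * G i ch (sel (snd w)) x xi))
        with (((gv - fst w u) * hv + (hv - G i ch (rep (snd w)) x xi) * fst w u)
          + (G i ch (rep (snd w)) x xi - G i ch (sel (snd w)) x xi) * fst w u) by ring.
      apply Rabs_plus_le; [apply Rabs_plus_le|].
      * apply Rabs_mult_le; [exact A1|].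
        replace hv with ((hv - G i ch (rep (snd w)) x xi) + G i ch (rep (snd w)) x xi) by ring.
        eapply Rle_trans; [apply Rabs_plus_le; eassumption|]. lra.
      * apply Rabs_mult_le; [exact A2|]. rewrite Rabs_right; lra.
      * unfold far_weight, sel in *. destruct (excluded_middle_informative _).
        -- rewrite Rminus_diag, Rmult_0_l, Rabs_R0. lra.
        -- apply Rabs_mult_le; [|rewrite Rabs_right; lra].
           replace (2 * M) with (M + M) by ring. now apply Rabs_minus_le.
    + rewrite lsum_plus, lsum_plus, lsum_const, !lsum_scal, Hone.
      assert (INR (length L) * (eps1 * (M + 1)) <= eta / 3).
      { apply Rle_trans with ((INR (length L) + 1) * (eps1 * (M + 1))).
        - apply Rmult_le_compat_r; [apply Rmult_le_pos; lra|lra].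
        - right. unfold eps1. field. lra. }
      assert (2 * M * lsum (fun w => far_weight s (del / 2) u (snd w) (fst w u)) L <= 2 * M * eta1)
        by (apply Rmult_le_compat_l; lra).
      assert (2 * M * eta1 = eta / 3) by (unfold eta1; field; lra).
      lra.
Qed.

(** * Networks as elements of C1(T) and DeepONets *)

Lemma cont_T_affine (f : R -> R) (a b c k : R) :
  (forall z, continuous f z) -> cont_T (fun x xi => k * f (a * x + b * xi + c)).
Proof.
  intros Hf. apply (cont_T_mult (fun _ _ => k)); [apply cont_T_const|].
  apply (cont_T_comp f (fun x xi => a * x + b * xi + c)); [exact Hf|].
  repeat apply cont_T_plus; try apply cont_T_const; apply (cont_T_mult (fun _ _ => _));
    auto using cont_T_const, cont_T_x, cont_T_xi.
Qed.

Lemma diff_T_affine (f : R -> R) (a b c k : R) :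
  (forall z, ex_derive f z) ->
  diff_T (fun x xi => k * f (a * x + b * xi + c))
    (fun x xi => k * (a * Derive f (a * x + b * xi + c)))
    (fun x xi => k * (b * Derive f (a * x + b * xi + c))).
Proof.
  intros Hf x xi HT eps He.
  set (z := a * x + b * xi + c).
  destruct (Derive_correct f z (Hf z)) as [_ H].
  specialize (H z (fun P HP => HP)).
  set (K := (Rabs k + 1) * (Rabs a + Rabs b + 1)).
  pose proof (Rabs_pos k). pose proof (Rabs_pos a). pose proof (Rabs_pos b).
  assert (HK : 0 < K) by (apply Rmult_lt_0_compat; lra).
  assert (He' : 0 < eps / K) by now apply Rdiv_lt_0_compat.
  destruct (H (mkposreal _ He')) as [d Hd].
  assert (Hab : 0 < Rabs a + Rabs b + 1) by lra.
  exists (d / (Rabs a + Rabs b + 1)). pose proof (cond_pos d) as Hdp.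
  split; [now apply Rdiv_lt_0_compat|].
  intros x' xi' HT' A1 A2.
  set (z' := a * x' + b * xi' + c).
  assert (Hz : z' - z = a * (x' - x) + b * (xi' - xi)) by (unfold z, z'; ring).
  assert (Hzle : Rabs (z' - z) <= (Rabs a + Rabs b + 1) * (Rabs (x' - x) + Rabs (xi' - xi))).
  { rewrite Hz. eapply Rle_trans; [apply Rabs_triang|]. rewrite !Rabs_mult.
    pose proof (Rabs_pos (x' - x)). pose proof (Rabs_pos (xi' - xi)). nra. }
  assert (Hb : ball (M := R_UniformSpace) z d z').
  { change (Rabs (z' - z) < d). rewrite Hz. eapply Rle_lt_trans; [apply Rabs_triang|].
    rewrite !Rabs_mult.
    assert (Rabs a * Rabs (x' - x) <= Rabs a * (d / (Rabs a + Rabs b + 1)))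
      by (apply Rmult_le_compat_l; lra).
    assert (Rabs b * Rabs (xi' - xi) <= Rabs b * (d / (Rabs a + Rabs b + 1)))
      by (apply Rmult_le_compat_l; lra).
    assert (0 < d / (Rabs a + Rabs b + 1)) by now apply Rdiv_lt_0_compat.
    replace (pos d) with ((Rabs a + Rabs b + 1) * (d / (Rabs a + Rabs b + 1))) by (field; lra).
    lra. }
  specialize (Hd z' Hb).
  change (Rabs (f z' - f z - (z' - z) * Derive f z) <= eps / K * Rabs (z' - z)) in Hd.
  replace (k * f z' - k * f z - ((x' - x) * (k * (a * Derive f z)) + (xi' - xi) * (k * (b * Derive f z))))
    with (k * (f z' - f z - (z' - z) * Derive f z)) by (rewrite Hz; ring).
  apply Rle_trans with ((Rabs k + 1) * (eps / K * ((Rabs a + Rabs b + 1)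
    * (Rabs (x' - x) + Rabs (xi' - xi))))).
  - apply Rabs_mult_le; [lra|]. eapply Rle_trans; [exact Hd|].
    apply Rmult_le_compat_l; [lra|exact Hzle].
  - right. unfold K. field. lra.
Qed.

Lemma shallow_C1_T act l : smooth act -> exists u : C1_T, forall x xi,
  u x xi = channel_eval act l 0 (coords [x; xi]) /\
  d_x u x xi = channel_eval act l 1 (coords [x; xi]) /\
  d_xi u x xi = channel_eval act l 2 (coords [x; xi]).
Proof.
  intros Hs.
  assert (Hder : forall z, ex_derive act z) by (intros z; exact (Hs 1%nat z)).
  assert (Hcd : forall z, continuous (Derive act) z).
  { intros z. apply continuous_of_derive.
    exact (Hs 2%nat z). }
  assert (H : forall l, diff_T (fun x xi => shallow_eval act 2 l (coords [x; xi]))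
      (fun x xi => shallow_grad act 2 l 0 (coords [x; xi]))
      (fun x xi => shallow_grad act 2 l 1 (coords [x; xi])) /\
    cont_T (fun x xi => shallow_grad act 2 l 0 (coords [x; xi])) /\
    cont_T (fun x xi => shallow_grad act 2 l 1 (coords [x; xi]))).
  { clear l. intros l. induction l as [|[[k w] b] l [IH1 [IH2 IH3]]].
    - simpl. split; [|split].
      + intros x xi _ eps He. exists 1. split; [lra|]. intros.
        replace (0 - 0 - ((x' - x) * 0 + (xi' - xi) * 0)) with 0 by ring. rewrite Rabs_R0.
        apply Rmult_le_pos; [lra|]. apply Rplus_le_le_0_compat; apply Rabs_pos.
      + intros x xi _ eps He. exists 1. split; [lra|]. intros. now rewrite Rminus_diag, Rabs_R0.
      + intros x xi _ eps He. exists 1. split; [lra|]. intros. now rewrite Rminus_diag, Rabs_R0.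
    - assert (Ed : forall x xi, dot 2 w (coords [x; xi]) + b = w 0%nat * x + w 1%nat * xi + b).
      { intros x xi. unfold dot, coords. simpl. ring. }
      assert (E0 : (fun x xi => shallow_eval act 2 ((k, w, b) :: l) (coords [x; xi]))
        = (fun x xi => k * act (w 0%nat * x + w 1%nat * xi + b)
            + shallow_eval act 2 l (coords [x; xi]))).
      { apply functional_extensionality. intros x. apply functional_extensionality. intros xi.
        simpl. now rewrite Ed. }
      assert (Ej : forall j, (fun x xi => shallow_grad act 2 ((k, w, b) :: l) j (coords [x; xi]))
        = (fun x xi => k * (w j * Derive act (w 0%nat * x + w 1%nat * xi + b))
            + shallow_grad act 2 l j (coords [x; xi]))).
      { intros j. apply functional_extensionality. intros x. apply functional_extensionality.
        intros xi. simpl. now rewrite Ed. }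
      rewrite E0, !Ej.
      assert (Hcj : forall j, cont_T (fun x xi =>
        k * (w j * Derive act (w 0%nat * x + w 1%nat * xi + b)))).
      { intros j.
        replace (fun x xi => k * (w j * Derive act (w 0%nat * x + w 1%nat * xi + b)))
          with (fun x xi => (k * w j) * Derive act (w 0%nat * x + w 1%nat * xi + b)).
        - now apply (cont_T_affine (Derive act)).
        - apply functional_extensionality. intros x. apply functional_extensionality.
          intros xi. ring. }
      split; [|split].
      + apply diff_T_plus; [now apply diff_T_affine|exact IH1].
      + apply cont_T_plus; [apply Hcj|exact IH2].
      + apply cont_T_plus; [apply Hcj|exact IH3]. }
  destruct (H l) as [H1 [H2 H3]].
  exists (make_C1_T _ _ _ H1 H2 H3). intros x xi. repeat split.
Qed.

Definition deeponet_of (s : nat) {I : Type} (l : list (shallow * (I -> shallow))) (i : I)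
    : deeponet s 2 :=
  {| width := length l;
     branch := fun j => fnn_of_shallow s (fst (nth j l ([], fun _ => [])));
     trunk := fun j => fnn_of_shallow 2 (snd (nth j l ([], fun _ => [])) i) |}.

Lemma deeponet_of_eval act s I (l : list (shallow * (I -> shallow))) i u y :
  deeponet_eval act (deeponet_of s l i) u y
  = channel_eval act (assembled act s l i (coords u)) 0 (coords y).
Proof.
  rewrite channel_eval_assembled. unfold deeponet_eval. simpl width. simpl branch. simpl trunk.
  rewrite (sum_below_ext _ _ (fun j => (fun a : shallow * (I -> shallow) =>
    shallow_eval act s (fst a) (coords u) * shallow_eval act 2 (snd a i) (coords y))
    (nth j l ([], fun _ => [])))).
  - apply (sum_below_list (fun a : shallow * (I -> shallow) =>
      shallow_eval act s (fst a) (coords u) * shallow_eval act 2 (snd a i) (coords y))).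
  - intros j _. now rewrite !fnn_of_shallow_eval.
Qed.

(** * Samples determine the coefficients up to a small error *)

Lemma C0_I_eps (g : C0_I) x : I01 x -> forall eps, 0 < eps -> exists del, 0 < del /\
  forall y, I01 y -> Rabs (y - x) < del -> Rabs (g y - g x) < eps.
Proof.
  intros Hx eps He.
  pose proof (proj1 (filterlim_locally _ _) (c0i_cont g x Hx) (mkposreal eps He)) as [d Hd].
  exists d. split; [apply cond_pos|]. intros y Hy Hxy. exact (Hd y Hxy Hy).
Qed.

Lemma C1_I_eps (g : C1_I) x : I01 x -> forall eps, 0 < eps -> exists del, 0 < del /\
  forall y, I01 y -> Rabs (y - x) < del ->
    Rabs (g y - g x - (y - x) * c1i' g x) <= eps * Rabs (y - x).
Proof.
  intros Hx eps He. destruct (c1i_diff g x Hx) as [_ H].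
  assert (Hl : is_filter_lim (within I01 (locally x)) x).
  { intros P HP. apply filter_le_within. exact HP. }
  specialize (H x Hl (mkposreal eps He)).
  destruct H as [d Hd]. exists d. split; [apply cond_pos|].
  intros y Hy Hxy. exact (Hd y Hxy Hy).
Qed.

Lemma C1_I_is_derive (g : C1_I) x : 0 < x < 1 -> is_derive g x (c1i' g x).
Proof.
  intros Hx. apply is_derive_eps. intros eps He.
  destruct (C1_I_eps g x ltac:(unfold I01; lra) eps He) as [d [Hd H]].
  exists (Rmin d (Rmin x (1 - x))). split; [repeat apply Rmin_glb_lt; lra|].
  intros y Hy. pose proof (Rmin_l d (Rmin x (1 - x))). pose proof (Rmin_r d (Rmin x (1 - x))).
  pose proof (Rmin_l x (1 - x)). pose proof (Rmin_r x (1 - x)).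
  apply H; [|lra]. apply Rabs_def2 in Hy. unfold I01. lra.
Qed.

Lemma C1_I_increment (f g : C1_I) x y : I01 x -> I01 y -> x < y ->
  exists c, x <= c <= y /\
    (f y - g y) - (f x - g x) = (c1i' f c - c1i' g c) * (y - x).
Proof.
  intros Hx Hy Hlt. unfold I01 in *.
  apply (mvt_segment x y (fun t => f t - g t) (fun t => c1i' f t - c1i' g t)); [exact Hlt| |].
  - assert (Hc : forall h : C1_I, cont_seg x y h).
    { intros h s Hs eps He.
      destruct (C1_I_eps h s ltac:(unfold I01; lra) 1 Rlt_0_1) as [d [Hd H]].
      set (K := 1 + Rabs (c1i' h s)).
      assert (HK : 1 <= K) by (unfold K; pose proof (Rabs_pos (c1i' h s)); lra).
      assert (HeK : 0 < eps / K) by (apply Rdiv_lt_0_compat; lra).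
      exists (Rmin d (eps / K)). split; [now apply Rmin_glb_lt|].
      intros t Ht Hts. pose proof (Rmin_l d (eps / K)). pose proof (Rmin_r d (eps / K)).
      specialize (H t ltac:(unfold I01; lra) ltac:(lra)).
      replace (h t - h s) with ((h t - h s - (t - s) * c1i' h s) + (t - s) * c1i' h s) by ring.
      apply Rle_lt_trans with (K * Rabs (t - s)).
      - replace (K * Rabs (t - s)) with (1 * Rabs (t - s) + Rabs (t - s) * Rabs (c1i' h s))
          by (unfold K; ring).
        apply Rabs_plus_le; [exact H|]. rewrite Rabs_mult. lra.
      - replace eps with (K * (eps / K)) by (field; lra). apply Rmult_lt_compat_l; lra. }
    intros s Hs eps He.
    destruct (Hc f s Hs (eps / 2) ltac:(lra)) as [d1 [D1 H1]].
    destruct (Hc g s Hs (eps / 2) ltac:(lra)) as [d2 [D2 H2]].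
    exists (Rmin d1 d2). split; [now apply Rmin_glb_lt|]. intros t Ht Hts.
    pose proof (Rmin_l d1 d2). pose proof (Rmin_r d1 d2).
    specialize (H1 t Ht ltac:(lra)). specialize (H2 t Ht ltac:(lra)).
    apply Rabs_def2 in H1, H2. apply Rabs_def1; lra.
  - intros t Ht. apply (is_derive_minus (K := R_AbsRing) (V := R_NormedModule));
      apply C1_I_is_derive; lra.
Qed.

(** Both derivatives are compared with difference quotients of step [h], through
    the mean value theorem. *)
Lemma derivative_close (f g : C1_I) L h rho :
  lipschitz L (c1i' f) -> lipschitz L (c1i' g) -> 0 <= L -> 0 < h <= 1 / 2 ->
  (forall x, I01 x -> Rabs (f x - g x) <= rho) ->
  forall x, I01 x -> Rabs (c1i' f x - c1i' g x) <= 2 * rho / h + 2 * L * h.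
Proof.
  intros Hf Hg HL Hh Hfg x Hx.
  assert (Hc : exists c, I01 c /\ Rabs (x - c) <= h /\ Rabs (c1i' f c - c1i' g c) <= 2 * rho / h).
  { assert (Hgen : forall a, I01 a -> I01 (a + h) -> exists c, a <= c <= a + h /\
      Rabs (c1i' f c - c1i' g c) <= 2 * rho / h).
    { intros a Ha Hah. destruct (C1_I_increment f g a (a + h) Ha Hah ltac:(lra)) as [c [Hc E]].
      exists c. split; [exact Hc|].
      replace (a + h - a) with h in E by ring.
      replace (c1i' f c - c1i' g c) with ((f (a + h) - g (a + h) - (f a - g a)) / h)
        by (rewrite E; field; lra).
      unfold Rdiv. apply Rabs_mult_le.
      - replace (2 * rho) with (rho + rho) by ring. apply Rabs_minus_le; auto.
      - rewrite Rabs_right; [lra|]. left. apply Rinv_0_lt_compat. lra. }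
    unfold I01 in *. destruct (Rle_lt_dec x (1 / 2)) as [H|H].
    - destruct (Hgen x ltac:(lra) ltac:(lra)) as [c [Hc E]]. exists c.
      split; [lra|]. split; [apply Rabs_le; lra|exact E].
    - destruct (Hgen (x - h) ltac:(lra) ltac:(lra)) as [c [Hc E]]. exists c.
      split; [lra|]. split; [apply Rabs_le; lra|exact E]. }
  destruct Hc as [c [Ic [Hxc Hb]]].
  replace (c1i' f x - c1i' g x)
    with ((c1i' f c - c1i' g c) + ((c1i' f x - c1i' f c) - (c1i' g x - c1i' g c))) by ring.
  apply Rabs_plus_le; [exact Hb|].
  replace (2 * L * h) with (L * h + L * h) by ring.
  assert (L * Rabs (x - c) <= L * h) by (apply Rmult_le_compat_l; lra).
  apply Rabs_minus_le; (eapply Rle_trans; [|eassumption]); auto.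
Qed.

Lemma nth_app_diff (l1 r1 l2 r2 : list R) d : length l1 = length l2 ->
  (forall j, Rabs (nth j (l1 ++ r1) 0 - nth j (l2 ++ r2) 0) <= d) ->
  (forall j, Rabs (nth j l1 0 - nth j l2 0) <= d) /\
  (forall j, Rabs (nth j r1 0 - nth j r2 0) <= d).
Proof.
  intros E H. split; intros j.
  - destruct (Nat.lt_ge_cases j (length l1)) as [Hj|Hj].
    + specialize (H j). rewrite !app_nth1 in H by lia. exact H.
    + rewrite !nth_overflow by lia. rewrite Rminus_diag, Rabs_R0.
      eapply Rle_trans; [apply Rabs_pos|apply (H 0%nat)].
  - specialize (H (length l1 + j)%nat). rewrite !app_nth2 in H by lia.
    rewrite <- E in H. now replace (length l1 + j - length l1)%nat with j in H by lia.
Qed.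

Lemma nth_map_diff (f g : R -> R) pts d :
  (forall j, Rabs (nth j (map f pts) 0 - nth j (map g pts) 0) <= d) ->
  forall p, In p pts -> Rabs (f p - g p) <= d.
Proof.
  intros H p Hp. destruct (In_nth pts p 0 Hp) as [j [Hj E]]. specialize (H j).
  rewrite (nth_indep (map f pts) 0 (f 0)) in H by (rewrite length_map; exact Hj).
  rewrite (nth_indep (map g pts) 0 (g 0)) in H by (rewrite length_map; exact Hj).
  rewrite !map_nth, E in H. exact H.
Qed.

Lemma sampled_length pts f : length (sampled pts f) = sampled_dim pts.
Proof. unfold sampled, sampled_dim. rewrite !length_app, !length_map. simpl. lia. Qed.

Lemma near_samples pts f g d :
  near (sampled_dim pts) d (coords (sampled pts f)) (coords (sampled pts g)) ->
  (forall p, In p pts ->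
     Rabs (lambda f p - lambda g p) <= d /\ Rabs (mu f p - mu g p) <= d /\
     Rabs (sigma f p - sigma g p) <= d /\ Rabs (omega f p - omega g p) <= d /\
     Rabs (theta f p - theta g p) <= d) /\ Rabs (q f - q g) <= d.
Proof.
  intros H.
  assert (Hall : forall j, Rabs (nth j (sampled pts f) 0 - nth j (sampled pts g) 0) <= d).
  { intros j. destruct (Nat.lt_ge_cases j (sampled_dim pts)) as [Hj|Hj]; [now apply H|].
    rewrite !nth_overflow by (rewrite sampled_length; exact Hj).
    rewrite Rminus_diag, Rabs_R0. eapply Rle_trans; [apply Rabs_pos|].
    apply (H 0%nat). unfold sampled_dim. lia. }
  assert (Hlen : forall h h' : R -> R, length (map h pts) = length (map h' pts))
    by (intros; now rewrite !length_map).
  unfold sampled in Hall.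
  apply nth_app_diff in Hall as [H1 Hall]; [|apply Hlen].
  apply nth_app_diff in Hall as [H2 Hall]; [|apply Hlen].
  apply nth_app_diff in Hall as [H3 Hall]; [|apply Hlen].
  apply nth_app_diff in Hall as [H4 Hall]; [|apply Hlen].
  apply nth_app_diff in Hall as [H5 Hall]; [|apply Hlen].
  split; [|exact (Hall 0%nat)].
  intros p Hp.
  split; [now apply (nth_map_diff (lambda f) (lambda g) pts)|].
  split; [now apply (nth_map_diff (mu f) (mu g) pts)|].
  split; [now apply (nth_map_diff (sigma f) (sigma g) pts)|].
  split; [now apply (nth_map_diff (omega f) (omega g) pts)|].
  now apply (nth_map_diff (theta f) (theta g) pts).
Qed.

Definition grid (n : nat) : list R := map (fun j => INR j / INR n) (seq 0 (S n)).

Lemma grid_in n : (0 < n)%nat -> List.Forall I01 (grid n).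
Proof.
  intros Hn. apply Forall_forall. intros p Hp. apply in_map_iff in Hp.
  destruct Hp as [j [<- Hj]]. apply in_seq in Hj.
  assert (H0 : 0 < INR n) by now apply lt_0_INR.
  assert (INR j <= INR n) by (apply le_INR; lia). pose proof (pos_INR j).
  unfold I01. split; [apply Rdiv_le_0_compat; lra|]. apply Rle_div_l; lra.
Qed.

Lemma grid_dense n x : (0 < n)%nat -> I01 x ->
  exists p, In p (grid n) /\ Rabs (x - p) <= / INR n.
Proof.
  intros Hn [Hx0 Hx1].
  assert (H0 : 0 < INR n) by now apply lt_0_INR.
  destruct (nfloor_ex (INR n * x)) as [j [Hj1 Hj2]]. { apply Rmult_le_pos; lra. }
  exists (INR j / INR n). split.
  - apply in_map_iff. exists j. split; [reflexivity|]. apply in_seq.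
    assert (INR j <= INR n) by nra. apply INR_le in H. lia.
  - assert (E : x - INR j / INR n = (INR n * x - INR j) * / INR n) by (field; lra).
    assert (Hi : 0 < / INR n) by now apply Rinv_0_lt_compat.
    rewrite E, Rabs_mult, (Rabs_right (/ INR n)) by lra.
    rewrite <- (Rmult_1_l (/ INR n)) at 2. apply Rmult_le_compat_r; [lra|].
    rewrite Rabs_right; lra.
Qed.

Lemma lipschitz_close L g h d n : 0 <= L -> (0 < n)%nat -> lipschitz L g -> lipschitz L h ->
  (forall p, In p (grid n) -> Rabs (g p - h p) <= d) ->
  forall x, I01 x -> Rabs (g x - h x) <= d + 2 * L * / INR n.
Proof.
  intros HL Hn Hg Hh Hp x Hx.
  destruct (grid_dense n x Hn Hx) as [p [Hin Hd]].
  assert (Ip : I01 p) by (apply (proj1 (Forall_forall _ _) (grid_in n Hn)); exact Hin).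
  replace (g x - h x) with ((g p - h p) + ((g x - g p) - (h x - h p))) by ring.
  apply Rabs_plus_le; [auto|].
  replace (2 * L * / INR n) with (L * / INR n + L * / INR n) by ring.
  assert (L * Rabs (x - p) <= L * / INR n) by (apply Rmult_le_compat_l; lra).
  apply Rabs_minus_le; (eapply Rle_trans; [|eassumption]); auto.
Qed.

(** Between grid points the Lipschitz constant controls the error; the derivatives
    of [lambda] and [mu] are not sampled and are recovered from their values. *)
Lemma samples_determine b del : positive_constants b -> 0 < del ->
  exists pts d0, List.Forall I01 pts /\ 0 < d0 /\
    forall f g, in_class b f -> in_class b g ->
      near (sampled_dim pts) d0 (coords (sampled pts f)) (coords (sampled pts g)) ->
      coef_close del f g.
Proof.
  intros Hb Hdel. pose proof Hb as (?&?&?&?&?&?&?&?&?&HL&?).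
  set (L := Lip b) in *.
  set (h := Rmin (1 / 2) (del / (4 * L))).
  assert (Hq : 0 < del / (4 * L)) by (apply Rdiv_lt_0_compat; lra).
  assert (Hh : 0 < h) by (apply Rmin_glb_lt; lra).
  assert (Hh1 : h <= 1 / 2) by apply Rmin_l.
  assert (Hh2 : 2 * L * h <= del / 2).
  { apply Rle_trans with (2 * L * (del / (4 * L))).
    - apply Rmult_le_compat_l; [lra|apply Rmin_r].
    - right. field. lra. }
  set (rho := h * del / 4).
  assert (Hrho : 0 < rho) by (unfold rho; nra).
  assert (Hrho1 : 2 * rho / h = del / 2) by (unfold rho; field; lra).
  assert (Hrho2 : rho <= del) by (unfold rho; nra).
  destruct (INR_unbounded (4 * L / rho)) as [n Hn].
  assert (Hn0 : 0 < INR n).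
  { assert (0 < 4 * L / rho) by (apply Rdiv_lt_0_compat; lra). lra. }
  assert (Hn1 : (0 < n)%nat) by (apply INR_lt; exact Hn0).
  exists (grid n), (rho / 2). split; [now apply grid_in|]. split; [lra|].
  intros f g Hf Hg Hnear.
  destruct (near_samples _ _ _ _ Hnear) as [Hp Hqq].
  assert (Hgr : rho / 2 + 2 * L * / INR n <= rho).
  { assert (2 * L * / INR n <= rho / 2); [|lra].
    apply (Rmult_le_reg_r (INR n)); [lra|].
    rewrite Rmult_assoc, Rinv_l by lra.
    assert (4 * L / rho * rho <= INR n * rho) by (apply Rmult_le_compat_r; lra).
    replace (4 * L / rho * rho) with (4 * L) in H9 by (field; lra). lra. }
  assert (Hclose : forall a a' : R -> R, lipschitz L a -> lipschitz L a' ->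
    (forall p, In p (grid n) -> Rabs (a p - a' p) <= rho / 2) ->
    forall x, I01 x -> Rabs (a x - a' x) <= rho).
  { intros a a' Ha Ha' Hg' x Hx. eapply Rle_trans; [|exact Hgr].
    apply lipschitz_close; auto; lra. }
  assert (C1 : forall x, I01 x -> Rabs (lambda f x - lambda g x) <= rho).
  { apply Hclose; [apply (lambda_lip b f Hf)|apply (lambda_lip b g Hg)|intros; now apply Hp]. }
  assert (C2 : forall x, I01 x -> Rabs (mu f x - mu g x) <= rho).
  { apply Hclose; [apply (mu_lip b f Hf)|apply (mu_lip b g Hg)|intros; now apply Hp]. }
  assert (C3 : forall x, I01 x -> Rabs (sigma f x - sigma g x) <= rho).
  { apply Hclose; [apply (sigma_lip b f Hf)|apply (sigma_lip b g Hg)|intros; now apply Hp]. }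
  assert (C4 : forall x, I01 x -> Rabs (omega f x - omega g x) <= rho).
  { apply Hclose; [apply (omega_lip b f Hf)|apply (omega_lip b g Hg)|intros; now apply Hp]. }
  assert (C5 : forall x, I01 x -> Rabs (theta f x - theta g x) <= rho).
  { apply Hclose; [apply (theta_lip b f Hf)|apply (theta_lip b g Hg)|intros; now apply Hp]. }
  constructor.
  - intros x Hx. specialize (C1 x Hx). lra.
  - intros x Hx. specialize (C2 x Hx). lra.
  - intros x Hx. specialize (C3 x Hx). lra.
  - intros x Hx. specialize (C4 x Hx). lra.
  - intros x Hx. specialize (C5 x Hx). lra.
  - intros x Hx. unfold lambda'.
    eapply Rle_trans; [apply (derivative_close (lambda f) (lambda g) L h rho); auto; try lra|lra].
    + apply (lambda'_lip b f Hf).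
    + apply (lambda'_lip b g Hg).
  - intros x Hx. unfold mu'.
    eapply Rle_trans; [apply (derivative_close (mu f) (mu g) L h rho); auto; try lra|lra].
    + apply (mu'_lip b f Hf).
    + apply (mu'_lip b g Hg).
  - lra.
Qed.

Definition sample_sup (b : class_constants) : R :=
  B_lambda b + B_mu b + B_sigma b + B_omega b + B_theta b + B_lambda' b + B_mu' b + B_q b.

Lemma samples_in_box b pts f : positive_constants b -> List.Forall I01 pts -> in_class b f ->
  in_box (sampled_dim pts) (sample_sup b) (coords (sampled pts f)).
Proof.
  intros (?&?&?&?&?&?&?&?&?&?&?) Hpts Hf j _. unfold coords.
  assert (Hs : forall B, 0 < B -> B <= sample_sup b -> forall g : R -> R, sup_le B g ->
    forall y, In y (map g pts) -> Rabs y <= sample_sup b).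
  { intros B HB HB' g Hg y Hy. apply in_map_iff in Hy. destruct Hy as [p [<- Hp]].
    eapply Rle_trans; [|exact HB']. apply Hg. exact (proj1 (Forall_forall _ _) Hpts p Hp). }
  destruct (nth_in_or_default j (sampled pts f) 0) as [Hin| ->].
  - set (y := nth j (sampled pts f) 0) in *. clearbody y.
    unfold sampled in Hin. rewrite !in_app_iff in Hin.
    destruct Hin as [Hi|[Hi|[Hi|[Hi|[Hi|[Hi|[]]]]]]].
    + apply (Hs (B_lambda b)) in Hi; auto; [unfold sample_sup; lra|apply (lambda_sup b f Hf)].
    + apply (Hs (B_mu b)) in Hi; auto; [unfold sample_sup; lra|apply (mu_sup b f Hf)].
    + apply (Hs (B_sigma b)) in Hi; auto; [unfold sample_sup; lra|apply (sigma_sup b f Hf)].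
    + apply (Hs (B_omega b)) in Hi; auto; [unfold sample_sup; lra|apply (omega_sup b f Hf)].
    + apply (Hs (B_theta b)) in Hi; auto; [unfold sample_sup; lra|apply (theta_sup b f Hf)].
    + rewrite <- Hi. pose proof (q_bound b f Hf). unfold sample_sup. lra.
  - rewrite Rabs_R0. unfold sample_sup. lra.
Qed.

(** * Stability of [kappa] and [c] *)

Lemma cont_T_C0_I (g : C0_I) : cont_T (fun x _ => g x).
Proof.
  intros x xi HT eps He. destruct (T_I01 _ _ HT) as [Ix _].
  destruct (C0_I_eps g x Ix eps He) as [d [Hd H]]. exists d. split; [exact Hd|].
  intros x' xi' HT' A1 _. apply H; [apply (T_I01 _ _ HT')|exact A1].
Qed.

Lemma volterra_sup_bound kap g k F M : 0 < M -> 0 <= F -> cont_T kap -> cont_T k ->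
  (forall x xi, T x xi -> Rabs (k x xi) <= M) ->
  (forall x xi, T x xi -> Rabs (g x xi) <= F) ->
  (forall x xi, T x xi -> kap x xi = g x xi + volterra kap k x xi) ->
  forall x xi, T x xi -> Rabs (kap x xi) <= 2 * F * exp (2 * M).
Proof.
  intros HM HF Hc Hk HkM Hg E. apply volterra_gronwall; auto.
  intros x xi HT. rewrite E by assumption. apply Rabs_plus_le; [auto|].
  now apply Rabs_volterra_le.
Qed.

Lemma volterra_product_diff a a' b b' A M da db x xi : T x xi ->
  cont_T a -> cont_T a' -> cont_T b -> cont_T b' -> 0 <= A -> 0 <= M -> 0 <= da -> 0 <= db ->
  (forall x xi, T x xi -> Rabs (a' x xi) <= A) ->
  (forall x xi, T x xi -> Rabs (b x xi) <= M) ->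
  (forall x xi, T x xi -> Rabs (a x xi - a' x xi) <= da) ->
  (forall x xi, T x xi -> Rabs (b x xi - b' x xi) <= db) ->
  Rabs (volterra a b x xi - volterra a' b' x xi) <= da * M + A * db.
Proof.
  intros HT Ha Ha' Hb Hb' HA HM Hda Hdb A' B' Da Db.
  replace (volterra a b x xi - volterra a' b' x xi)
    with ((volterra a b x xi - volterra a' b x xi)
      + (volterra a' b x xi - volterra a' b' x xi)) by ring.
  rewrite volterra_minus_l, volterra_minus_r by assumption.
  apply Rabs_plus_le; apply volterra_bound; auto; now apply cont_T_minus.
Qed.

(** The difference of two solutions solves a Volterra equation with the first
    kernel, so the a priori bound applies to it. *)
Lemma volterra_stability kap g k kap' g' k' M A D d :
  0 < M -> 0 <= A -> 0 <= D -> 0 <= d ->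
  cont_T kap -> cont_T k -> cont_T kap' -> cont_T k' ->
  (forall x xi, T x xi -> Rabs (k x xi) <= M) ->
  (forall x xi, T x xi -> Rabs (kap' x xi) <= A) ->
  (forall x xi, T x xi -> Rabs (k x xi - k' x xi) <= d) ->
  (forall x xi, T x xi -> Rabs (g x xi - g' x xi) <= D) ->
  (forall x xi, T x xi -> kap x xi = g x xi + volterra kap k x xi) ->
  (forall x xi, T x xi -> kap' x xi = g' x xi + volterra kap' k' x xi) ->
  forall x xi, T x xi -> Rabs (kap x xi - kap' x xi) <= 2 * (D + A * d) * exp (2 * M).
Proof.
  intros HM HA HD Hd C1 C2 C3 C4 Hk Hkap' Hkk Hgg E E'.
  apply (volterra_sup_bound (fun x xi => kap x xi - kap' x xi)
    (fun x xi => (g x xi - g' x xi) + (volterra kap' k x xi - volterra kap' k' x xi)) k); auto.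
  - assert (0 <= A * d) by now apply Rmult_le_pos. lra.
  - now apply cont_T_minus.
  - intros x xi HT. apply Rabs_plus_le; [auto|].
    rewrite volterra_minus_r by assumption.
    apply volterra_bound; auto. now apply cont_T_minus.
  - intros x xi HT. rewrite <- volterra_minus_l by assumption.
    rewrite E, E' by assumption. ring.
Qed.

Lemma product_diff_le a a' b b' da db A M :
  Rabs (a - a') <= da -> Rabs (b - b') <= db -> Rabs a' <= A -> Rabs b <= M ->
  Rabs (a * b - a' * b') <= da * M + A * db.
Proof.
  intros H1 H2 H3 H4. replace (a * b - a' * b') with ((a - a') * b + a' * (b - b')) by ring.
  apply Rabs_plus_le; now apply Rabs_mult_le.
Qed.

(** * Both neural operators *)

(** The networks interpolate between finitely many of these.  Existence of the
    kernels is part of the record, so that only coefficients with kernels serve as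
    representatives. *)
Record solved (b : class_constants) : Type := {
  sv_f : coefficients;
  sv_k : kernels;
  sv_kappa : C0_T;
  sv_class : in_class b sv_f;
  sv_K : is_K sv_f sv_k;
  sv_is_kappa : is_kappa sv_f sv_k sv_kappa }.

Arguments sv_f {b} _. Arguments sv_k {b} _. Arguments sv_kappa {b} _.
Arguments sv_class {b} _. Arguments sv_K {b} _. Arguments sv_is_kappa {b} _.

Lemma kappa_c_bound b : positive_constants b -> exists M, 0 < M /\
  forall (o : solved b) x xi, T x xi ->
    Rabs (sv_kappa o x xi) <= M /\ Rabs (c_of (sv_f o) (sv_k o) (sv_kappa o) x xi) <= M.
Proof.
  intros Hb. destruct (kernels_C1_bound b Hb) as [M [HM HMb]].
  pose proof Hb as (?&?&?&?&?&HBo&?&?&?&?&?).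
  set (F := B_omega b * M). assert (HF : 0 < F) by now apply Rmult_lt_0_compat.
  set (A := 2 * F * exp (2 * M)).
  assert (HA : 0 < A) by (apply Rmult_lt_0_compat; [lra|apply exp_pos]).
  assert (HAM : 0 < A * M) by now apply Rmult_lt_0_compat.
  exists (A + F + A * M). split; [lra|].
  intros o.
  assert (Hkap : forall x xi, T x xi -> Rabs (sv_kappa o x xi) <= A).
  { apply (volterra_sup_bound _ (fun x xi => omega (sv_f o) x * k2 (sv_k o) x xi) (k2 (sv_k o)));
      auto; [lra|apply C0_T_cont|apply C1_T_cont| | |exact (sv_is_kappa o)].
    - intros x xi HT. apply (HMb _ _ (sv_class o) (sv_K o) K_k2 x xi HT).
    - intros x xi HT. apply Rabs_mult_le.
      + apply (omega_sup b _ (sv_class o)), (T_I01 _ _ HT).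
      + apply (HMb _ _ (sv_class o) (sv_K o) K_k2 x xi HT). }
  assert (Hk1 : forall x xi, T x xi -> Rabs (k1 (sv_k o) x xi) <= M)
    by (intros x xi HT; apply (HMb _ _ (sv_class o) (sv_K o) K_k1 x xi HT)).
  intros x xi HT. split.
  - specialize (Hkap x xi HT). lra.
  - apply Rle_trans with (F + A * M); [|lra]. unfold c_of. apply Rabs_plus_le.
    + apply Rabs_mult_le; [apply (omega_sup b _ (sv_class o)), (T_I01 _ _ HT)|auto].
    + apply (volterra_bound (sv_kappa o) (k1 (sv_k o))); auto; try lra;
        [apply C0_T_cont|apply C1_T_cont].
Qed.

Lemma kappa_c_stability b : positive_constants b -> exists M, 0 < M /\
  forall (o o' : solved b) del, 0 <= del -> coef_close del (sv_f o) (sv_f o') ->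
  forall x xi, T x xi ->
    Rabs (sv_kappa o x xi - sv_kappa o' x xi) <= M * del /\
    Rabs (c_of (sv_f o) (sv_k o) (sv_kappa o) x xi
          - c_of (sv_f o') (sv_k o') (sv_kappa o') x xi) <= M * del.
Proof.
  intros Hb. destruct (kernels_C1_bound b Hb) as [M [HM HMb]].
  destruct (kernels_stability b Hb) as [Ms [HMs Hst]].
  destruct (kappa_c_bound b Hb) as [A [HA HAb]].
  pose proof Hb as (?&?&?&?&?&HBo&?&?&?&?&?).
  set (D := M + B_omega b * Ms).
  set (C1 := 2 * (D + A * Ms) * exp (2 * M)).
  assert (P1 : 0 < B_omega b * Ms) by now apply Rmult_lt_0_compat.
  assert (P2 : 0 < A * Ms) by now apply Rmult_lt_0_compat.
  assert (P3 : 0 < C1) by (apply Rmult_lt_0_compat; [unfold D; lra|apply exp_pos]).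
  assert (P4 : 0 < C1 * M) by now apply Rmult_lt_0_compat.
  exists (C1 + D + C1 * M + A * Ms). split; [unfold D; lra|].
  intros o o' del Hdel Hcl.
  assert (HMsd : 0 <= Ms * del) by (apply Rmult_le_pos; lra).
  assert (HDd : 0 <= D * del) by (apply Rmult_le_pos; unfold D; lra).
  assert (Hkd : forall i x xi, T x xi ->
    Rabs (K_value (sv_k o) i x xi - K_value (sv_k o') i x xi) <= Ms * del).
  { intros i x xi HT. apply (Hst (sv_f o) (sv_k o) (sv_f o') (sv_k o')); auto;
      try apply sv_class; apply sv_K. }
  assert (Hb1 : forall i x xi, T x xi -> Rabs (K_value (sv_k o) i x xi) <= M).
  { intros i x xi HT. apply (HMb _ _ (sv_class o) (sv_K o) i x xi HT). }
  assert (Hg : forall i x xi, T x xi ->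
    Rabs (omega (sv_f o) x * K_value (sv_k o) i x xi
      - omega (sv_f o') x * K_value (sv_k o') i x xi) <= D * del).
  { intros i x xi HT. replace (D * del) with (del * M + B_omega b * (Ms * del)) by (unfold D; ring).
    apply product_diff_le; auto.
    - apply (cc_omega _ _ _ Hcl), (T_I01 _ _ HT).
    - apply (omega_sup b _ (sv_class o')), (T_I01 _ _ HT). }
  assert (Hkap : forall x xi, T x xi ->
    Rabs (sv_kappa o x xi - sv_kappa o' x xi) <= C1 * del).
  { intros x xi HT.
    replace (C1 * del) with (2 * (D * del + A * (Ms * del)) * exp (2 * M)) by (unfold C1; ring).
    apply (volterra_stability (sv_kappa o) (fun x xi => omega (sv_f o) x * k2 (sv_k o) x xi)
      (k2 (sv_k o)) (sv_kappa o') (fun x xi => omega (sv_f o') x * k2 (sv_k o') x xi)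
      (k2 (sv_k o')) M A); auto; try lra; try apply C0_T_cont; try apply C1_T_cont.
    - apply (Hb1 K_k2).
    - intros y eta HT'. apply (HAb o' y eta HT').
    - apply (Hkd K_k2).
    - apply (Hg K_k2).
    - exact (sv_is_kappa o).
    - exact (sv_is_kappa o'). }
  intros x xi HT. split.
  - eapply Rle_trans; [now apply Hkap|]. apply Rmult_le_compat_r; [exact Hdel|]. unfold D; lra.
  - apply Rle_trans with (D * del + (C1 * del * M + A * (Ms * del))).
    + unfold c_of.
      match goal with |- Rabs (?a + ?b - (?a' + ?b')) <= _ =>
        replace (a + b - (a' + b')) with ((a - a') + (b - b')) by ring end.
      apply Rabs_plus_le; [apply (Hg K_k1 x xi HT)|].
      apply (volterra_product_diff (sv_kappa o) (sv_kappa o') (k1 (sv_k o)) (k1 (sv_k o')));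
        auto; try lra; try apply C0_T_cont; try apply C1_T_cont.
      * apply Rmult_le_pos; lra.
      * intros y eta HT'. apply (HAb o' y eta HT').
      * apply (Hb1 K_k1).
      * apply (Hkd K_k1).
    + replace (D * del + (C1 * del * M + A * (Ms * del))) with ((D + C1 * M + A * Ms) * del) by ring.
      apply Rmult_le_compat_r; [exact Hdel|]. lra.
Qed.

Lemma lsum_convex {A : Type} (wl : list (R * A)) (g : A -> R) y e :
  (forall w, In w wl -> 0 <= fst w) -> lsum fst wl = 1 ->
  (forall w, In w wl -> Rabs (g (snd w) - y) <= e) ->
  Rabs (lsum (fun w => fst w * g (snd w)) wl - y) <= e.
Proof.
  intros H0 H1 H.
  assert (E : lsum (fun w => fst w * g (snd w)) wl - y
    = lsum (fun w => fst w * (g (snd w) - y)) wl).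
  { rewrite (lsum_ext (fun w => fst w * (g (snd w) - y))
      (fun w => fst w * g (snd w) + (- y) * fst w)) by (intros; ring).
    rewrite lsum_plus, lsum_scal, H1. ring. }
  rewrite E. apply Rle_trans with (lsum (fun w => e * fst w) wl).
  - apply lsum_abs. intros w Hw. rewrite Rmult_comm. apply Rabs_mult_le; [auto|].
    rewrite Rabs_right; [lra|]. apply Rle_ge. auto.
  - rewrite lsum_scal, H1. lra.
Qed.

Definition is_residual (i : M_index) : Prop :=
  match i with M_k1 | M_k2 | M_c | M_kappa => False | _ => True end.

(** These components restate the equations and boundary conditions of the exact
    kernels; the zero network represents them exactly. *)
Lemma M_value_residual b f k kappa i x xi : positive_constants b -> in_class b f -> is_K f k ->
  T x xi -> is_residual i -> M_value f k kappa i x xi = 0.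
Proof.
  intros Hb Hf [Hk Hm] HT Hi. destruct (T_I01 _ _ HT) as [Ix Ixi].
  pose proof (speed_min_pos b Hb).
  destruct (class_speed b f x Hf Ix).
  destruct i; try contradiction; simpl.
  - rewrite (bc_k1 _ _ _ Hk) by assumption. field. lra.
  - pose proof (bc_k2 _ _ _ Hk x Ix). lra.
  - pose proof (pde_k1 _ _ _ Hk x xi HT). lra.
  - pose proof (pde_k2 _ _ _ Hk x xi HT). lra.
  - pose proof (pde_m1 _ _ _ Hm x xi HT). lra.
  - pose proof (pde_m2 _ _ _ Hm x xi HT). lra.
  - rewrite (bc_m1 _ _ _ Hm) by assumption. field. lra.
  - apply (bc_m2 _ _ _ Hm xi Ixi).
Qed.

(** With no summands the output is exactly 0, for every activation. *)
Definition zero_deeponet (s d : nat) : deeponet s d :=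
  {| width := 0;
     branch := fun _ => Output s (fun _ => 0) 0;
     trunk := fun _ => Output d (fun _ => 0) 0 |}.

Lemma neural_operator_M (act : R -> R) (b : class_constants) (eps : R) :
  admissible_activation act -> positive_constants b -> 0 < eps ->
  exists Mhat : neural_operator M_index M_dim,
     forall (f : coefficients) (k : kernels) (kappa : C0_T),
       in_class b f -> is_K f k -> is_kappa f k kappa ->
       forall x xi : R, T x xi -> M_error act Mhat f k kappa x xi < eps.
Proof.
  intros Hact Hb Heps.
  destruct (kernels_C1_bound b Hb) as [M1 [HM1 HMb1]].
  destruct (kernels_stability b Hb) as [Ms [HMs Hst]].
  destruct (kappa_c_bound b Hb) as [A [HA HAb]].
  destruct (kappa_c_stability b Hb) as [As [HAs HAst]].
  set (e := eps / 20). assert (He : 0 < e) by (unfold e; lra).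
  set (del := e / (Ms + As)).
  assert (Hdel : 0 < del) by (apply Rdiv_lt_0_compat; lra).
  assert (Hdm : Ms * del <= e /\ As * del <= e).
  { assert (E : (Ms + As) * del = e) by (unfold del; field; lra).
    assert (0 < Ms * del) by (apply Rmult_lt_0_compat; lra).
    assert (0 < As * del) by (apply Rmult_lt_0_compat; lra). lra. }
  destruct (samples_determine b del Hb Hdel) as [pts [d0 [Hpts [Hd0 Hclose]]]].
  set (s := sampled_dim pts).
  set (G := fun (i : M_index) (_ : nat) (o : solved b) x xi =>
    M_value (sv_f o) (sv_k o) (sv_kappa o) i x xi).
  assert (HB : 0 < sample_sup b).
  { destruct Hb as (?&?&?&?&?&?&?&?&?&?&?). unfold sample_sup. lra. }
  destruct (convex_approximation act (solved b) M_index s (sample_sup b) (M1 + A)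
    (fun o => coords (sampled pts (sv_f o))) G (fun ch => ch = 0%nat)) with (del := d0) (eta := e)
    as [l Hl]; auto.
  - unfold s, sampled_dim. lia.
  - lra.
  - intros o. apply samples_in_box; auto. apply sv_class.
  - intros i ch o x xi _ HT. unfold G.
    destruct (classic (is_residual i)) as [Hi|Hi].
    + rewrite (M_value_residual b) by (auto; try apply sv_class; apply sv_K).
      rewrite Rabs_R0. lra.
    + destruct (HAb o x xi HT).
      destruct i; simpl in Hi; try (exfalso; now apply Hi).
      * destruct (HMb1 _ _ (sv_class o) (sv_K o) K_k1 x xi HT) as [Hk _]. simpl in *. lra.
      * destruct (HMb1 _ _ (sv_class o) (sv_K o) K_k2 x xi HT) as [Hk _]. simpl in *. lra.
      * simpl. lra.
      * simpl. lra.
  - intros i o e' He'.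
    destruct (classic (is_residual i)) as [Hi|Hi].
    + exists []. intros ch x xi -> HT. unfold G.
      rewrite (M_value_residual b) by (auto; try apply sv_class; apply sv_K).
      simpl. rewrite Rminus_diag, Rabs_R0. lra.
    + assert (Hc : cont_T (M_value (sv_f o) (sv_k o) (sv_kappa o) i)).
      { destruct i; simpl in Hi; try (exfalso; now apply Hi).
        - apply C1_T_cont.
        - apply C1_T_cont.
        - apply (cont_T_plus (fun x xi => omega (sv_f o) x * k1 (sv_k o) x xi)
            (volterra (sv_kappa o) (k1 (sv_k o)))).
          + apply (cont_T_mult (fun x _ => omega (sv_f o) x)); [apply cont_T_C0_I|apply C1_T_cont].
          + apply cont_T_volterra; [apply C0_T_cont|apply C1_T_cont].
        - apply C0_T_cont. }
      destruct (net_approx_C0_T act _ e' Hact Hc He') as [l Hl].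
      exists l. intros ch x xi -> HT. apply (Hl x xi HT).
  - set (comp := fun i : M_index => match i return deeponet s (M_dim i) with
      | M_k1 => deeponet_of s l M_k1 | M_k2 => deeponet_of s l M_k2
      | M_c => deeponet_of s l M_c | M_kappa => deeponet_of s l M_kappa
      | i => zero_deeponet s (M_dim i) end).
    exists (Build_neural_operator M_index M_dim pts Hpts comp).
    intros f k kappa Hf HK Hkappa x xi HT.
    set (o := Build_solved b f k kappa Hf HK Hkappa).
    destruct (Hl o) as [wl [Hw [Hone Happ]]].
    assert (Hmain : forall i, ~ is_residual i ->
      Rabs (M_value f k kappa i x xi
        - deeponet_eval act (deeponet_of s l i) (sampled pts f) [x; xi]) <= 2 * e).
    { intros i Hi. rewrite deeponet_of_eval.
      specialize (Happ i 0%nat x xi eq_refl HT). cbn [sv_f o] in Happ.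
      assert (Hcv : Rabs (lsum (fun w => fst w * G i 0%nat (snd w) x xi) wl
        - M_value f k kappa i x xi) <= e).
      { apply (lsum_convex wl (fun o' => G i 0%nat o' x xi)); auto.
        - intros w Hin. apply (Hw w Hin).
        - intros w Hin. destruct (Hw w Hin) as [_ Hn].
          assert (Hcl : coef_close del (sv_f (snd w)) f)
            by (apply Hclose; [apply sv_class|exact Hf|exact Hn]).
          destruct (HAst (snd w) o del ltac:(lra) Hcl x xi HT) as [S1 S2].
          pose proof (fun i => Hst _ _ _ _ del (sv_class (snd w)) (sv_K (snd w)) Hf HK
            ltac:(lra) Hcl i x xi HT) as S3.
          unfold G. destruct i; simpl in Hi; try (exfalso; now apply Hi); simpl.
          + specialize (S3 K_k1). simpl in S3. lra.
          + specialize (S3 K_k2). simpl in S3. lra.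
          + simpl in S2. lra.
          + simpl in S1. lra. }
      match type of Happ with Rabs (?a - ?m) <= _ =>
        replace (M_value f k kappa i x xi - a) with (- ((a - m) + (m - M_value f k kappa i x xi)))
          by ring end.
      rewrite Rabs_Ropp. replace (2 * e) with (e + e) by ring. now apply Rabs_plus_le. }
    assert (Hres : forall i, is_residual i ->
      Rabs (M_value f k kappa i x xi
        - operator_eval act (Build_neural_operator M_index M_dim pts Hpts comp) f i
            (M_point i x xi)) = 0).
    { intros i Hi. rewrite (M_value_residual b) by assumption.
      replace (operator_eval act (Build_neural_operator M_index M_dim pts Hpts comp) f i
        (M_point i x xi)) with 0.
      - now rewrite Rminus_diag, Rabs_R0.
      - destruct i; try contradiction; reflexivity. }
    unfold M_error, M_indices. cbn [map fold_right].
    rewrite (Hres M_K1 I), (Hres M_K2 I), (Hres M_K3 I), (Hres M_K4 I),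
      (Hres M_K5 I), (Hres M_K6 I), (Hres M_K7 I), (Hres M_K8 I).
    set (Op := Build_neural_operator M_index M_dim pts Hpts comp).
    assert (E1 : Rabs (M_value f k kappa M_k1 x xi
      - operator_eval act Op f M_k1 (M_point M_k1 x xi)) <= 2 * e) by exact (Hmain M_k1 (fun h => h)).
    assert (E2 : Rabs (M_value f k kappa M_k2 x xi
      - operator_eval act Op f M_k2 (M_point M_k2 x xi)) <= 2 * e) by exact (Hmain M_k2 (fun h => h)).
    assert (E3 : Rabs (M_value f k kappa M_c x xi
      - operator_eval act Op f M_c (M_point M_c x xi)) <= 2 * e) by exact (Hmain M_c (fun h => h)).
    assert (E4 : Rabs (M_value f k kappa M_kappa x xi
      - operator_eval act Op f M_kappa (M_point M_kappa x xi)) <= 2 * e)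
      by exact (Hmain M_kappa (fun h => h)).
    unfold e in *. lra.
Qed.

(** Here [sum_j a_j t_j] stands for one of the differential equations, [t0] for the
    exact kernels and their derivatives and [h] for those of the network.  Closeness
    of [h] to [t0] in C1 is not at hand; instead each [t] is annihilated by its own
    coefficients [b], which are close to [a]. *)
Lemma residual_small {A : Type} (n : nat) (a t0 h : nat -> R) (b t : A -> nat -> R)
    (wl : list (R * A)) (del eta B M : R) :
  0 <= del -> 0 <= eta -> 0 <= B -> 0 <= M ->
  (forall w, In w wl -> 0 <= fst w) -> lsum fst wl = 1 ->
  (forall j, (j < n)%nat -> Rabs (a j) <= B) ->
  sum_below n (fun j => a j * t0 j) = 0 ->
  (forall w, In w wl -> sum_below n (fun j => b (snd w) j * t (snd w) j) = 0) ->
  (forall w j, In w wl -> (j < n)%nat -> Rabs (a j - b (snd w) j) <= del) ->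
  (forall w j, In w wl -> (j < n)%nat -> Rabs (t (snd w) j) <= M) ->
  (forall j, (j < n)%nat -> Rabs (h j - lsum (fun w => fst w * t (snd w) j) wl) <= eta) ->
  Rabs (sum_below n (fun j => a j * (t0 j - h j))) <= INR n * (B * eta) + INR n * (del * M).
Proof.
  intros Hdel Heta HB HM Hpos Hone Ha H0 Hb Hab Ht Hh.
  set (m := fun j => lsum (fun w => fst w * t (snd w) j) wl).
  assert (E : sum_below n (fun j => a j * (t0 j - h j))
    = - (sum_below n (fun j => a j * (h j - m j))
         + lsum (fun w => fst w * sum_below n (fun j => (a j - b (snd w) j) * t (snd w) j)) wl)).
  { assert (E1 : lsum (fun w => fst w * sum_below n (fun j => (a j - b (snd w) j) * t (snd w) j)) wl
      = sum_below n (fun j => a j * m j)).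
    { transitivity (lsum (fun w => fst w * sum_below n (fun j => a j * t (snd w) j)) wl).
      - apply lsum_ext. intros w Hw.
        rewrite (sum_below_ext n (fun j => (a j - b (snd w) j) * t (snd w) j)
          (fun j => a j * t (snd w) j + (-1) * (b (snd w) j * t (snd w) j))) by (intros; ring).
        rewrite sum_below_plus, sum_below_scal, Hb by assumption. ring.
      - clear. unfold m. induction n as [|n IH]; simpl.
        + rewrite (lsum_ext _ (fun w => 0 * fst w)) by (intros; ring). rewrite lsum_scal. ring.
        + rewrite <- IH, <- lsum_scal, <- lsum_plus. apply lsum_ext. intros. ring. }
    rewrite E1, <- sum_below_plus.
    transitivity (sum_below n (fun j => a j * t0 j) + (-1) * sum_below n (fun j => a j * h j)).
    - rewrite <- sum_below_scal, <- sum_below_plus. apply sum_below_ext. intros. ring.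
    - rewrite H0, Rplus_0_l, (sum_below_ext n (fun j => a j * (h j - m j) + a j * m j)
        (fun j => a j * h j)) by (intros; ring). ring. }
  rewrite E, Rabs_Ropp. apply Rabs_plus_le.
  - rewrite <- sum_below_const. apply sum_below_bound. intros j Hj. apply Rabs_mult_le;
      [now apply Ha|now apply Hh].
  - rewrite <- (Rminus_0_r (lsum _ _)).
    apply (lsum_convex wl (fun o => sum_below n (fun j => (a j - b o j) * t o j))); auto.
    intros w Hw. rewrite Rminus_0_r, <- sum_below_const. apply sum_below_bound.
    intros j Hj. apply Rabs_mult_le; auto.
Qed.

Definition K_channel (k : kernels) (i : K_index) (ch : nat) : R -> R -> R :=
  match ch with
  | O => K_value k i
  | 1%nat => d_x (K_value k i)
  | _ => d_xi (K_value k i)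
  end.

Lemma neural_operator_K (act : R -> R) (b : class_constants) (eps : R) :
  admissible_activation act -> positive_constants b -> 0 < eps ->
  exists Khat : neural_operator K_index K_dim,
     forall (f : coefficients) (k : kernels) (kappa : C0_T),
       in_class b f -> is_K f k -> is_kappa f k kappa ->
       exists (kh : kernels) (kappah : C0_T),
         is_K_hat act Khat f kh /\ is_kappa f kh kappah /\
         forall x xi : R, T x xi -> K_error f k kh kappa kappah x xi < eps.
Proof.
  intros Hact Hb Heps.
  destruct (kernels_C1_bound b Hb) as [M [HM HMb]].
  destruct (kernels_stability b Hb) as [Ms [HMs Hst]].
  destruct (kappa_c_bound b Hb) as [A [HA HAb]].
  pose proof Hb as (?&?&HBl&HBm&HBs&HBo&HBt&HBl'&HBm'&HLip&HBq).
  set (Bs := sample_sup b).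
  assert (HBs0 : 0 < Bs) by (unfold Bs, sample_sup; lra).
  set (C3 := 2 * (Bs + A) * exp (2 * (M + 1))).
  assert (HC3 : 0 < C3) by (apply Rmult_lt_0_compat; [lra|apply exp_pos]).
  set (C4 := Bs + (C3 * (M + 1) + A)).
  assert (HC4 : 0 < C4).
  { assert (0 < C3 * (M + 1)) by (apply Rmult_lt_0_compat; lra). unfold C4. lra. }
  set (Ct := 2 + C3 + C4 + 2 * Bs + (Bs * Bs + Bs) + 4 * (5 * Bs + 5 * M)).
  assert (HBB : 0 < Bs * Bs) by now apply Rmult_lt_0_compat.
  assert (HCt : 0 < Ct) by (unfold Ct; lra).
  set (tau := eps / (2 * Ct)).
  assert (Htau : 0 < tau) by (apply Rdiv_lt_0_compat; lra).
  assert (HCtau : Ct * tau = eps / 2) by (unfold tau; field; lra).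
  set (eta := Rmin 1 (tau / 2)).
  assert (Heta : 0 < eta) by (apply Rmin_glb_lt; lra).
  assert (Heta1 : eta <= 1) by apply Rmin_l.
  assert (Heta2 : eta <= tau / 2) by apply Rmin_r.
  set (del := tau / (2 * Ms + 1)).
  assert (Hdel : 0 < del) by (apply Rdiv_lt_0_compat; lra).
  assert (HdE : (2 * Ms + 1) * del = tau) by (unfold del; field; lra).
  assert (HMsd : 0 < Ms * del) by now apply Rmult_lt_0_compat.
  assert (Hdt : del <= tau) by lra.
  assert (Hrho : Ms * del + eta <= tau) by lra.
  destruct (samples_determine b del Hb Hdel) as [pts [d0 [Hpts [Hd0 Hclose]]]].
  set (s := sampled_dim pts).
  set (G := fun (i : K_index) (ch : nat) (o : solved b) => K_channel (sv_k o) i ch).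
  assert (HGM : forall i ch (o : solved b) x xi, T x xi -> Rabs (G i ch o x xi) <= M).
  { intros i ch o x xi HT. destruct (HMb _ _ (sv_class o) (sv_K o) i x xi HT) as [E1 [E2 E3]].
    unfold G. destruct ch as [|[|ch]]; simpl; assumption. }
  destruct (convex_approximation act (solved b) K_index s Bs M
    (fun o => coords (sampled pts (sv_f o))) G (fun ch => (ch < 3)%nat)) with (del := d0) (eta := eta)
    as [l Hl]; auto.
  - unfold s, sampled_dim. lia.
  - intros o. apply samples_in_box; auto. apply sv_class.
  - intros i o e' He'.
    destruct (net_approx_C1_T act (K_value (sv_k o) i) e' Hact He') as [l Hl].
    exists l. intros ch x xi Hch HT. destruct (Hl x xi HT) as [E1 [E2 E3]].
    destruct ch as [|[|[|ch]]]; [exact E1|exact E2|exact E3|lia].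
  - exists (Build_neural_operator K_index K_dim pts Hpts (fun i =>
      match i return deeponet s (K_dim i) with
      | K_k1 => deeponet_of s l K_k1 | K_k2 => deeponet_of s l K_k2
      | K_m1 => deeponet_of s l K_m1 | K_m2 => deeponet_of s l K_m2 end)).
    intros f k kappa Hf HK Hkappa.
    set (o := Build_solved b f k kappa Hf HK Hkappa).
    destruct (Hl o) as [wl [Hw [Hone Happ]]]. cbn [sv_f o] in Happ.
    assert (Hpos : forall w, In w wl -> 0 <= fst w) by (intros w Hin; apply (Hw w Hin)).
    assert (Hcl : forall w, In w wl -> coef_close del f (sv_f (snd w))).
    { intros w Hin. apply Hclose; [exact Hf|apply sv_class|].
      destruct (Hw w Hin) as [_ Hn]. intros j Hj. rewrite Rabs_minus_sym. now apply Hn. }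
    assert (Hnet : forall i, exists u : C1_T, forall x xi,
      u x xi = channel_eval act (assembled act s l i (coords (sampled pts f))) 0 (coords [x; xi]) /\
      d_x u x xi = channel_eval act (assembled act s l i (coords (sampled pts f))) 1 (coords [x; xi]) /\
      d_xi u x xi = channel_eval act (assembled act s l i (coords (sampled pts f))) 2 (coords [x; xi]))
      by (intros i; apply shallow_C1_T, Hact).
    destruct (functional_choice _ Hnet) as [net Hnet'].
    set (kh := {| k1 := net K_k1; k2 := net K_k2; m1 := net K_m1; m2 := net K_m2 |}).
    assert (EK : forall i, K_value kh i = net i) by (intros []; reflexivity).
    assert (Hch : forall i ch x xi, (ch < 3)%nat -> T x xi ->
      Rabs (K_channel kh i ch x xi - lsum (fun w => fst w * G i ch (snd w) x xi) wl) <= eta).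
    { intros i ch x xi Hc HT. specialize (Happ i ch x xi Hc HT).
      destruct (Hnet' i x xi) as [E1 [E2 E3]].
      destruct ch as [|[|[|ch]]]; [| | |lia]; unfold K_channel; rewrite EK.
      - rewrite E1. exact Happ.
      - rewrite E2. exact Happ.
      - rewrite E3. exact Happ. }
    (* the kernels of nearby coefficients are close in the sup norm *)
    assert (Hval : forall i x xi, T x xi -> Rabs (K_value k i x xi - K_value kh i x xi) <= tau).
    { intros i x xi HT. specialize (Hch i 0%nat x xi ltac:(lia) HT).
      assert (Hcv : Rabs (lsum (fun w => fst w * G i 0%nat (snd w) x xi) wl
        - K_value k i x xi) <= Ms * del).
      { apply (lsum_convex wl (fun o' => G i 0%nat o' x xi)); auto.
        intros w Hin. rewrite Rabs_minus_sym.
        apply (Hst f k (sv_f (snd w)) (sv_k (snd w))); auto;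
          [apply sv_class|apply sv_K|lra]. }
      unfold K_channel in Hch.
      match type of Hch with Rabs (?a - ?m) <= _ =>
        replace (K_value k i x xi - a) with (- ((a - m) + (m - K_value k i x xi))) by ring end.
      rewrite Rabs_Ropp. eapply Rle_trans; [apply Rabs_plus_le; eassumption|]. lra. }
    assert (HkhM : forall i x xi, T x xi -> Rabs (K_value kh i x xi) <= M + 1).
    { intros i x xi HT. specialize (Hch i 0%nat x xi ltac:(lia) HT). unfold K_channel in Hch.
      match type of Hch with Rabs (?a - ?m) <= _ => replace a with ((a - m) + (m - 0)) by ring end.
      rewrite Rplus_comm. apply Rabs_plus_le; [|lra].
      apply (lsum_convex wl (fun o' => G i 0%nat o' x xi)); auto.
      intros w Hin. rewrite Rminus_0_r. now apply HGM. }
    destruct (volterra_solution (fun x xi => omega f x * k2 kh x xi) (k2 kh)) as [kappah Hkaph].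
    { apply (cont_T_mult (fun x _ => omega f x)); [apply cont_T_C0_I|apply C1_T_cont]. }
    { apply C1_T_cont. }
    exists kh, kappah. split; [|split; [exact Hkaph|]].
    + intros i x xi HT. rewrite EK. destruct (Hnet' i x xi) as [-> _].
      unfold operator_eval. cbn [component sample_points K_point].
      destruct i; symmetry; apply (deeponet_of_eval act s K_index l).
    + assert (Bom : forall x, I01 x -> Rabs (omega f x) <= Bs).
      { intros x Hx. pose proof (omega_sup b f Hf x Hx). unfold Bs, sample_sup. lra. }
      assert (Hkap : forall x xi, T x xi -> Rabs (kappa x xi - kappah x xi) <= C3 * tau).
      { intros x xi HT. rewrite Rabs_minus_sym.
        replace (C3 * tau) with (2 * (Bs * tau + A * tau) * exp (2 * (M + 1))) by (unfold C3; ring).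
        apply (volterra_stability kappah (fun x xi => omega f x * k2 kh x xi) (k2 kh)
          kappa (fun x xi => omega f x * k2 k x xi) (k2 k) (M + 1) A (Bs * tau) tau);
          auto; try apply C0_T_cont; try apply C1_T_cont; try lra.
        - apply Rmult_le_pos; lra.
        - apply (HkhM K_k2).
        - intros y y' HT'. apply (HAb o y y' HT').
        - intros y y' HT'. rewrite Rabs_minus_sym. now apply (Hval K_k2).
        - intros y y' HT'. rewrite <- Rmult_minus_distr_l. apply Rabs_mult_le.
          + apply Bom, (T_I01 _ _ HT').
          + rewrite Rabs_minus_sym. now apply (Hval K_k2). }
      intros x xi HT. destruct (T_I01 _ _ HT) as [Ix Ixi].
      assert (I0 : I01 0) by (unfold I01; lra).
      assert (Txx : T x x) by (unfold T, I01 in *; lra).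
      assert (Tx0 : T x 0) by (unfold T, I01 in *; lra).
      assert (Bl : forall x, I01 x -> Rabs (lambda f x) <= Bs).
      { intros y Hy. pose proof (lambda_sup b f Hf y Hy). unfold Bs, sample_sup. lra. }
      assert (Bm : forall x, I01 x -> Rabs (mu f x) <= Bs).
      { intros y Hy. pose proof (mu_sup b f Hf y Hy). unfold Bs, sample_sup. lra. }
      assert (Bsi : forall x, I01 x -> Rabs (sigma f x) <= Bs).
      { intros y Hy. pose proof (sigma_sup b f Hf y Hy). unfold Bs, sample_sup. lra. }
      assert (Bt : forall x, I01 x -> Rabs (theta f x) <= Bs).
      { intros y Hy. pose proof (theta_sup b f Hf y Hy). unfold Bs, sample_sup. lra. }
      assert (Bl' : forall x, I01 x -> Rabs (lambda' f x) <= Bs).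
      { intros y Hy. pose proof (lambda'_sup b f Hf y Hy). unfold Bs, sample_sup. lra. }
      assert (Bm' : forall x, I01 x -> Rabs (mu' f x) <= Bs).
      { intros y Hy. pose proof (mu'_sup b f Hf y Hy). unfold Bs, sample_sup. lra. }
      assert (Bq : Rabs (q f) <= Bs).
      { pose proof (q_bound b f Hf). unfold Bs, sample_sup. lra. }
      assert (Hres : forall (co : coefficients -> list R) (chan : list (K_index * nat)),
        length chan = 5%nat ->
        (forall g h, in_class b g -> is_K g h ->
           sum_below 5 (fun j => coords (co g) j
             * K_channel h (fst (nth j chan (K_k1, 0%nat))) (snd (nth j chan (K_k1, 0%nat))) x xi) = 0) ->
        (forall p, In p chan -> (snd p < 3)%nat) ->
        (forall j, (j < 5)%nat -> Rabs (coords (co f) j) <= Bs) ->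
        (forall g j, coef_close del f g -> (j < 5)%nat ->
           Rabs (coords (co f) j - coords (co g) j) <= del) ->
        Rabs (sum_below 5 (fun j => coords (co f) j *
          (K_channel k (fst (nth j chan (K_k1, 0%nat))) (snd (nth j chan (K_k1, 0%nat))) x xi
           - K_channel kh (fst (nth j chan (K_k1, 0%nat))) (snd (nth j chan (K_k1, 0%nat))) x xi)))
        <= 5 * Bs * tau + 5 * M * tau).
      { intros co chan Hlen Hz H3 Hco Hcc.
        eapply Rle_trans.
        - apply (residual_small 5 (coords (co f))
            (fun j => K_channel k (fst (nth j chan (K_k1, 0%nat))) (snd (nth j chan (K_k1, 0%nat))) x xi)
            (fun j => K_channel kh (fst (nth j chan (K_k1, 0%nat))) (snd (nth j chan (K_k1, 0%nat))) x xi)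
            (fun o : solved b => coords (co (sv_f o)))
            (fun (o : solved b) j => G (fst (nth j chan (K_k1, 0%nat))) (snd (nth j chan (K_k1, 0%nat))) o x xi)
            wl del eta Bs M); auto; try lra.
          + intros w Hin. apply (Hz (sv_f (snd w)) (sv_k (snd w))); [apply sv_class|apply sv_K].
          + intros j Hj. apply Hch; [|exact HT]. apply H3. apply nth_In. lia.
        - replace (INR 5) with 5 by (simpl; ring).
          assert (Bs * eta <= Bs * tau) by (apply Rmult_le_compat_l; lra).
          assert (del * M <= tau * M) by (apply Rmult_le_compat_r; lra). lra. }
      assert (H3 : forall p : K_index * nat, snd p = 0%nat \/ snd p = 1%nat \/ snd p = 2%nat ->
        (snd p < 3)%nat) by (intros; lia).
      assert (R1 := Hres (fun g => [- mu g x; lambda g xi; lambda' g xi; sigma g xi; theta g xi])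
        [(K_k1, 1%nat); (K_k1, 2%nat); (K_k1, 0%nat); (K_k1, 0%nat); (K_k2, 0%nat)] eq_refl).
      assert (R2 := Hres (fun g => [- mu g x; - mu g xi; - mu' g xi; omega g xi; 0])
        [(K_k2, 1%nat); (K_k2, 2%nat); (K_k2, 0%nat); (K_k1, 0%nat); (K_k1, 0%nat)] eq_refl).
      assert (R3 := Hres (fun g => [lambda g x; - mu g xi; - mu' g xi; - sigma g x; - omega g x])
        [(K_m1, 1%nat); (K_m1, 2%nat); (K_m1, 0%nat); (K_m1, 0%nat); (K_m2, 0%nat)] eq_refl).
      assert (R4 := Hres (fun g => [mu g x; mu g xi; mu' g xi; theta g x; 0])
        [(K_m2, 1%nat); (K_m2, 2%nat); (K_m2, 0%nat); (K_m1, 0%nat); (K_m1, 0%nat)] eq_refl).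
      clear Hres. unfold coords in R1, R2, R3, R4.
      assert (Hlt5 : forall P : nat -> Prop, P 0%nat -> P 1%nat -> P 2%nat -> P 3%nat -> P 4%nat ->
        forall j, (j < 5)%nat -> P j).
      { intros P ? ? ? ? ? j Hj. destruct j as [|[|[|[|[|j]]]]]; auto. lia. }
      assert (Hneg : forall a c, Rabs (- a - - c) = Rabs (a - c)).
      { intros a c. replace (- a - - c) with (- (a - c)) by ring. apply Rabs_Ropp. }
      assert (Hzero : Rabs (0 - 0) <= del) by (rewrite Rminus_diag, Rabs_R0; lra).
      assert (Hzero' : Rabs 0 <= Bs) by (rewrite Rabs_R0; lra).
      assert (Hin5 : forall chan : list (K_index * nat), List.Forall (fun p => (snd p < 3)%nat) chan ->
        forall p, In p chan -> (snd p < 3)%nat) by (intros ch HF; apply Forall_forall; exact HF).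
      specialize (R1 ltac:(intros g h Hg [Gk Gm]; simpl; pose proof (pde_k1 _ _ _ Gk x xi HT); lra)
        ltac:(apply Hin5; repeat constructor)
        ltac:(apply Hlt5; cbn [nth]; rewrite ?Rabs_Ropp; auto)
        ltac:(intros g j [? ? ? ? ? ? ? ?]; revert j; apply Hlt5; cbn [nth]; rewrite ?Hneg; auto)).
      specialize (R2 ltac:(intros g h Hg [Gk Gm]; simpl; pose proof (pde_k2 _ _ _ Gk x xi HT); lra)
        ltac:(apply Hin5; repeat constructor)
        ltac:(apply Hlt5; cbn [nth]; rewrite ?Rabs_Ropp; auto)
        ltac:(intros g j [? ? ? ? ? ? ? ?]; revert j; apply Hlt5; cbn [nth]; rewrite ?Hneg; auto)).
      specialize (R3 ltac:(intros g h Hg [Gk Gm]; simpl; pose proof (pde_m1 _ _ _ Gm x xi HT); lra)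
        ltac:(apply Hin5; repeat constructor)
        ltac:(apply Hlt5; cbn [nth]; rewrite ?Rabs_Ropp; auto)
        ltac:(intros g j [? ? ? ? ? ? ? ?]; revert j; apply Hlt5; cbn [nth]; rewrite ?Hneg; auto)).
      specialize (R4 ltac:(intros g h Hg [Gk Gm]; simpl; pose proof (pde_m2 _ _ _ Gm x xi HT); lra)
        ltac:(apply Hin5; repeat constructor)
        ltac:(apply Hlt5; cbn [nth]; rewrite ?Rabs_Ropp; auto)
        ltac:(intros g j [? ? ? ? ? ? ? ?]; revert j; apply Hlt5; cbn [nth]; rewrite ?Hneg; auto)).
      pose proof (Hval K_k1 x xi HT) as V1. pose proof (Hval K_k2 x xi HT) as V2.
      pose proof (Hval K_k1 x x Txx) as V1x.
      pose proof (Hval K_k1 x 0 Tx0) as V10. pose proof (Hval K_k2 x 0 Tx0) as V20.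
      cbn [sum_below nth fst snd K_channel K_value] in R1, R2, R3, R4, V1, V2, V1x, V10, V20.
      assert (Hc : Rabs (c_of f k kappa x xi - c_of f kh kappah x xi) <= C4 * tau).
      { unfold c_of.
        match goal with |- Rabs (?a + ?p - (?a' + ?p')) <= _ =>
          replace (a + p - (a' + p')) with ((a - a') + (- (p' - p))) by ring end.
        replace (C4 * tau) with (Bs * tau + (C3 * tau * (M + 1) + A * tau)) by (unfold C4; ring).
        apply Rabs_plus_le.
        - rewrite <- Rmult_minus_distr_l. apply Rabs_mult_le; auto.
        - rewrite Rabs_Ropp.
          apply (volterra_product_diff kappah kappa (k1 kh) (k1 k)); auto;
            try apply C0_T_cont; try apply C1_T_cont; try lra.
          + apply Rmult_le_pos; lra.
          + intros y y' HT'. apply (HAb o y y' HT').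
          + apply (HkhM K_k1).
          + intros y y' HT'. rewrite Rabs_minus_sym. auto.
          + intros y y' HT'. rewrite Rabs_minus_sym. now apply (Hval K_k1). }
      assert (Hd : Rabs ((lambda f x + mu f x) * (k1 k x x - k1 kh x x)) <= 2 * Bs * tau).
      { apply Rabs_mult_le; [|exact V1x]. replace (2 * Bs) with (Bs + Bs) by ring.
        apply Rabs_plus_le; auto. }
      assert (Hb0 : Rabs (lambda f 0 * q f * (k1 k x 0 - k1 kh x 0)
        - mu f 0 * (k2 k x 0 - k2 kh x 0)) <= (Bs * Bs + Bs) * tau).
      { replace ((Bs * Bs + Bs) * tau) with (Bs * Bs * tau + Bs * tau) by ring.
        apply Rabs_minus_le; apply Rabs_mult_le; auto. apply Rabs_mult_le; auto. }
      specialize (Hkap x xi HT).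
      unfold K_error. cbv zeta.
      assert (Q1 : forall a c e, Rabs a <= e -> a = c -> Rabs c <= e) by (intros; congruence).
      apply Rle_lt_trans with (Ct * tau); [|lra].
      replace (Ct * tau) with (tau + tau + C4 * tau + C3 * tau + 2 * Bs * tau + (Bs * Bs + Bs) * tau
        + (5 * Bs * tau + 5 * M * tau) + (5 * Bs * tau + 5 * M * tau)
        + (5 * Bs * tau + 5 * M * tau) + (5 * Bs * tau + 5 * M * tau)) by (unfold Ct; ring).
      repeat apply Rplus_le_compat; try assumption.
      * apply (Q1 _ _ _ R1). ring.
      * apply (Q1 _ _ _ R2). ring.
      * apply (Q1 _ _ _ R3). ring.
      * apply (Q1 _ _ _ R4). ring.
Qed.

Theorem theorem1
  (act : R -> R) (b : class_constants) (eps : R)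
  (hact : admissible_activation act)
  (hb : positive_constants b)
  (heps : 0 < eps) :
  (exists Mhat : neural_operator M_index M_dim,
     forall (f : coefficients) (k : kernels) (kappa : C0_T),
       in_class b f -> is_K f k -> is_kappa f k kappa ->
       forall x xi : R, T x xi -> M_error act Mhat f k kappa x xi < eps)
  /\
  (exists Khat : neural_operator K_index K_dim,
     forall (f : coefficients) (k : kernels) (kappa : C0_T),
       in_class b f -> is_K f k -> is_kappa f k kappa ->
       exists (kh : kernels) (kappah : C0_T),
         is_K_hat act Khat f kh /\ is_kappa f kh kappah /\
         forall x xi : R, T x xi -> K_error f k kh kappa kappah x xi < eps).
Proof.
  split.
  - now apply neural_operator_M.
  - now apply neural_operator_K.
Qed.
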